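(* Let $n\ge 2$ and let $X=M(\mathcal{S})$ be a slit Sierpi\'nski space corresponding to a sequence of slits $\mathcal{S}$ in a bounded open box $I\subset\mathbb{R}^n$. If $X$ is porous and its peripheral spheres are uniformly relatively separated (i.e. the slits of $\mathcal{S}$ are uniformly relatively separated in $I$), then the double $DX=DM(\mathcal{S})$ of $X$ is quasisymmetrically co-Hopfian.
   Context: QS co-Hopfian. A homeomorphism $f:(X,d_X)\to(Y,d_Y)$ is quasisymmetric (QS) if there is an increasing $\eta:[0,\infty)\to[0,\infty)$ with $\frac{d_Y(f(x),f(y))}{d_Y(f(y),f(z))}\le \eta\left(\frac{d_X(x,y)}{d_X(y,z)}\right)$ for all distinct $x,y,z\in X$. A QS embedding is a QS homeomorphism onto its image. $X$ is QS co-Hopfian if every QS embedding of $X$ into itself is onto. Slits. Let $n\ge2$ and let $I=(a_1,b_1)\times\cdots\times(a_n,b_n)\subset\mathbb{R}^n$ be a bounded open box. A slit in $I$ is a set $s=\{x\}\times[c_2,d_2]\times\cdots\times[c_n,d_n]\subset I$ with $d_2-c_2=\dots=d_n-c_n=:l(s)>0$. Consider a sequence $\mathcal{S}=\{s_i\}_{i\ge1}$ of pairwise disjoint slits in $I$ satisfying: ($\mathcal{S}_1$) the slits are uniformly relatively separated in $I$: there is $\sigma>0$ with $\Delta(s_i,s_j)\ge\sigma$ and $\Delta(s_i,\partial I)\ge\sigma$ for all $i\ne j$, where $\Delta(E,F)=\mathrm{dist}(E,F)/\min(\mathrm{diam}\,E,\mathrm{diam}\,F)$; ($\mathcal{S}_2$)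 $\mathrm{diam}(s_i)\to0$; ($\mathcal{S}_3$) $\bigcup_i s_i$ is dense in $I$. (These are standing assumptions for slit Sierpi\'nski spaces.) Slit Sierpi\'nski space. Put $S_0=I$, $S_i=I\setminus\bigcup_{j\le i}s_j$, and let $(\overline{M}_i,d_{\overline{M}_i})$ be the completion of $S_i$ in its inner (path) metric ($d(x,y)$ = infimum of Euclidean lengths of curves in $S_i$ joining $x,y$), with $\overline{M}_0=\overline I$. For $i\le j$ let $\tau_{i,j}:\overline{M}_j\to\overline{M}_i$ be the $1$-Lipschitz extension of the inclusion $S_j\subset S_i$. Then $M(\mathcal{S})=\varprojlim(\overline{M}_i,\tau_{i,j})$, with metric $d_{\mathcal{S}}(p,q)=\lim_i d_{\overline{M}_i}(p_i,q_i)$ for $p=(p_i)$, $q=(q_i)$, is the slit Sierpi\'nski space (of topological dimension $n-1$) corresponding to $\mathcal{S}$. Let $\tau_0:M(\mathcal{S})\to\overline I$, $p\mapsto p_0$. The peripheral spheres of $M(\mathcal{S})$ are the sets $\tau_0^{-1}(s_i)$ and the outer boundary (outer peripheral sphere) $\tau_0^{-1}(\partial I)$; they are topological $(n-1)$-spheres. Double. $DM(\mathcal{S})$ is obtained by gluing two copies of $M(\mathcal{S})$ along their outer boundaries by the identity, with the induced gluing path metric: the metric is $d_{\mathcal{S}}$ on each copy, and for $p,q$ in different copies it is $\inf_z (d_{\mathcal{S}}(p,z)+d_{\mathcal{S}}(z,q))$ over $z$ in the outer boundary. Porosity. $X$ is porous if there is $A<\infty$ such that every ball $B(x,r)\subset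 X$, $0<r<\mathrm{diam}\,X$, contains a peripheral sphere $S$ with $\mathrm{diam}(S)\ge r/A$. *)

(* Defs.v *)
From HB Require Import structures.
From mathcomp Require Import all_boot all_order all_algebra.
From mathcomp Require Import generic_quotient.
From mathcomp Require Import all_classical all_reals all_analysis.
Import Order.TTheory GRing.Theory Num.Theory.
Import numFieldNormedType.Exports.

Set Implicit Arguments.
Unset Strict Implicit.
Unset Printing Implicit Defensive.

Local Open Scope classical_set_scope.
Local Open Scope ring_scope.

(* The distance is an explicit function rather than a metricType structure: the
   distances of the slit spaces are finite only for suitable slits. *)
Section MetricNotions.
Variable R : realType.

Definition diam (X : Type) (d : X -> X -> R) (E : set X) : R :=
  sup [set d x y | x in E & y in E].

Definition set_dist (X : Type) (d : X -> X -> R) (E F : set X) : R :=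
  inf [set d x y | x in E & y in F].

Definition rel_dist (X : Type) (d : X -> X -> R) (E F : set X) : R :=
  set_dist d E F / Num.min (diam d E) (diam d F).

Definition dcontinuous (X Y : Type) (dX : X -> X -> R) (dY : Y -> Y -> R)
    (f : X -> Y) : Prop :=
  forall x e, 0 < e ->
    exists2 delta, 0 < delta & forall y, dX x y < delta -> dY (f x) (f y) < e.

Definition homeomorphism (X Y : Type) (dX : X -> X -> R) (dY : Y -> Y -> R)
    (f : X -> Y) : Prop :=
  dcontinuous dX dY f /\
  exists g : Y -> X, [/\ cancel f g, cancel g f & dcontinuous dY dX g].

Definition quasisymmetric (X Y : Type) (dX : X -> X -> R) (dY : Y -> Y -> R)
    (f : X -> Y) : Prop :=
  homeomorphism dX dY f /\
  exists eta : R -> R,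
    [/\ forall t, 0 <= t -> 0 <= eta t,
        forall t u, 0 <= t -> t < u -> eta t < eta u
      & forall x y z, x <> y -> y <> z -> x <> z ->
          dY (f x) (f y) / dY (f y) (f z) <= eta (dX x y / dX y z)].

Definition image_dist (X Y : Type) (dY : Y -> Y -> R) (f : X -> Y)
    (p q : {y | range f y}) : R := dY (sval p) (sval q).

Definition to_image (X Y : Type) (f : X -> Y) (x : X) : {y | range f y} :=
  exist _ (f x) (imageT f x).

Definition qs_embedding (X Y : Type) (dX : X -> X -> R) (dY : Y -> Y -> R)
    (f : X -> Y) : Prop :=
  quasisymmetric dX (@image_dist X Y dY f) (to_image f).

Definition qs_co_hopfian (X : Type) (d : X -> X -> R) : Prop :=
  forall f : X -> X, qs_embedding d d f -> range f = setT.

Definition porous (X : Type) (d : X -> X -> R) (spheres : set (set X)) : Prop :=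
  exists2 A : R, 0 < A &
    forall (x : X) (r : R), 0 < r -> r < diam d setT ->
      exists E, [/\ spheres E, E `<=` [set y | d x y < r] & r / A <= diam d E].

End MetricNotions.

(* The distance takes values in \bar R: a path metric is a priori infinite
   between points that no rectifiable curve joins. *)
Section Completion.
Variables (R : realType) (T : Type).
Implicit Types (S : set T) (d : T -> T -> \bar R) (u : nat -> T).

Definition cauchy_in S d : set (nat -> T) :=
  [set u | (forall k, S (u k)) /\
    forall e : R, 0 < e ->
      exists N, forall k l, (N <= k)%N -> (N <= l)%N -> (d (u k) (u l) < e%:E)%E].

Definition cauchy_class S d u : set (nat -> T) :=
  [set v | cauchy_in S d v /\ (fun k => d (u k) (v k)) @ \oo --> 0%E].

Definition completion S d : Type :=
  {P : set (nat -> T) | exists2 u, cauchy_in S d u & P = cauchy_class S d u}.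

Definition in_completion S d u (cu : cauchy_in S d u) : completion S d :=
  exist _ (cauchy_class S d u) (ex_intro2 _ _ u cu erefl).

Definition cauchy_repr S d (p : completion S d) : nat -> T :=
  sval (cid2 (svalP p)).

Lemma cauchy_reprP S d (p : completion S d) : cauchy_in S d (cauchy_repr p).
Proof. by rewrite /cauchy_repr; case: cid2. Qed.

Definition completion_dist S d (p q : completion S d) : \bar R :=
  limn (fun k => d (cauchy_repr p k) (cauchy_repr q k)).

Lemma cauchy_in_le S' S d' d u : S' `<=` S -> (forall x y, d x y <= d' x y)%E ->
  cauchy_in S' d' u -> cauchy_in S d u.
Proof.
move=> sub le [uS uC]; split=> [k|e e0]; first exact/sub/uS.
have [N hN] := uC e e0; exists N => k l Nk Nl.
exact: Order.POrderTheory.le_lt_trans (le _ _) (hN _ _ Nk Nl).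
Qed.

(* The 1-Lipschitz extension to the completions of an inclusion S' `<=` S that
   does not increase distances. *)
Definition completion_map S' S d' d (sub : S' `<=` S)
    (le : forall x y, (d x y <= d' x y)%E) (p : completion S' d') :
    completion S d :=
  in_completion (cauchy_in_le sub le (cauchy_reprP p)).

End Completion.

Section PathMetric.
Variables (R : realType) (n : nat).
Implicit Types (x y : 'rV[R]_n) (S : set 'rV[R]_n).

(* The norm of the library on 'rV[R]_n is the sup norm; its topology is the
   Euclidean one. *)
Definition euclid_dist x y : R :=
  Num.sqrt (\sum_(i < n) (x 0 i - y 0 i) ^+ 2).

Definition polygon_length (c : R -> 'rV[R]_n) (t0 : R) (t : seq R) : R :=
  \sum_(0 <= i < size t) euclid_dist (c (nth 0 (t0 :: t) i)) (c (nth 0 t i)).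

Definition curve_length (c : R -> 'rV[R]_n) : \bar R :=
  ereal_sup [set (polygon_length c 0 t)%:E | t in itv_partition 0 1].

Definition curve_in S x y : set (R -> 'rV[R]_n) :=
  [set c : R -> 'rV[R]_n |
    [/\ {within `[(0 : R), 1], continuous c}, c 0 = x, c 1 = y
      & forall t, 0 <= t <= 1 -> S (c t)]].

Definition path_dist S x y : \bar R :=
  ereal_inf [set curve_length c | c in curve_in S x y].

Lemma path_dist_le S' S : S' `<=` S ->
  forall x y, (path_dist S x y <= path_dist S' x y)%E.
Proof.
move=> sub x y; apply: ereal_inf_le_tmp => _ [c [c1 c2 c3 c4] <-].
by exists c => //; split=> // t /c4 /sub.
Qed.

End PathMetric.

Section Slits.
Variables (R : realType) (n : nat).

Definition open_box (a b : 'rV[R]_n) : set 'rV[R]_n :=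
  [set y : 'rV[R]_n | forall i, a 0 i < y 0 i < b 0 i].

Definition is_slit (E : set 'rV[R]_n) : Prop :=
  exists (x l : R) (c d : 'rV[R]_n),
    [/\ 0 < l, forall i : 'I_n, i != 0%N :> nat -> d 0 i - c 0 i = l
      & E = [set y : 'rV[R]_n | forall i : 'I_n,
              if i == 0%N :> nat then y 0 i = x else c 0 i <= y 0 i <= d 0 i]].

Definition boundary (E : set 'rV[R]_n) : set 'rV[R]_n := closure E `\` E°.

Variables (I : set 'rV[R]_n) (s : nat -> set 'rV[R]_n).

Definition slits_in : Prop :=
  [/\ forall i, is_slit (s i), forall i, s i `<=` I & trivIset setT s].

Definition uniformly_rel_separated : Prop :=
  exists2 sigma : R, 0 < sigma &
    (forall i j, i <> j -> sigma <= rel_dist (@euclid_dist R n) (s i) (s j)) /\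
    (forall i, sigma <= rel_dist (@euclid_dist R n) (s i) (boundary I)).

Definition vanishing_diam : Prop :=
  (fun i => diam (@euclid_dist R n) (s i)) @ \oo --> (0 : R).

Definition slits_dense : Prop := I `<=` closure (\bigcup_i s i).

End Slits.

Section SlitSpace.
Variables (R : realType) (n : nat).
Variables (I : set 'rV[R]_n) (s : nat -> set 'rV[R]_n).

(* The slits are numbered from 0, so that the i-th domain omits s 0, ...,
   s (i - 1) and the 0-th one is I. *)
Definition slit_domain (i : nat) : set 'rV[R]_n :=
  I `\` \bigcup_(j in [set j | (j < i)%N]) s j.

Lemma slit_domain_sub i j : (i <= j)%N -> slit_domain j `<=` slit_domain i.
Proof.
move=> ij x [Ix nx]; split=> // -[k /= ki skx]; apply: nx.
by exists k => //=; exact: leq_trans ki ij.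
Qed.

Definition slit_stage (i : nat) : Type :=
  completion (slit_domain i) (path_dist (slit_domain i)).

Definition stage_map i j (ij : (i <= j)%N) : slit_stage j -> slit_stage i :=
  completion_map (slit_domain_sub ij) (path_dist_le (slit_domain_sub ij)).

Definition slit_space : Type :=
  {p : forall i, slit_stage i |
    forall i j (ij : (i <= j)%N), stage_map ij (p j) = p i}.

HB.instance Definition _ := gen_eqMixin slit_space.
HB.instance Definition _ := gen_choiceMixin slit_space.

(* For an open box I in dimension at least 2 and pairwise disjoint slits, the
   stage distances are finite, nondecreasing in i and bounded: a staircase
   running along the first axis, and along the second one when it meets a slit,
   has length at most the sum of two sides of I.  So fine is only applied to
   finite values. *)
Definition slit_dist (p q : slit_space) : R :=
  fine (limn (fun i => completion_dist (sval p i) (sval q i))).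

(* For a box I, stage 0 is identified with closure I, a Cauchy sequence of I
   being sent to its limit in R^n. *)
Definition tau0 (p : slit_space) : 'rV[R]_n :=
  lim (cauchy_repr (sval p 0%N) @ \oo).

Definition outer_boundary : set slit_space := tau0 @^-1` boundary I.

Definition peripheral_spheres : set (set slit_space) :=
  range (fun i => tau0 @^-1` s i) `|` [set outer_boundary].

End SlitSpace.

Section Double.
Variables (R : realType) (X : choiceType) (d : X -> X -> R) (A : set X).

Definition double_rel (x y : X * bool) : bool :=
  (x.1 == y.1) && ((x.2 == y.2) || (x.1 \in A)).

Lemma double_rel_equiv : equiv_class_of double_rel.
Proof.
split=> [x|x y|y x z]; rewrite /double_rel; first by rewrite !eqxx.
  by rewrite eq_sym [y.2 == _]eq_sym; case: eqP => //= ->.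
move=> /andP[/eqP -> h] /andP[/eqP <- h']; rewrite eqxx /=.
by move: h h'; case: (y.1 \in A); rewrite ?orbT // !orbF => /eqP -> /eqP ->.
Qed.

Canonical double_equiv := EquivRelPack double_rel_equiv.

Definition double : Type := {eq_quot double_equiv}%qT.

(* On a point of A, which lies on both copies, the two formulas agree by the
   triangle inequality: the value does not depend on the representatives. *)
Definition double_dist (x y : double) : R :=
  let p := repr x in let q := repr y in
  if p.2 == q.2 then d p.1 q.1 else inf [set d p.1 z + d z q.1 | z in A].

End Double.

(* Main.v *)
Require Import Defs.
From HB Require Import structures.
From mathcomp Require Import all_boot all_order all_algebra.
From mathcomp Require Import generic_quotient.
From mathcomp Require Import all_classical all_reals all_analysis.
From mathcomp Require Import measurable_realfun ring lra zify.
Import Order.TTheory GRing.Theory Num.Theory.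
Import numFieldNormedType.Exports.

Set Implicit Arguments.
Unset Strict Implicit.
Unset Printing Implicit Defensive.

Local Open Scope classical_set_scope.
Local Open Scope ring_scope.

(** The slits are orthogonal to the first axis, called horizontal; a slice is the
    part of the double over a vertical hyperplane. A slice that meets no slit is
    generic. Movement inside it is free ([vertical_slide]), so it is the double of
    a Euclidean cube, a sphere of codimension one. The proof shows that a
    quasisymmetric embedding f maps generic slices to slices, induces a map F of
    the horizontal coordinate, and that F attains every value.

    Slices are mapped to slices by an argument of conformal modulus. Porosity and
    relative separation make the slit space as large as Euclidean space: the ball
    of radius r contains the points over a box with sides comparable to r
    ([ball_contains_box]). Take a fine grid of points on parallel vertical lines.
    Since f is quasisymmetric, the balls around their images with radii comparable
    to the steps along the lines are separated, so the n-th powers of the steps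
    add up to a bounded volume, and to a small one if only the balls that miss a
    set of nearly full volume are counted. By Hölder's inequality the steps of
    this kind along some line have a small sum ([short_chain]). The set is made of
    boxes around slits, with which porosity fills the volume up to a small part
    ([fill_box]). A curve near a slit cannot cross it, and so the horizontal
    coordinate can be changed by little into a Lipschitz function that is constant
    near these boxes ([jump_function]). Along the image of some line next to any
    vertical segment this function hardly changes; in the limit the horizontal
    coordinate of f is constant on vertical segments ([slice]). With the two sides
    of a hyperplane for the boxes the same estimate shows that a slab is not
    mapped into one slice ([slab_not_flat]).

    The rest is topology, by the theorem of Borsuk and Ulam, which is derived from
    a lemma of Tucker on labellings of subdivided spheres ([borsuk_ulam]). If a
    generic slice is mapped into a generic slice, it is mapped onto it
    ([slice_onto]), because a sphere does not embed in a Euclidean space of its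
    dimension. Hence F is injective over values of which all preimages are
    generic. The composition of the inverse of f on such a slice with the
    projection to the box identifies two antipodal points, which are then images
    of twins, the two points of the double over one point of the box
    ([distant_twins]). Near the faces orthogonal to the first axis twins are close
    to the outer boundary and to each other; so F maps the two ends of its
    interval to ends, to different ones by injectivity, and takes all values in
    between. The image of f contains a dense set of slices and is compact
    ([qs_onto]). *)

(** * Simplicial chains modulo two *)
Section Chains.
Variable T : Type.
Implicit Types (s : seq T) (c : seq (seq T)) (phi : seq T -> bool).

(** Chains modulo two are lists of simplices, compared by the values that all
    cochains take on them; the empty simplex is allowed, so that the complex is
    augmented and coning needs no special case for vertices. *)
Definition ev phi c : bool := \big[addb/false]_(s <- c) phi s.

Fixpoint faces s : seq (seq T) :=
  if s is x :: s' then s' :: map (cons x) (faces s') else [::].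

Definition bd c := flatten (map faces c).

Lemma ev_cat phi c c' : ev phi (c ++ c') = ev phi c (+) ev phi c'.
Proof. by rewrite /ev big_cat. Qed.

Lemma ev_map phi (f : seq T -> seq T) c :
  ev phi (map f c) = ev (fun s => phi (f s)) c.
Proof. by rewrite /ev big_map. Qed.

Lemma ev_flatten phi (f : seq T -> seq (seq T)) c :
  ev phi (flatten (map f c)) = ev (fun s => ev phi (f s)) c.
Proof. by rewrite /ev big_flatten big_map. Qed.

Lemma eq_ev phi psi c : phi =1 psi -> ev phi c = ev psi c.
Proof. by move=> e; apply: eq_bigr => s _; exact: e. Qed.

Lemma ev_add phi psi c :
  ev (fun s => phi s (+) psi s) c = ev phi c (+) ev psi c.
Proof. by rewrite /ev big_split. Qed.

(** The boundary of a boundary vanishes: in the cone from x over s, the faces of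
    s and of the boundary of s cancel in pairs. *)
Lemma bd_faces phi s : ev phi (bd (faces s)) = false.
Proof.
elim: s phi => [|x s ih] phi; first by rewrite /ev big_nil.
rewrite /bd ev_flatten /= {1}/ev big_cons -[X in _ (+) X]/(ev _ _) ev_map /=.
have e t : ev phi (t :: map (cons x) (faces t)) =
    phi t (+) ev (fun u => phi (x :: u)) (faces t).
  by rewrite {1}/ev big_cons -[X in _ (+) X]/(ev _ _) ev_map.
rewrite (eq_ev _ e) ev_add.
have := ih (fun u => phi (x :: u)); rewrite /bd ev_flatten => ->.
by rewrite addbF addbb.
Qed.

Lemma bd_cone phi (b : T) c :
  ev phi (bd (map (cons b) c)) = ev phi c (+) ev (fun s => phi (b :: s)) (bd c).
Proof.
rewrite /bd !ev_flatten ev_map -ev_add; apply: eq_ev => t.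
by rewrite /= {1}/ev big_cons -[X in _ (+) X]/(ev _ _) ev_map.
Qed.

Lemma bd_cat phi c c' : ev phi (bd (c ++ c')) = ev phi (bd c) (+) ev phi (bd c').
Proof. by rewrite /bd map_cat flatten_cat ev_cat. Qed.

Lemma faces_map (f : T -> T) s : faces (map f s) = map (map f) (faces s).
Proof. by elim: s => //= x s ->; rewrite -!map_comp. Qed.

Lemma bd_map phi (f : T -> T) c :
  ev phi (bd (map (map f) c)) = ev (fun s => phi (map f s)) (bd c).
Proof.
rewrite /bd !ev_flatten ev_map; apply: eq_ev => s.
by rewrite faces_map ev_map.
Qed.

Variable bary : seq T -> T.

(** Barycentric subdivision of a simplex with [k] vertices, as the cone from the
    barycentre over the subdivided boundary. *)
Fixpoint sd k s : seq (seq T) :=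
  if k is k'.+1 then map (cons (bary s)) (flatten (map (sd k') (faces s)))
  else [:: s].

Definition Sd k c := flatten (map (sd k) c).

Lemma ev_Sd phi k c : ev phi (Sd k c) = ev (fun s => ev phi (sd k s)) c.
Proof. exact: ev_flatten. Qed.

Lemma sdS k s : sd k.+1 s = map (cons (bary s)) (Sd k (faces s)).
Proof. by []. Qed.

Lemma Sd_cat k c c' : Sd k (c ++ c') = Sd k c ++ Sd k c'.
Proof. by rewrite /Sd map_cat flatten_cat. Qed.

Lemma size_faces s : forall k, size s = k.+1 -> all (fun t => size t == k) (faces s).
Proof.
elim: s => // x s ih k /= [sk]; rewrite sk eqxx /=; rewrite all_map.
case: k sk => [|k] sk; first by rewrite (size0nil sk).
by apply: sub_all (ih _ sk) => t /= /eqP ->.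
Qed.

Lemma all_flatten (P : pred (seq T)) (f : seq T -> seq (seq T)) c :
  all P (flatten (map f c)) = all (fun s => all P (f s)) c.
Proof. by elim: c => //= s c ih; rewrite all_cat ih. Qed.

Lemma size_sd k s : size s = k -> all (fun t => size t == k) (sd k s).
Proof.
elim: k s => [|k ih] s sk /=; first by rewrite sk eqxx.
rewrite all_map all_flatten; apply: sub_all (size_faces sk) => t /eqP tk.
by apply: sub_all (ih _ tk) => u /= /eqP ->.
Qed.

Lemma eq_ev_all phi psi c (P : pred (seq T)) : all P c ->
  (forall s, P s -> phi s = psi s) -> ev phi c = ev psi c.
Proof.
move=> + e; elim: c => [|s c ih] /=; first by rewrite /ev !big_nil.
by case/andP=> Ps Pc; rewrite /ev !big_cons e//; congr (_ (+) _); exact: ih.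
Qed.

(** Subdivision is a chain map. By induction it is one on the boundary of s, and
    the boundary of a cone is its base plus the cone over the boundary of the base,
    which is zero here. *)
Lemma bd_sd phi k s : size s = k.+1 ->
  ev phi (bd (sd k.+1 s)) = ev phi (Sd k (faces s)).
Proof.
elim: k s phi => [|k ih] s phi sk; rewrite sdS bd_cone.
  case: s sk => // x [|//] _ /=.
  by rewrite [X in _ (+) X]/ev /bd /Sd /= big_nil addbF.
rewrite [X in _ (+) X](_ : _ = false) ?addbF//.
rewrite /bd ev_flatten ev_Sd.
transitivity (ev (fun t => ev (fun u => phi (bary s :: u)) (Sd k (faces t))) (faces s)).
  apply: eq_ev_all (size_faces sk) _ => t /eqP tk.
  by rewrite -ih// /bd ev_flatten.
under eq_ev do rewrite ev_Sd.
by rewrite -ev_flatten -/(bd _) bd_faces.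
Qed.

Lemma bd_Sd phi k c : all (fun t => size t == k.+1) c ->
  ev phi (bd (Sd k.+1 c)) = ev phi (Sd k (bd c)).
Proof.
move=> ck; rewrite /bd ev_flatten !ev_Sd ev_flatten.
apply: eq_ev_all ck _ => t /eqP tk.
by rewrite -ev_flatten -/(bd _) bd_sd// ev_Sd.
Qed.

Lemma size_Sd k c : all (fun t => size t == k) c ->
  all (fun t => size t == k) (Sd k c).
Proof.
by rewrite all_flatten => ck; apply: sub_all ck => t /eqP; exact: size_sd.
Qed.

Lemma size_iter_Sd k c r : all (fun t => size t == k) c ->
  all (fun t => size t == k) (iter r (Sd k) c).
Proof. by move=> ck; elim: r => //= r; exact: size_Sd. Qed.

Lemma bd_iter_Sd phi k c r : all (fun t => size t == k.+1) c ->
  ev phi (bd (iter r (Sd k.+1) c)) = ev phi (iter r (Sd k) (bd c)).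
Proof.
move=> ck; elim: r phi => //= r ih phi.
by rewrite bd_Sd ?size_iter_Sd// ev_Sd ih -ev_Sd.
Qed.

Lemma eq_ev_iter_Sd phi k c c' r : (forall psi, ev psi c = ev psi c') ->
  ev phi (iter r (Sd k) c) = ev phi (iter r (Sd k) c').
Proof. by move=> e; elim: r phi => //= r ih phi; rewrite !ev_Sd ih. Qed.

Lemma iter_Sd_cat k c c' r :
  iter r (Sd k) (c ++ c') = iter r (Sd k) c ++ iter r (Sd k) c'.
Proof. by elim: r => //= r ->; rewrite Sd_cat. Qed.

Lemma iter_Sd0 c r : iter r (Sd 0) c = c.
Proof. by elim: r => //= r ->; rewrite /Sd /= flatten_seq1. Qed.

Lemma sd_map (f : T -> T) k s : (forall t, bary (map f t) = f (bary t)) ->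
  sd k (map f s) = map (map f) (sd k s).
Proof.
move=> fb; elim: k s => [|k ih] s //=; rewrite fb faces_map -!map_comp.
rewrite (eq_map (_ : _ =1 map (map f) \o sd k)); last by move=> t /=; rewrite ih.
by rewrite map_comp -map_flatten -!map_comp.
Qed.

Lemma iter_Sd_map (f : T -> T) k c r : (forall t, bary (map f t) = f (bary t)) ->
  iter r (Sd k) (map (map f) c) = map (map f) (iter r (Sd k) c).
Proof.
move=> fb; elim: r => //= r ->; rewrite /Sd -map_comp map_flatten -map_comp.
by congr flatten; apply: eq_map => s /=; rewrite sd_map.
Qed.

End Chains.

Section Alternating.

Fixpoint altb (b : bool) (s : seq bool) : bool :=
  if s is x :: s' then (x == b) && altb (~~ b) s' else true.

(** Removing an entry from a sequence of signs leaves an alternating one in ways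
    that cancel in pairs, except when the sequence alternates itself and an end
    entry is removed. *)
Lemma altb_faces b s : ev (altb b) (faces s) = altb b s (+) altb (~~ b) s.
Proof.
elim: s b => [|x s ih] b; first by rewrite /ev big_nil.
rewrite /= {1}/ev big_cons -[X in _ (+) X]/(ev _ _) ev_map /=.
case: (x =P b) => [->|xb]; last first.
  have -> : x == ~~ b by case: x b xb => -[].
  by rewrite /ev big1 ?addbF// negbK.
have -> : b == ~~ b = false by case: b {ih}.
rewrite (eq_ev (psi := altb (~~ b)))// ih negbK.
by rewrite addbC -addbA addbb /= addbF; case: (altb _ _).
Qed.

Lemma altb_neg b s : altb b (map negb s) = altb (~~ b) s.
Proof. by elim: s b => //= x s ih b; rewrite ih; case: x b => -[]. Qed.

Lemma faces_rem (F : seq nat -> bool) s :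
  (forall t t', perm_eq t t' -> F t = F t') ->
  ev F (faces s) = \big[addb/false]_(x <- s) F (rem x s).
Proof.
move=> FP; elim: s F FP => [|x s ih] F FP; first by rewrite /ev !big_nil.
rewrite /= {1}/ev big_cons -[X in _ (+) X]/(ev _ _) ev_map ih; last first.
  by move=> t t' tt'; apply: FP; rewrite perm_cons.
rewrite big_cons eqxx; congr (_ (+) _); apply: eq_big_seq => y ys.
apply: FP; case: eqVneq => // ->; rewrite perm_sym; exact: perm_to_rem.
Qed.

Lemma perm_faces (F : seq nat -> bool) s s' : perm_eq s s' ->
  (forall t t', perm_eq t t' -> F t = F t') -> ev F (faces s) = ev F (faces s').
Proof.
move=> ss' FP; rewrite !faces_rem// (perm_big _ ss'); apply: eq_big_seq => x xs.
apply: FP; rewrite -(perm_cons x) -(permPl (perm_to_rem _)) ?(perm_mem ss')//.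
by rewrite -(permPr (perm_to_rem xs)).
Qed.

(** Signed labels are coded by natural numbers: the parity of a code is its sign
    and its half the absolute value. *)
Definition altlab b (s : seq nat) := altb b (map odd (sort leq s)).

Lemma faces_sorted s : sorted leq s -> all (sorted leq) (faces s).
Proof.
move=> ss; have : all (fun t => subseq t s) (faces s).
  elim: s {ss} => // x s ih; apply/allP => t; rewrite inE.
  case/orP=> [/eqP->|/mapP[u /(allP ih) us ->]]; first exact: subseq_cons.
  by rewrite /= eqxx.
apply: sub_all => t ts; apply: subseq_sorted ts ss; exact: leq_trans.
Qed.

(** The coboundary of the cochain of the simplices alternating from b on is the
    sum of the two alternating cochains one dimension higher. *)
Lemma altlab_faces b s :
  ev (altlab b) (faces s) = altlab b s (+) altlab (~~ b) s.
Proof.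
rewrite (@perm_faces _ s (sort leq s)); last 2 first.
- by rewrite perm_sym perm_sort.
- move=> t t' tt'; rewrite /altlab; congr (altb b (map _ _)).
  by apply/perm_sortP => //; [exact: leq_total|exact: leq_trans|exact: anti_leq].
rewrite -altb_faces /altlab.
rewrite (_ : faces (map odd _) = map (map odd) (faces (sort leq s))); last first.
  by elim: (sort leq s) => //= x t ->; rewrite -!map_comp.
rewrite /ev big_map.
have so : sorted leq (sort leq s) by apply: sort_sorted; exact: leq_total.
have := faces_sorted so; elim: (faces _) => [|t c ih] /=; first by rewrite !big_nil.
case/andP=> st sc; rewrite !big_cons ih//; congr (altb b (map _ _) (+) _).
by apply: sorted_sort => //; exact: leq_trans.
Qed.

(** The label opposite to c. *)
Definition flip c := if odd c then c.-1 else c.+1.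

Definition nocompl (s : seq nat) :=
  {in s &, forall x y, x./2 = y./2 -> x = y}.

Lemma odd_flip c : odd (flip c) = ~~ odd c.
Proof. by rewrite /flip; case: ifP => h; lia. Qed.

(** Without complementary edges the sorting by codes is a sorting by absolute
    values, which flipping all signs does not change. *)
Lemma altlab_flip b s : nocompl s -> altlab b (map flip s) = altlab (~~ b) s.
Proof.
move=> ns; rewrite /altlab (_ : sort leq (map flip s) = map flip (sort leq s)).
  by rewrite -map_comp (eq_map odd_flip) map_comp altb_neg.
have leqtr : transitive leq by exact: leq_trans.
apply: (sorted_eq leqtr anti_leq).
- exact/sort_sorted/leq_total.
- have : sorted leq (sort leq s) by apply: sort_sorted; exact: leq_total.
  have : {subset sort leq s <= s} by move=> x; rewrite mem_sort.
  elim: (sort leq s) => //= x t ih sub.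
  case: t ih sub => //= y t ih sub /andP[xy yt].
  rewrite ih//; last by move=> z zt; apply: sub; rewrite inE zt orbT.
  rewrite andbT; have := ns x y (sub _ (mem_head _ _)) (sub y _).
  rewrite !inE eqxx orbT => /(_ isT); rewrite /flip.
  by case: ifP => ? h; case: ifP => ?; lia.
- by rewrite perm_sort; apply: perm_map; rewrite perm_sym perm_sort.
Qed.

(** Alternating signs on distinct absolute values need as many absolute values as
    vertices. *)
Lemma altlab_big b m s : nocompl s -> size s = m.+1 -> all (fun x => x./2 < m)%N s ->
  altlab b s = false.
Proof.
move=> ns sm sl; apply/negP => h.
have : sorted ltn (map half (sort leq s)).
  have : sorted leq (sort leq s) by apply: sort_sorted; exact: leq_total.
  have : {subset sort leq s <= s} by move=> x; rewrite mem_sort.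
  move: h; rewrite /altlab; elim: (sort leq s) b => //= x t ih b.
  case: t ih => //= y t ih /and3P[xb yb ht] sub /andP[xy yt].
  rewrite (ih (~~ b)) ?yb//; last by move=> z zt; apply: sub; rewrite inE zt orbT.
  rewrite andbT; have := ns x y (sub _ (mem_head _ _)) (sub y _).
  rewrite !inE eqxx orbT => /(_ isT) e.
  rewrite ltn_neqAle half_leq// andbT; apply/eqP => /e xE.
  by move: xb yb; rewrite xE => /eqP ->; clear; case: b.
move=> /(sorted_uniq ltn_trans ltnn) u.
suff /(uniq_leq_size u) : {subset map half (sort leq s) <= iota 0 m}.
  by rewrite size_map size_sort sm size_iota ltnn.
move=> x /mapP[y]; rewrite mem_sort => /(allP sl) ym ->.
by rewrite mem_iota add0n.
Qed.

End Alternating.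

(** * The Borsuk-Ulam theorem on a cube *)
Section BorsukUlam.
Variables (R : realType) (m : nat).
Let V := 'rV[R]_m.+1.

Definition bary (s : seq V) : V := (size s)%:R^-1 *: \sum_(v <- s) v.

Definition nuc (c : seq (seq V)) := map (map -%R) c.

Lemma bary_opp t : bary (map -%R t) = - bary t.
Proof. by rewrite /bary size_map big_map sumrN scalerN. Qed.

Definition axis (i : nat) : V := delta_mx 0 (inord i).

(** The upper hemispheres of the boundaries of the crosspolytopes: each one is
    the cone over the sphere of one dimension less. *)
Fixpoint hemi (d : nat) : seq (seq V) :=
  if d is d'.+1 then map (cons (axis d)) (hemi d' ++ nuc (hemi d'))
  else [:: [:: axis 0]].

Definition sphere d := hemi d ++ nuc (hemi d).

Lemma nuc_sphere phi d : ev phi (nuc (sphere d)) = ev phi (sphere d).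
Proof.
rewrite /sphere /nuc map_cat !ev_cat addbC; congr (_ (+) _).
by rewrite !ev_map; apply: eq_ev => s; rewrite -map_comp map_id_in // => v _; exact: opprK.
Qed.

Lemma bd_hemi phi d :
  ev phi (bd (hemi d)) = ev phi (if d is d'.+1 then sphere d' else [:: [::]]).
Proof.
elim: d phi => [|d ih] phi; first by rewrite /ev /= !big_cons !big_nil.
rewrite /= bd_cone -/(sphere d) [X in _ (+) X](_ : _ = false) ?addbF//.
move: (fun s => phi _) => {}phi.
rewrite bd_cat bd_map !ih; case: d {ih} => [|d]; first by rewrite /ev !big_cons !big_nil /= !addbF addbb.
rewrite -(ev_map phi (map -%R)) -[map _ _]/(nuc _).
by rewrite nuc_sphere addbb.
Qed.

Lemma bd_sphere phi d : ev phi (bd (sphere d)) = false.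
Proof.
rewrite /sphere bd_cat bd_map !bd_hemi; case: d => [|d].
  by rewrite /ev !big_cons !big_nil /= !addbF addbb.
rewrite -(ev_map phi (map -%R)) -[map _ _]/(nuc _).
by rewrite nuc_sphere addbb.
Qed.

Lemma size_nuc k c : all (fun t : seq V => size t == k) c ->
  all (fun t => size t == k) (nuc c).
Proof. by rewrite all_map => ck; apply: sub_all ck => t /=; rewrite size_map. Qed.

Lemma size_sphere d : all (fun t => size t == d.+1) (sphere d).
Proof.
have h : all (fun t => size t == d.+1) (hemi d).
  elim: d => //= d ih; rewrite all_map.
  have : all (fun t => size t == d.+1) (hemi d ++ nuc (hemi d)).
    by rewrite all_cat ih size_nuc.
  by apply: sub_all => t /= /eqP ->.
by rewrite all_cat h size_nuc.
Qed.

Section Tucker.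
Variables (lab : V -> nat) (r : nat).
Hypothesis lab_lt : forall v, ((lab v)./2 < m.+1)%N.

Let ball := map (cons 0) (sphere m).

Definition labnc (s : seq V) := nocompl (map lab s).
Definition labodd (s : seq V) := {in s, forall v, lab (- v) = flip (lab v)}.

Hypothesis nc_hemi : forall d s, (d <= m)%N -> s \in iter r (Sd bary d.+1) (hemi d) -> labnc s /\ labodd s.
Hypothesis nc_ball : forall s, s \in iter r (Sd bary m.+2) ball -> labnc s.

(** An antipodal labelling of the sphere by m labels cannot extend to the ball
    without a complementary edge: the number of simplices of the d-th sphere on
    which the labels alternate in sign starting with a positive one is odd. *)
Lemma tucker_absurd : False.
Proof.
pose phi s := altlab true (map lab s).
have phif s : ev phi (faces s) = phi s (+) altlab false (map lab s).
  rewrite -altlab_faces (_ : faces (map lab s) = map (map lab) (faces s)).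
    by rewrite /ev big_map.
  by elim: s => //= x s ->; rewrite -!map_comp.
have step d : (d <= m)%N -> ev phi (iter r (Sd bary d.+1) (sphere d)) =
    ev phi (iter r (Sd bary d) (if d is d'.+1 then sphere d' else [:: [::]])).
  move=> dm; have hd : all (fun t => size t == d.+1) (hemi d).
    by have := size_sphere d; rewrite all_cat => /andP[].
  rewrite -(@eq_ev_iter_Sd _ bary phi _ _ _ r (fun psi => bd_hemi psi d)) -bd_iter_Sd//.
  rewrite /sphere iter_Sd_cat ev_cat /nuc iter_Sd_map; last exact: bary_opp.
  rewrite ev_map -ev_add /bd ev_flatten /ev; apply: eq_big_seq => s sh.
  have [nc od] := nc_hemi dm sh; rewrite -[RHS]/(ev _ _) phif; congr (_ (+) _).
  rewrite /phi -[false]/(~~ true) -altlab_flip// -!map_comp; congr altlab.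
  by apply/eq_in_map => v vs /=; exact: od.
have odd_sphere d : (d <= m)%N -> ev phi (iter r (Sd bary d.+1) (sphere d)).
  elim: d => [|d ih] dm; rewrite step//; last by apply: ih; exact: ltnW.
  by rewrite iter_Sd0 /ev big_cons big_nil.
have szb : all (fun t => size t == m.+2) ball.
  by rewrite all_map; apply: sub_all (size_sphere m) => t /= /eqP ->.
have : ev phi (bd (iter r (Sd bary m.+2) ball)) = true.
  rewrite bd_iter_Sd// -(odd_sphere m (leqnn _)); apply: eq_ev_iter_Sd => psi.
  by rewrite bd_cone bd_sphere addbF.
have nz b s : s \in iter r (Sd bary m.+2) ball -> altlab b (map lab s) = false.
  move=> si; apply: (@altlab_big _ m.+1); first exact: nc_ball.
    by rewrite size_map; have /allP/(_ _ si)/eqP := size_iter_Sd bary r szb.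
  by apply/allP => _ /mapP[v _ ->].
rewrite /bd ev_flatten /ev big1_seq// => s /andP[_ si].
by rewrite -[LHS]/(ev _ _) phif /phi !nz.
Qed.

End Tucker.

(** What survives subdivision; convex sets do. *)
Definition bclosed (C : V -> Prop) :=
  forall s, s <> [::] -> (forall v, v \in s -> C v) -> C (bary s).

Lemma face_sub (s t : seq V) : t \in faces s -> {subset t <= s}.
Proof.
elim: s t => //= x s ih t; rewrite inE => /orP[/eqP->|/mapP[u us ->]] v.
  by rewrite inE orbC => ->.
by rewrite !inE => /orP[->//|/(ih _ us) ->]; rewrite orbT.
Qed.

Lemma sd_closed C k (s t : seq V) : bclosed C -> size s = k -> t \in sd bary k s ->
  (forall v, v \in s -> C v) -> forall v, v \in t -> C v.
Proof.
move=> Cb; elim: k s t => [|k ih] s t sk; first by rewrite inE => /eqP ->.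
case/mapP=> u /flatten_mapP[f fs uf] -> Cs v; rewrite inE => /orP[/eqP->|vu].
  by apply: Cb => // s0; rewrite s0 in sk.
apply: (ih f u) vu => //; first by have /allP/(_ _ fs)/eqP := size_faces sk.
by move=> w wf; apply/Cs/(face_sub fs).
Qed.

Lemma linear_closed (a : 'I_m.+1 -> R) (e : R) :
  bclosed (fun v => \sum_i a i * v 0 i <= e).
Proof.
move=> s s0 sC; rewrite /bary.
have k0 : 0 < (size s)%:R :> R by rewrite ltr0n lt0n size_eq0; exact/eqP.
rewrite (_ : \sum_i _ = (size s)%:R^-1 * \sum_(v <- s) \sum_i a i * v 0 i).
  rewrite mulrC ler_pdivrMr//; elim: s {k0 s0} sC => [|v s ih] sC; first by rewrite big_nil mulr0.
  rewrite big_cons /= -natr1 mulrDr mulr1 addrC lerD ?sC ?mem_head//.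
  by apply: ih => w ws; apply: sC; rewrite inE ws orbT.
rewrite exchange_big /= mulr_sumr; apply: eq_bigr => i _.
by rewrite !mxE summxE mulrCA -mulr_sumr.
Qed.

Lemma coord_closed i (e f : R) : bclosed (fun v => e <= v 0 i <= f).
Proof.
move=> s s0 sC; apply/andP; split.
  have := @linear_closed (fun j => - (j == i)%:R) (- e) s s0.
  rewrite (bigD1 i)//= eqxx big1 ?addr0 ?mulN1r ?lerN2; last first.
    by move=> j /negbTE ->; rewrite oppr0 mul0r.
  apply=> v /sC /andP[ev _].
  rewrite (bigD1 i)//= eqxx big1 ?addr0 ?mulN1r ?lerN2//.
  by move=> j /negbTE ->; rewrite oppr0 mul0r.
have := @linear_closed (fun j => (j == i)%:R) f s s0.
rewrite (bigD1 i)//= eqxx big1 ?addr0 ?mul1r; last first.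
  by move=> j /negbTE ->; rewrite mul0r.
apply=> v /sC /andP[_ vf].
by rewrite (bigD1 i)//= eqxx big1 ?addr0 ?mul1r// => j /negbTE ->; rewrite mul0r.
Qed.

Definition close (e : R) (s : seq V) :=
  forall x y : V, x \in s -> y \in s -> forall i, `|x 0 i - y 0 i| <= e.

Definition contraction : R := m.+1%:R / m.+2%:R.

(** The vertex v itself takes up a share of at least 1 / m.+2 of the barycentre. *)
Lemma bary_close e (s : seq V) v i : close e s -> (size s <= m.+2)%N -> v \in s ->
  `|bary s 0 i - v 0 i| <= contraction * e.
Proof.
move=> se sm vs; have s0 : (0 < size s)%N by case: s vs {se sm}.
have k0 : 0 < (size s)%:R :> R by rewrite ltr0n.
have e0 : 0 <= e by apply: le_trans (se v v vs vs i); rewrite subrr normr0.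
have -> : bary s 0 i - v 0 i = (size s)%:R^-1 * \sum_(w <- s) (w 0 i - v 0 i).
  rewrite sumrB big_const_seq count_predT iter_addr_0 mulrBr -[v 0 i *+ _]mulr_natl.
  by rewrite mulKf ?gt_eqF// !mxE summxE.
rewrite normrM ger0_norm ?invr_ge0 ?ler0n// mulrC ler_pdivrMr//.
rewrite (perm_big _ (perm_to_rem vs)) big_cons /= subrr add0r.
apply: (@le_trans _ _ ((size s).-1%:R * e)).
  rewrite -(size_rem vs); have : {subset rem v s <= s} by move=> w /mem_rem.
  elim: (rem v s) => [|w t ih] sub; first by rewrite big_nil normr0 mul0r.
  rewrite big_cons /= -natr1 mulrDl mul1r (le_trans (ler_normD _ _))// addrC.
  apply: lerD; first by apply: ih => z zt; apply: sub; rewrite inE zt orbT.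
  by apply: se => //; exact/sub/mem_head.
rewrite mulrAC ler_wpM2r// /contraction mulrAC ler_pdivlMr ?ltr0n// -!natrM ler_nat.
by move: sm s0; case: (size s) => // k; rewrite ltnS => km _; nia.
Qed.

Lemma sd_close e k (s t : seq V) : close e s -> size s = k -> (k <= m.+2)%N ->
  t \in sd bary k s -> close (contraction * e) t.
Proof.
have c0 : 0 <= contraction by rewrite divr_ge0 ?ler0n.
elim: k s t => [|k ih] s t se sk km; first by rewrite inE (size0nil sk) => /eqP -> ?.
case/mapP=> u /flatten_mapP[f fs uf] ->.
have fk : size f = k by have /allP/(_ _ fs)/eqP := size_faces sk.
have ue : close (contraction * e) u.
  apply: (ih f) => //; last exact: ltnW.
  by move=> x y /(face_sub fs) xs /(face_sub fs) ys; exact: se.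
have bu w i : w \in u -> `|bary s 0 i - w 0 i| <= contraction * e.
  move=> wu; have := sd_closed (@coord_closed i (bary s 0 i - contraction * e)
    (bary s 0 i + contraction * e)) fk uf _ wu.
  rewrite distrC ler_distl; apply=> v /(face_sub fs) vs.
  by rewrite -ler_distl distrC bary_close// sk.
have e0 : 0 <= contraction * e.
  rewrite mulr_ge0//; case: s sk se {ih fs bu} => //= x s _ se.
  by apply: le_trans (se x x (mem_head _ _) (mem_head _ _) 0).
move=> x y; rewrite !inE => /orP[/eqP->|xu] /orP[/eqP->|yu] i.
- by rewrite subrr normr0.
- exact: bu.
- by rewrite distrC bu.
- exact: ue.
Qed.

Lemma iter_Sd_closed k c r (s : seq V) :
  all (fun t => size t == k) c -> s \in iter r (Sd bary k) c ->
  exists2 t, t \in c & forall C, bclosed C ->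
    (forall v, v \in t -> C v) -> forall v, v \in s -> C v.
Proof.
move=> ck; elim: r s => [|r ih] s; first by move=> sc; exists s => // C _ h; exact: h.
rewrite iterS => /flatten_mapP[t tc st]; have [u uc utC] := ih _ tc.
exists u => // C Cb uC; apply: (@sd_closed C k t s Cb _ st); last exact: utC.
by have /allP/(_ _ tc)/eqP := size_iter_Sd bary r ck.
Qed.

Lemma iter_Sd_close e k c r (s : seq V) : (k <= m.+2)%N ->
  all (fun t => size t == k) c -> (forall t, t \in c -> close e t) ->
  s \in iter r (Sd bary k) c -> close (contraction ^+ r * e) s.
Proof.
move=> km ck ce; elim: r s => [|r ih] s; first by rewrite mul1r; exact: ce.
rewrite iterS => /flatten_mapP[t tc st]; rewrite exprS -mulrA.
apply: sd_close st => //; first exact: ih.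
by have /allP/(_ _ tc)/eqP := size_iter_Sd bary r ck.
Qed.

Lemma hemi_signs d s : (d <= m)%N -> s \in hemi d ->
  exists2 e : 'I_m.+1 -> R, (forall i, e i = 1 \/ e i = -1) &
    forall v, v \in s -> exists2 i : 'I_m.+1, (i <= d)%N & v = e i *: delta_mx 0 i.
Proof.
elim: d s => [|d ih] s dm.
  rewrite inE => /eqP ->; exists (fun=> 1) => [i|v]; first by left.
  rewrite inE => /eqP ->; exists ord0 => //; rewrite scale1r /axis; congr delta_mx.
  by apply/val_inj; rewrite /= inordK.
case/mapP=> t + ->; have dm' := ltnW dm.
move=> th.
have [t' t'h tt'] : exists2 t', t' \in hemi d & t = t' \/ t = map -%R t'.
  move: th; rewrite mem_cat => /orP[h|/mapP[t'' h ->]]; first by exists t; [|left].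
  by exists t''; [|right].
have [e e1 te] := ih _ dm' t'h.
pose o : R := if t == t' then 1 else -1.
have o1 : o = 1 \/ o = -1 by rewrite /o; case: ifP; [left|right].
exists (fun i => if i == inord d.+1 then 1 else o * e i) => [i|v].
  case: ifP => _; first by left.
  by case: o1 => ->; case: (e1 i) => ->; rewrite ?mul1r ?mulN1r ?opprK; [left|right|right|left].
rewrite inE => /orP[/eqP->|vt].
  by exists (inord d.+1); rewrite ?eqxx ?scale1r// inordK.
have [w [wt vE]] : exists w, w \in t' /\ v = o *: w.
  rewrite /o; case: eqP tt' => [tE _|nt [//|tE]].
    by exists v; rewrite -tE scale1r.
  by move: vt; rewrite tE => /mapP[w wt ->]; exists w; rewrite scaleN1r.
have [i id wE] := te _ wt; exists i; first exact: leqW.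
rewrite vE wE scalerA; case: eqP => // ii.
by move: id; rewrite ii inordK// ltnn.
Qed.

End BorsukUlam.

Lemma nbhs_rV (R : realType) k (x : 'rV[R]_k) (e : R) : 0 < e ->
  nbhs x [set y : 'rV[R]_k | forall i, `|y 0 i - x 0 i| < e].
Proof.
move=> e0; apply: filterS (nbhsx_ballx x e e0) => y.
by case=> _ xy i /=; rewrite distrC; apply: xy.
Qed.

Lemma rV_cluster (R : realType) k (lo hi : 'rV[R]_k) (u : nat -> 'rV[R]_k) :
  (forall n i, lo 0 i <= u n 0 i <= hi 0 i) ->
  exists2 x : 'rV[R]_k, forall i, lo 0 i <= x 0 i <= hi 0 i &
    forall (e : R) (N : nat), 0 < e -> exists2 n, (N <= n)%N & forall i, `|u n 0 i - x 0 i| < e.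
Proof.
move=> ub.
have := @rV_compact R k (fun i => `[lo 0 i, hi 0 i]%classic)
  (fun i => @segment_compact R _ _).
move=> /(_ (u @ \oo) _)[|x [xI cx]].
  by exists 0%N => // n _ i; rewrite /= in_itv /=; exact: ub.
exists x => [i|e N e0]; first by have := xI i; rewrite /= in_itv.
have uN : (u @ \oo) (u @` [set n | (N <= n)%N]).
  apply: (@filterS _ \oo _ [set n | (N <= n)%N] _ _ (nbhs_infty_ge N)).
  by move=> n Nn; exists n.
by have [_ [[n Nn <-] h]] := cx _ _ uN (nbhs_rV x e0); exists n.
Qed.

Lemma geometric_small (R : realType) (q C e : R) : 0 <= q < 1 -> 0 <= C -> 0 < e ->
  exists N, forall r, (N <= r)%N -> C * q ^+ r < e.
Proof.
move=> /andP[q0 q1] C0 e0.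
have nq : `|q| < 1 by rewrite ger0_norm.
have eC : 0 < e / (C + 1) by rewrite divr_gt0// ltr_wpDl.
have [N _ h] := cvgr0_norm_lt _ (cvg_expr nq) _ eC.
exists N => r /h /=; rewrite ger0_norm ?exprn_ge0// ltr_pdivlMr ?ltr_wpDl// => qr.
by apply: le_lt_trans qr; rewrite mulrDr mulr1 mulrC lerDl exprn_ge0.
Qed.

Definition sup_cont (R : realType) k (A : 'rV[R]_k -> Prop) (G : 'rV[R]_k -> 'rV[R]_k) :=
  forall x, A x -> forall e, 0 < e -> exists2 d, 0 < d & forall y, A y ->
    (forall i, `|y 0 i - x 0 i| < d) -> forall i, `|G y 0 i - G x 0 i| < e.

Definition cube (R : realType) k (x : 'rV[R]_k) := forall i, `|x 0 i| <= 1.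

Section BorsukUlam2.
Variables (R : realType) (m : nat) (G : 'rV[R]_m.+1 -> 'rV[R]_m.+1).
Let V := 'rV[R]_m.+1.
Hypothesis Gc : sup_cont (@cube R m.+1) G.
Hypothesis Godd : forall x, cube x -> (exists i, `|x 0 i| = 1) -> G (- x) = - G x.

Definition clamp (t : R) : R := Num.max (-1) (Num.min 1 t).

Lemma clampN t : clamp (- t) = - clamp t.
Proof. by rewrite /clamp oppr_max oppr_min opprK maxC minC; have [] := leP (-1) t; have [] := leP t 1; rewrite /Num.max/Num.min; do ?case: ifP; lra. Qed.

Lemma clamp_bd t : `|clamp t| <= 1.
Proof. by rewrite ler_norml /clamp le_max lexx ge_max ge_min; lra. Qed.

Lemma clamp_lip s t : `|clamp s - clamp t| <= `|s - t|.
Proof.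
rewrite /clamp /Num.max /Num.min; do ?case: ifP; move=> *; have := normr_ge0 (s - t);
  rewrite ler_norml; case: (lerP 0 (s - t)) => h; rewrite ?(ger0_norm h) ?(ltr0_norm h); lra.
Qed.

Lemma clamp_big t : 1 <= `|t| -> `|clamp t| = 1.
Proof.
rewrite ler_normr => /orP[t1|t1]; rewrite /clamp.
  by rewrite min_l// max_r ?normr1//; lra.
by rewrite min_r ?max_l ?normrN1//; lra.
Qed.

Definition toCube (v : V) : V := \row_i clamp (m.+1%:R * v 0 i).

Definition maxidx (g : V) : 'I_m.+1 := [arg max_(i > ord0) `|g 0 i|]%O.

Lemma maxidxN (g : V) : maxidx (- g) = maxidx g.
Proof.
rewrite /maxidx (_ : (fun i => `|(- g) 0 i|) = (fun i => `|g 0 i|))//.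
by apply/funext => i; rewrite mxE normrN.
Qed.

Lemma maxidxP (g : V) i : `|g 0 i| <= `|g 0 (maxidx g)|.
Proof. by rewrite /maxidx; case: arg_maxP => //= j _; apply. Qed.

Definition gsign (g : V) : bool := g 0 (maxidx g) < 0.

Definition glab (v : V) : nat := let g := G (toCube v) in (gsign g + (maxidx g).*2)%N.

Lemma toCube_cube v : cube (toCube v).
Proof. by move=> i; rewrite mxE clamp_bd. Qed.

Lemma toCubeN v : toCube (- v) = - toCube v.
Proof. by apply/rowP => i; rewrite !mxE mulrN clampN. Qed.

Lemma glab_half v : (glab v)./2 = maxidx (G (toCube v)).
Proof. by rewrite /glab; case: gsign; rewrite /= ?uphalf_double ?doubleK. Qed.

Lemma glab_odd v : odd (glab v) = gsign (G (toCube v)).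
Proof. by rewrite /glab oddD odd_double addbF; case: gsign. Qed.

Lemma glabN v : (exists i, `|toCube v 0 i| = 1) -> G (toCube v) <> 0 ->
  glab (- v) = flip (glab v).
Proof.
move=> bv nz; have gN : G (toCube (- v)) = - G (toCube v).
  by rewrite toCubeN Godd//; exact: toCube_cube.
have g0 : G (toCube v) 0 (maxidx (G (toCube v))) != 0.
  apply/eqP => g0; apply: nz; apply/rowP => i; rewrite mxE; apply/eqP.
  by rewrite -normr_le0 (le_trans (maxidxP _ i))// g0 normr0.
have sN : gsign (G (toCube (- v))) = ~~ gsign (G (toCube v)).
  by rewrite gN /gsign maxidxN mxE oppr_lt0 -leNgt le_eqVlt eq_sym (negbTE g0).
rewrite /flip glab_odd {1}/glab sN gN maxidxN /glab.
by case: gsign => /=; lia.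
Qed.

(** A map of the cube that is odd on the boundary has a zero: label a point by
    the coordinate of largest absolute value of its image, with its sign. *)
Theorem borsuk_ulam : exists2 x, cube x & G x = 0.
Proof.
apply: contrapT => nz.
have {}nz x : cube x -> G x <> 0 by move=> cx gx; apply: nz; exists x.
have small (r : nat) : exists yz : V * V, [/\ cube yz.1, cube yz.2,
    forall i, `|yz.1 0 i - yz.2 0 i| <= m.+1%:R * (contraction R m ^+ r * 2),
    maxidx (G yz.1) = maxidx (G yz.2) &
    G yz.1 0 (maxidx (G yz.1)) < 0 <= G yz.2 0 (maxidx (G yz.2))].
  apply: contrapT => none.
  have c2 t : close (contraction R m ^+ r * 2) t -> labnc glab t.
    move=> ct _ _ /mapP[x xt ->] /mapP[y yt ->] h.
    have hi : maxidx (G (toCube x)) = maxidx (G (toCube y)).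
      by apply/val_inj; rewrite /= -(glab_half x) -(glab_half y).
    rewrite -[LHS]odd_double_half -[RHS]odd_double_half h; congr (nat_of_bool _ + _)%N.
    have cl x' y' : x' \in t -> y' \in t -> forall i, `|toCube x' 0 i - toCube y' 0 i| <=
        m.+1%:R * (contraction R m ^+ r * 2).
      move=> xt' yt' i; rewrite !mxE (le_trans (clamp_lip _ _))//.
      by rewrite -mulrBr normrM ger0_norm ?ler_wpM2l ?ct.
    rewrite !glab_odd /gsign; apply/idP/idP => h1; rewrite ltNge; apply/negP => h2;
      apply: none; [exists (toCube x, toCube y)|exists (toCube y, toCube x)].
    1,2: by split => /=; [exact: toCube_cube|exact: toCube_cube|exact: cl| |rewrite ?h1 ?h2].
  have [sz shape] : all (fun t => size t == m.+2) (map (cons 0) (sphere R m m)) /\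
      forall d, (d <= m)%N -> all (fun t => size t == d.+1) (hemi R m d).
    split=> [|d dm].
      by rewrite all_map; apply: sub_all (size_sphere R m m) => t /= /eqP ->.
    by have := size_sphere R m d; rewrite all_cat => /andP[].
  have h2 d t : (d <= m)%N -> t \in hemi R m d ->
      forall v, v \in t -> forall i, -1 <= v 0 i <= 1.
    move=> dm /(hemi_signs dm)[e e1 te] v /te[j _ ->] i; rewrite !mxE eqxx /=.
    by case: (e1 j) => ->; case: (i == j); rewrite /= ?mulr0 ?mulr1; apply/andP; split; lra.
  have cl2 (t : seq V) : (forall v : V, v \in t -> forall i, -1 <= v 0 i <= 1) -> close 2 t.
    move=> h x y /h hx /h hy i; have := hx i; have := hy i.
    by rewrite ler_norml; lra.
  apply: (@tucker_absurd R m glab r).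
  - by move=> v; rewrite glab_half.
  - move=> d s dm sd; split.
      apply: c2; apply: iter_Sd_close sd => //; first by rewrite ltnS ltnW.
        exact: shape.
      by move=> t td; exact/cl2/(h2 _ _ dm td).
    move=> v vs; apply: glabN; last exact/nz/toCube_cube.
    (* some coordinate of a point of the crosspolytope's boundary is at least
       1 / m.+1 in absolute value *)
    have [t td tC] := iter_Sd_closed (shape _ dm) sd.
    have [e e1 te] := hemi_signs dm td.
    have : \sum_i - e i * v 0 i <= -1.
      apply: (tC _ (@linear_closed R m _ _)) vs => w /te[j _ ->].
      rewrite (bigD1 j)//= big1 ?addr0 => [|i ij]; last first.
        by rewrite !mxE (negbTE ij) andbF mulr0 mulr0.
      by rewrite !mxE !eqxx mulr1; case: (e1 j) => ->; rewrite ?mulNr ?mulrN ?mulr1 ?opprK.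
    move=> hv; apply: contrapT => nb.
    have vi i : `|v 0 i| < m.+1%:R^-1.
      rewrite ltNge; apply/negP => vi; apply: nb; exists i; rewrite mxE.
      by apply: clamp_big; rewrite normrM ger0_norm// -ler_pdivrMl ?ltr0n// mulr1.
    have : \sum_i - e i * v 0 i > \sum_(i < m.+1) - m.+1%:R^-1.
      apply: ltr_sum => [|i _]; first by apply/hasP; exists ord0; rewrite ?mem_index_enum.
      rewrite -[ltRHS]opprK ltrN2 -mulNr opprK (le_lt_trans _ (vi i))//.
      by rewrite (le_trans (ler_norm _))// normrM; case: (e1 i) => ->; rewrite ?normrN ?normr1 mul1r.
    rewrite sumr_const card_ord -[X in X < _]mulr_natl mulrN divff ?pnatr_eq0//.
    by move=> /lt_le_trans/(_ hv); rewrite ltxx.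
  - move=> s si; apply: c2; apply: iter_Sd_close si => // t /mapP[u uS ->].
    apply: cl2 => v; rewrite inE => /orP[/eqP -> i|]; first by rewrite mxE; apply/andP; split; lra.
    move: v; move: uS; rewrite mem_cat => /orP[uh|/mapP[w wh ->]]; first exact: h2 uh.
    by move=> _ /mapP[v /(h2 _ _ (leqnn m) wh) vw ->] i; have := vw i; rewrite mxE; lra.
have [yz yzP] := choice small.
pose lo : 'rV[R]_m.+1 := const_mx (-1); pose hi : 'rV[R]_m.+1 := const_mx 1.
have [|x xl cx] := @rV_cluster R m.+1 lo hi (fun r => (yz r).1).
  by move=> r i; rewrite !mxE; have [/(_ i)+ _ _ _ _] := yzP r; rewrite ler_norml.
have xc : cube x by move=> i; have := xl i; rewrite !mxE ler_norml.
apply: (nz x xc); apply/rowP => j; rewrite mxE; apply/eqP; rewrite -normr_le0.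
apply/ler_addgt0Pl => e e0; rewrite addr0.
have e3 : 0 < e / 3 by rewrite divr_gt0.
have [d d0 Gd] := Gc xc e3; have d2 : 0 < d / 2 by rewrite divr_gt0.
have [N mesh] : exists N, forall r, (N <= r)%N ->
    (m.+1%:R * 2) * contraction R m ^+ r < d / 2.
  apply: geometric_small => //.
  by rewrite /contraction divr_ge0//= ltr_pdivrMr ?ltr0n// mul1r ltr_nat.
have [r Nr xr] := cx (d / 2) N d2.
have [c1 c2 yzr mi /andP[s1 s2]] := yzP r.
have g1 : forall i, `|G (yz r).1 0 i - G x 0 i| < e / 3.
  by apply: Gd => // i; apply: lt_trans (xr i) _; rewrite ltr_pdivrMr// mulr_natr mulr2n ltrDl.
have g2 : forall i, `|G (yz r).2 0 i - G x 0 i| < e / 3.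
  apply: Gd => // i; have := xr i; have := mesh r Nr; have := yzr i.
  rewrite -mulrA [2 * _]mulrC; move: (m.+1%:R * _) => q.
  by rewrite !ltr_norml ler_norml; lra.
rewrite -mi in s2.
have := maxidxP (G (yz r).1) j; have := g1 j; have := g1 (maxidx (G (yz r).1)).
have := g2 (maxidx (G (yz r).1)); rewrite (ltr0_norm s1).
set p := G _ 0 _ in s1 *; set q := G _ 0 _ in s2 *.
rewrite !ltr_norml !ler_norml; lra.
Qed.

End BorsukUlam2.

(** * Path metrics *)
Section EuclidDist.
Variables (R : realType) (n : nat).
Implicit Types x y z : 'rV[R]_n.
Local Notation ed := (@euclid_dist R n).

Lemma ed_ge0 x y : 0 <= ed x y.
Proof. exact: sqrtr_ge0. Qed.

Lemma ed_sym x y : ed x y = ed y x.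
Proof. by rewrite /euclid_dist; under eq_bigr do rewrite -sqrrN opprB. Qed.

Lemma ed_sqr x y : ed x y ^+ 2 = \sum_i (x 0 i - y 0 i) ^+ 2.
Proof. by rewrite sqr_sqrtr// sumr_ge0// => i _; exact: sqr_ge0. Qed.

Lemma coord_le_ed x y i : `|x 0 i - y 0 i| <= ed x y.
Proof.
rewrite -(ler_pXn2r (n := 2)) ?nnegrE ?ed_ge0// ed_sqr -normrX ger0_norm ?sqr_ge0//.
by rewrite (bigD1 i)//= lerDl sumr_ge0// => j _; exact: sqr_ge0.
Qed.

Lemma cauchy_schwarz (f g : 'I_n -> R) :
  (\sum_i f i * g i) ^+ 2 <= (\sum_i f i ^+ 2) * (\sum_i g i ^+ 2).
Proof.
have : 0 <= \sum_i \sum_j (f i * g j - f j * g i) ^+ 2.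
  by apply: sumr_ge0 => i _; apply: sumr_ge0 => j _; exact: sqr_ge0.
have -> : \sum_i \sum_j (f i * g j - f j * g i) ^+ 2 =
    2 * ((\sum_i f i ^+ 2) * (\sum_i g i ^+ 2) - (\sum_i f i * g i) ^+ 2).
  transitivity (\sum_i \sum_j (f i ^+ 2 * g j ^+ 2 + f j ^+ 2 * g i ^+ 2
      - 2 * ((f i * g i) * (f j * g j)))).
    by apply: eq_bigr => i _; apply: eq_bigr => j _; ring.
  have sp (p q : 'I_n -> R) : \sum_i \sum_j p i * q j = (\sum_i p i) * (\sum_i q i).
    by rewrite mulr_suml; apply: eq_bigr => i _; rewrite mulr_sumr.
  have lin (p q r : 'I_n -> 'I_n -> R) : \sum_i \sum_j (p i j + q i j - 2 * r i j) =
      \sum_i \sum_j p i j + \sum_i \sum_j q i j - 2 * \sum_i \sum_j r i j.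
    rewrite mulr_sumr -big_split -sumrB; apply: eq_bigr => i _ /=.
    by rewrite mulr_sumr -big_split -sumrB.
  rewrite (lin (fun i j => f i ^+ 2 * g j ^+ 2) (fun i j => f j ^+ 2 * g i ^+ 2)
    (fun i j => f i * g i * (f j * g j))).
  have -> : \sum_i \sum_j f j ^+ 2 * g i ^+ 2 = (\sum_i f i ^+ 2) * (\sum_i g i ^+ 2).
    by rewrite exchange_big /= sp.
  by rewrite !sp; ring.
by rewrite pmulr_rge0// subr_ge0.
Qed.

Lemma ed_triangle y x z : ed x z <= ed x y + ed y z.
Proof.
rewrite -(ler_pXn2r (n := 2)) ?nnegrE ?addr_ge0 ?ed_ge0//.
rewrite sqrrD !ed_sqr.
have -> : \sum_i (x 0 i - z 0 i) ^+ 2 = \sum_i (x 0 i - y 0 i) ^+ 2 +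
    (\sum_i (x 0 i - y 0 i) * (y 0 i - z 0 i)) *+ 2 + \sum_i (y 0 i - z 0 i) ^+ 2.
  by rewrite -sumrMnl -!big_split; apply: eq_bigr => i _ /=; ring.
rewrite lerD2r lerD2l lerMn2r /= (le_trans (ler_norm _))//.
rewrite -(ler_pXn2r (n := 2)) ?nnegrE ?mulr_ge0 ?ed_ge0// -normrX.
by rewrite ger0_norm ?sqr_ge0// exprMn !ed_sqr; exact: cauchy_schwarz.
Qed.

Lemma ed_le_sum x y : ed x y <= \sum_i `|x 0 i - y 0 i|.
Proof.
rewrite -(ler_pXn2r (n := 2)) ?nnegrE ?ed_ge0 ?sumr_ge0// ed_sqr.
suff [] : 0 <= \sum_i `|x 0 i - y 0 i| /\
    \sum_i (x 0 i - y 0 i) ^+ 2 <= (\sum_i `|x 0 i - y 0 i|) ^+ 2 by [].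
apply: (big_ind2 (fun p q => 0 <= q /\ p <= q ^+ 2)) => [|p q p' q' [q0 pq] [q'0 pq']|i _].
- by rewrite expr0n.
- by split; [exact: addr_ge0|nra].
- by rewrite real_normK ?num_real.
Qed.

Lemma ed_xx x : ed x x = 0.
Proof. by rewrite /euclid_dist big1 ?sqrtr0// => i _; rewrite subrr expr0n. Qed.

Lemma ed_line x y s t :
  ed (x + s *: (y - x)) (x + t *: (y - x)) = `|s - t| * ed x y.
Proof.
apply/eqP; rewrite -(eqrXn2 (n := 2)) ?mulr_ge0 ?ed_ge0// exprMn !ed_sqr.
rewrite real_normK ?num_real// mulr_sumr; apply/eqP/eq_bigr => i _.
by rewrite !mxE; ring.
Qed.

End EuclidDist.

Section Polygons.
Variables (R : realType) (n : nat).
Implicit Types (c : R -> 'rV[R]_n) (t : seq R) (S : set 'rV[R]_n) (x y z : 'rV[R]_n).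
Local Notation ed := (@euclid_dist R n).

Fixpoint polylen c (a : R) t : R :=
  if t is b :: t' then ed (c a) (c b) + polylen c b t' else 0.

Lemma polygon_lengthE c a t : polygon_length c a t = polylen c a t.
Proof.
elim: t a => [|b t ih] a; first by rewrite /polygon_length big_geq.
by rewrite /polygon_length big_nat_recl//= -ih.
Qed.

Lemma polylen_ge0 c a t : 0 <= polylen c a t.
Proof. by elim: t a => //= b t ih a; rewrite addr_ge0 ?ed_ge0. Qed.

Lemma polylen_cat c a t t' :
  polylen c a (t ++ t') = polylen c a t + polylen c (last a t) t'.
Proof. by elim: t a => [|b t ih] a /=; rewrite ?add0r// ih addrA. Qed.

Lemma polylen_map c c' (f : R -> R) a t :
  (forall s, s \in a :: t -> c s = c' (f s)) ->
  polylen c a t = polylen c' (f a) (map f t).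
Proof.
elim: t a => //= b t ih a h; rewrite !h ?inE ?eqxx ?orbT//; congr (_ + _).
by apply: ih => s sb; apply: h; rewrite inE sb orbT.
Qed.

Lemma polylen_rev c a t :
  polylen c (last a t) (rev (belast a t)) = polylen c a t.
Proof.
elim: t a => //= b t ih a; rewrite rev_cons -cats1 polylen_cat ih /= addr0 addrC.
congr (_ + _); rewrite ed_sym; congr (ed _ (c _)).
by case/lastP: t {ih} => //= t z; rewrite belast_rcons rev_cons last_rcons.
Qed.

Lemma polylen_split c a b h t : a < h -> h < b -> path <%O a t -> last a t = b ->
  exists t1 t2, [/\ path <%O a t1, last a t1 = h, path <%O h t2, last h t2 = b &
    polylen c a t <= polylen c a t1 + polylen c h t2].
Proof.
move=> + hb; elim: t a => [|x t ih] a /= ah; first by move=> _ ab; move: (lt_trans ah hb); rewrite ab ltxx.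
case/andP=> ax pt lt; have [xh|hx|xh] := ltgtP x h.
- have [t1 [t2 [p1 l1 p2 l2 le]]] := ih x xh pt lt.
  exists (x :: t1), t2; split=> //=; first by rewrite ax.
  by rewrite -addrA lerD2l.
- exists [:: h], (x :: t); split=> //=; rewrite ?ah ?hx//.
  by rewrite addr0 addrA lerD2r ed_triangle.
- by exists [:: h], t; rewrite /= ah addr0 -xh; split.
Qed.

Lemma curve_length_le c (L : R) :
  (forall t, path <%O 0 t -> last 0 t = 1 -> polylen c 0 t <= L) ->
  (curve_length c <= L%:E)%E.
Proof.
move=> h; apply: ge_ereal_sup => _ [t [pt /eqP lt] <-].
by rewrite lee_fin polygon_lengthE h.
Qed.

Lemma curve_length_ge c t : path <%O 0 t -> last 0 t = 1 ->
  ((polylen c 0 t)%:E <= curve_length c)%E.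
Proof.
move=> pt lt; apply: ereal_sup_ubound; exists t; last by rewrite polygon_lengthE.
by split=> //; apply/eqP.
Qed.

Lemma within_contP c : {within `[(0 : R), 1], continuous c} <->
  forall x : R, 0 <= x <= 1 -> forall e : R, 0 < e -> exists2 d : R, 0 < d &
    forall y : R, 0 <= y <= 1 -> `|y - x| < d -> forall i, `|c y 0 i - c x 0 i| < e.
Proof.
rewrite subspace_continuousP; split=> h x.
  move=> x01 e e0; have xI : `[0, 1]%classic x by rewrite /= in_itv.
  have [d /= d0 xd] := h x xI _ (nbhs_rV (c x) e0).
  by exists d => // y y01 yx i; apply: (xd y); rewrite /= ?in_itv//= distrC.
rewrite /= in_itv /= => x01 A /nbhs_ballP[e /= e0 eA].
have [d d0 xd] := h x x01 e e0; exists d => //= y /= yx.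
rewrite in_itv /= => y01; apply: eA; split=> // i j; rewrite ord1.
by rewrite /ball /= distrC; apply: xd => //; rewrite distrC.
Qed.

(** A curve as it enters the definition of the path metric, of length less
    than L; the length is tested on partitions. *)
Definition short_curve S x y (L : R) c :=
  curve_in S x y c /\
  exists2 L', L' < L & forall t, path <%O 0 t -> last 0 t = 1 -> polylen c 0 t <= L'.

Lemma path_dist_ltP S x y L :
  (path_dist S x y < L%:E)%E <-> exists c, short_curve S x y L c.
Proof.
split.
  move=> /ereal_inf_lt[_ [c cS <-]] cL; exists c; split=> //.
  have c0 : (0 <= curve_length c)%E.
    apply: le_trans (@curve_length_ge c [:: 1] _ _) => //=; last by rewrite ltr01.
    by rewrite lee_fin addr_ge0 ?ed_ge0.
  have fc : curve_length c \is a fin_num by rewrite ge0_fin_numE// (lt_trans cL) ?ltry.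
  exists (fine (curve_length c)); first by rewrite -lte_fin fineK.
  by move=> t pt lt; rewrite -lee_fin fineK// curve_length_ge.
move=> [c [cS [L' L'L h]]]; apply: le_lt_trans (_ : L'%:E < L%:E)%E; last by rewrite lte_fin.
by apply: le_trans (curve_length_le h); apply: ereal_inf_lbound; exists c.
Qed.

Lemma path_dist_ge S x y : ((ed x y)%:E <= path_dist S x y)%E.
Proof.
apply: le_ereal_inf_tmp => _ [c [_ <- <- _] <-].
apply: le_trans (@curve_length_ge c [:: 1] _ _) => //=; last by rewrite ltr01.
by rewrite addr0.
Qed.

Lemma path_dist_ge0 S x y : (0 <= path_dist S x y)%E.
Proof. by apply: le_trans (path_dist_ge S x y); rewrite lee_fin ed_ge0. Qed.

Lemma path_dist_segment S x y : (forall t : R, 0 <= t <= 1 -> S (x + t *: (y - x))) ->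
  (path_dist S x y <= (ed x y)%:E)%E.
Proof.
move=> xyS; pose c (t : R) := x + t *: (y - x).
apply: (@le_trans _ _ (curve_length c)).
  apply: ereal_inf_lbound; exists c => //; split=> //.
  - apply/within_contP => s _ e e0.
    pose M := \sum_i `|(y - x) 0 i|; have M0 : 0 <= M by exact: sumr_ge0.
    exists (e / (M + 1)); first by rewrite divr_gt0 ?ltr_wpDl.
    move=> t _ ts i; rewrite /c !mxE opprD addrACA subrr add0r -mulrBl normrM.
    have : `|y 0 i - x 0 i| <= M by rewrite /M (bigD1 i)//= !mxE lerDl sumr_ge0.
    rewrite ltr_pdivlMr ?ltr_wpDl// in ts => h.
    apply: le_lt_trans ts; rewrite ler_wpM2l//; lra.
  - by rewrite /c scale0r addr0.
  - by rewrite /c scale1r addrC subrK.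
apply: curve_length_le => t pt lt.
have -> : ed x y = `|last 0 t - 0| * ed x y by rewrite lt subr0 normr1 mul1r.
elim: t (0 : R) pt {lt} => [|b t ih] a /=; first by rewrite mulr_ge0 ?ed_ge0.
case/andP=> ab /[dup] pt /ih h; have blt : b <= last b t.
  elim: t b pt {ih h ab} => //= z t ih b /andP[/ltW bz /ih]; exact: le_trans.
rewrite [ed (c a) _]ed_line (le_trans (lerD (lexx _) h))// -mulrDl ler_wpM2r ?ed_ge0//.
rewrite distrC !ger0_norm ?subr_ge0//; [lra|exact: le_trans (ltW ab) blt|exact: ltW].
Qed.

Lemma path_dist_sym S x y : path_dist S x y = path_dist S y x.
Proof.
suff h u v : (path_dist S u v <= path_dist S v u)%E by apply/eqP; rewrite eq_le !h.
apply: le_ereal_inf_tmp => _ [c [cc c0 c1 cS] <-].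
apply: (@le_trans _ _ (curve_length (fun r : R => c (1 - r)))).
  apply: ereal_inf_lbound; exists (fun r : R => c (1 - r)) => //; split.
  - apply/within_contP => a a01 e e0.
    have a01' : 0 <= 1 - a <= 1 by lra.
    have [d d0 h] := (within_contP c).1 cc _ a01' e e0.
    exists d => // b b01 ba; apply: h; first by lra.
    by rewrite (_ : 1 - b - (1 - a) = a - b) 1?distrC//; ring.
  - by rewrite subr0.
  - by rewrite subrr.
  - by move=> t t01; apply: cS; lra.
apply: ge_ereal_sup => _ [t [pt /eqP lt] <-]; rewrite polygon_lengthE.
rewrite -polylen_rev lt (@polylen_map _ c (fun r : R => 1 - r))// subrr.
have [pr lr] : path <%O (1 - 1) (map (fun r : R => 1 - r) (rev (belast 0 t))) /\
    last (1 - 1) (map (fun r : R => 1 - r) (rev (belast 0 t))) = 1.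
  split.
    have := pt; rewrite -(rev_path (>%O)) lt.
    rewrite -[X in _ -> path _ X _]/((fun r : R => 1 - r) 1) path_map.
    by apply: sub_path => p q /= pq; rewrite ltrD2l ltrN2.
  rewrite (last_map (fun r : R => 1 - r)); case: t lt {pt} => /= [/eqP|b t _].
    by rewrite eq_sym oner_eq0.
  by rewrite rev_cons last_rcons subr0.
by rewrite subrr in pr lr; exact: curve_length_ge.
Qed.

End Polygons.

Section PathDist.
Variables (R : realType) (n : nat).
Implicit Types (c : R -> 'rV[R]_n) (S : set 'rV[R]_n) (x y z : 'rV[R]_n).
Local Notation ed := (@euclid_dist R n).

Lemma path_map_affine (p q : R) (a : R) (t : seq R) : 0 < p -> path <%O a t ->
  path <%O (p * a + q) (map (fun s => p * s + q) t).
Proof.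
move=> p0; rewrite -[p * a + q]/((fun s => p * s + q) a) path_map.
by apply: sub_path => u v /= uv; rewrite ltrD2r ltr_pM2l.
Qed.

Lemma path_dist_concat S x y z (L1 L2 : R) : (path_dist S x y < L1%:E)%E ->
  (path_dist S y z < L2%:E)%E -> (path_dist S x z < (L1 + L2)%:E)%E.
Proof.
move=> /path_dist_ltP[c1 [[cc1 c10 c11 cS1] [l1 l1L h1]]].
move=> /path_dist_ltP[c2 [[cc2 c20 c21 cS2] [l2 l2L h2]]].
pose c (s : R) := if s <= 2^-1 then c1 (2 * s) else c2 (2 * s - 1).
have cL (s : R) : s <= 2^-1 -> c s = c1 (2 * s) by rewrite /c => ->.
have cR (s : R) : 2^-1 <= s -> c s = c2 (2 * s - 1).
  rewrite /c le_eqVlt => /orP[/eqP <-|]; last by rewrite ltNge => /negbTE ->.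
  by rewrite lexx mulfV// subrr c11 c20.
apply/path_dist_ltP; exists c; split.
  split.
  - apply/within_contP => s s01 e e0.
    have w1 : s <= 2^-1 -> exists2 d : R, 0 < d & forall r : R, 0 <= r <= 2^-1 ->
        `|r - s| < d -> forall i, `|c r 0 i - c s 0 i| < e.
      move=> sh; have s2 : 0 <= 2 * s <= 1 by lra.
      have [d d0 h] := (within_contP c1).1 cc1 _ s2 e e0.
      exists (d / 2) => [|r r01 rs]; first by rewrite divr_gt0.
      rewrite !cL; [|lra..]; apply: h; first by lra.
      by rewrite -mulrBr normrM ger0_norm// mulrC -ltr_pdivlMr.
    have w2 : 2^-1 <= s -> exists2 d : R, 0 < d & forall r : R, 2^-1 <= r <= 1 ->
        `|r - s| < d -> forall i, `|c r 0 i - c s 0 i| < e.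
      move=> sh; have s2 : 0 <= 2 * s - 1 <= 1 by lra.
      have [d d0 h] := (within_contP c2).1 cc2 _ s2 e e0.
      exists (d / 2) => [|r r01 rs]; first by rewrite divr_gt0.
      rewrite !cR; [|lra..]; apply: h; first by lra.
      rewrite (_ : _ - _ = 2 * (r - s)); last by ring.
      by rewrite normrM ger0_norm// mulrC -ltr_pdivlMr.
    have [sh|sh|sh] := ltgtP s 2^-1.
    + have [d d0 h] := w1 (ltW sh); exists (Num.min d (2^-1 - s)).
        by rewrite lt_min d0 subr_gt0.
      move=> r r01; rewrite lt_min => /andP[rd]; rewrite ltr_norml => rs.
      by apply: h => //; lra.
    + have [d d0 h] := w2 (ltW sh); exists (Num.min d (s - 2^-1)).
        by rewrite lt_min d0 subr_gt0.
      move=> r r01; rewrite lt_min => /andP[rd]; rewrite ltr_norml => rs.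
      by apply: h => //; lra.
    + have [|d1 d10 h] := w1; first by rewrite sh.
      have [|d2 d20 h'] := w2; first by rewrite sh.
      exists (Num.min d1 d2); first by rewrite lt_min d10.
      move=> r r01; rewrite lt_min => /andP[rd1 rd2].
      by have [rh|rh] := leP r 2^-1; [apply: h|apply: h'] => //; lra.
  - by rewrite cL ?mulr0.
  - have e1 : 2 * 1 - 1 = 1 :> R by ring.
    by rewrite cR ?e1//; lra.
  - move=> t t01; rewrite /c; case: ifP => th; [apply: cS1|apply: cS2]; first by lra.
    by move/negbT: th; rewrite -ltNge; lra.
exists (l1 + l2) => [|t pt lt]; first exact: ltrD.
have [||t1 [t2 [p1 l1' p2 l2' le]]] := @polylen_split _ _ c 0 1 2^-1 t _ _ pt lt.
- by rewrite invr_gt0.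
- by rewrite invf_lt1 // ltr1n.
have sortle (a : R) t' s : path <%O a t' -> s \in a :: t' -> a <= s <= last a t'.
  elim: t' s a => [|b t' ih] s a; first by rewrite inE => _ /eqP -> /=; rewrite lexx.
  case/andP=> ab pb; rewrite inE => /orP[/eqP ->|sb] /=; rewrite ?lexx.
    by have /andP[_] := ih b b pb (mem_head _ _); apply: le_trans (ltW ab).
  by have /andP[bs ->] := ih s b pb sb; rewrite andbT (le_trans (ltW ab)).
apply: le_trans le _; apply: lerD.
  rewrite (@polylen_map _ _ c c1 (fun s => 2 * s + 0)) => [|s /(sortle _ _ _ p1)].
    have := @path_map_affine 2 0 0 t1 _ p1; rewrite mulr0 addr0.
    move=> /(_ _)/h1; apply=> //.
    by rewrite -[X in last X _]addr0 -{1}(mulr0 2) (last_map (fun s => 2 * s + 0)) l1' addr0 mulfV.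
  by rewrite l1' addr0 => sl; apply: cL; lra.
rewrite (@polylen_map _ _ c c2 (fun s => 2 * s - 1)) => [|s /(sortle _ _ _ p2)].
  have e0 : 2 * 2^-1 - 1 = 0 :> R by rewrite mulfV// subrr.
  have := @path_map_affine 2 (-1) _ t2 _ p2; rewrite e0.
  move=> /(_ _)/h2; apply=> //.
  by rewrite -{1}e0 (last_map (fun s => 2 * s - 1)) l2' mulr1 addrK.
by rewrite l2' => sl; apply: cR; lra.
Qed.

Lemma path_dist_triangle S x y z :
  (path_dist S x z <= path_dist S x y + path_dist S y z)%E.
Proof.
have := path_dist_ge0 S x y; have := path_dist_ge0 S y z.
case e1 : (path_dist S x y) => [a| |]//; case e2 : (path_dist S y z) => [b| |]// _ _;
  rewrite ?addey ?addye ?leey//.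
apply/lee_addgt0Pr => e e0; rewrite -!EFinD.
rewrite (_ : a + b + e = (a + e / 2) + (b + e / 2)); last by lra.
apply/ltW/(@path_dist_concat S x y z); first by rewrite e1 lte_fin ltrDl divr_gt0.
by rewrite e2 lte_fin ltrDl divr_gt0.
Qed.

(** Every value of a coordinate between those at the endpoints is attained on a
    short curve, at a point that the curve reaches even sooner. *)
Lemma path_dist_cross S x y (L v : R) i : (path_dist S x y < L%:E)%E ->
  Num.min (x 0 i) (y 0 i) <= v <= Num.max (x 0 i) (y 0 i) ->
  exists z, [/\ S z, z 0 i = v & (path_dist S x z < L%:E)%E].
Proof.
move=> /path_dist_ltP[c [[cc c0 c1 cS] [l lL h]]] v01.
have [||| tau] := @IVT R (fun t => c t 0 i) 0 1 v => //; rewrite ?c0 ?c1//.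
  have /within_contP cc' := cc.
  apply/subspace_continuousP => s; rewrite /= in_itv /= => s01 A /nbhs_ballP[e /= e0 eA].
  have [d d0 hd] := cc' s s01 e e0; exists d => //= r rs; rewrite in_itv /= => r01.
  by apply: eA; rewrite /ball /= distrC; apply: hd => //; rewrite distrC.
rewrite in_itv /= => tau01 ctau; exists (c tau); split=> //; first exact: cS.
have l0 : 0 <= l.
  by apply: le_trans (h [:: 1] _ _) => //=; rewrite ?ltr01// addr0 ed_ge0.
apply/path_dist_ltP; exists (fun s => c (tau * s)); split.
  split.
  - apply/within_contP => s s01 e e0.
    have ts : 0 <= tau * s <= 1 by nra.
    have [d d0 hd] := (within_contP c).1 cc _ ts e e0.
    exists d => // r r01 rs; apply: hd; first by nra.
    rewrite -mulrBr normrM ger0_norm; last by lra.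
    by apply: le_lt_trans rs; rewrite ler_piMl//; lra.
  - by rewrite mulr0.
  - by rewrite mulr1.
  - by move=> t t01; apply: cS; nra.
exists l => // t pt lt.
have [t0|t0] := eqVneq tau 0.
  apply: le_trans l0; rewrite t0.
  have -> // : forall a, polylen (fun s : R => c (0 * s)) a t = 0.
  by elim: t {pt lt} => //= b t ih a; rewrite !mul0r ed_xx ih addr0.
have tau0 : 0 < tau by rewrite lt_def t0; lra.
rewrite (@polylen_map _ _ _ c (fun s => tau * s + 0)) => [|s _]; last by rewrite addr0.
have pt' := @path_map_affine tau 0 0 t tau0 pt.
have lt' : last (tau * 0 + 0) (map (fun s => tau * s + 0) t) = tau.
  by rewrite (last_map (fun s => tau * s + 0)) lt mulr1 addr0.
rewrite mulr0 addr0 in pt' lt' *.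
have [t1|t1] := eqVneq tau 1; first by apply: h => //; rewrite lt'.
apply: (le_trans _ (h (map (fun s => tau * s + 0) t ++ [:: 1]) _ _)).
- by rewrite polylen_cat lerDl polylen_ge0.
- by rewrite cat_path pt' /= lt' andbT lt_neqAle t1; lra.
- by rewrite last_cat.
Qed.

(** A function that is Lipschitz near every point reached changes by at most
    the Lipschitz constant times the length. *)
Lemma path_dist_lipschitz S x y (L C : R) (u : 'rV[R]_n -> R) : 0 <= C ->
  (path_dist S x y < L%:E)%E ->
  (forall z, S z -> ed x z < L -> exists2 e : R, 0 < e & forall z1 z2, S z1 -> S z2 ->
    (forall i, `|z1 0 i - z 0 i| < e) -> (forall i, `|z2 0 i - z 0 i| < e) ->
    `|u z1 - u z2| <= C * ed z1 z2) ->
  `|u x - u y| <= C * L.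
Proof.
move=> C0 /path_dist_ltP[c [[cc c0 c1 cS] [l lL h]]] uL.
have near (s : R) : 0 <= s <= 1 -> exists2 d : R, 0 < d & forall r1 r2 : R,
    0 <= r1 <= 1 -> 0 <= r2 <= 1 -> `|r1 - s| < d -> `|r2 - s| < d ->
    `|u (c r1) - u (c r2)| <= C * ed (c r1) (c r2).
  move=> s01; have eL : ed x (c s) < L.
    have [s0|s0] := eqVneq s 0.
      rewrite s0 c0 ed_xx; apply: le_lt_trans lL.
      by apply: le_trans (h [:: 1] _ _) => //=; rewrite ?ltr01// addr0 ed_ge0.
    apply: le_lt_trans lL; rewrite -c0; have [s1|s1] := eqVneq s 1.
      by have := h [:: 1]; rewrite /= ltr01 addr0 s1; apply.
    apply: le_trans (h [:: s; 1] _ _) => //=; first by rewrite lerDl addr0 ed_ge0.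
    by rewrite !lt_neqAle eq_sym s0 s1 andbT.
  have [e e0 eu] := uL _ (cS s s01) eL.
  have [d d0 hd] := (within_contP c).1 cc s s01 e e0.
  by exists d => // r1 r2 r101 r201 r1s r2s; apply: eu; [exact: cS|exact: cS|exact: hd|exact: hd].
pose A : set R := [set s | 0 <= s <= 1 /\ exists t, [/\ path <%O 0 t, last 0 t = s &
  `|u (c 0) - u (c s)| <= C * polylen c 0 t]].
have extend (s s' : R) t : path <%O 0 t -> last 0 t = s -> s < s' ->
    `|u (c 0) - u (c s)| <= C * polylen c 0 t ->
    `|u (c s) - u (c s')| <= C * ed (c s) (c s') ->
    [/\ path <%O 0 (rcons t s'), last 0 (rcons t s') = s' &
      `|u (c 0) - u (c s')| <= C * polylen c 0 (rcons t s')].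
  move=> pt lt ss' h1 h2; split; rewrite ?last_rcons ?rcons_path ?pt ?lt//.
  rewrite -cats1 polylen_cat lt /= addr0 mulrDr.
  by rewrite (le_trans (ler_distD (u (c s)) _ _))// lerD.
have A0 : A 0 by split; [rewrite lexx ler01|exists [::]; rewrite /= mulr0 subrr normr0].
have hsA : has_sup A by split; [exists 0|exists 1 => s [/andP[]]].
pose s := sup A.
have s0 : 0 <= s by apply: ub_le_sup => //; case: hsA.
have s1 : s <= 1 by apply: ge_sup => [|r [/andP[]]//]; exists 0.
have s01 : 0 <= s <= 1 by rewrite s0 s1.
have [d d0 hd] := near s s01.
have [r [r01 [t [pt lt ut]]] rs] := sup_adherent d0 hsA.
have rles : r <= s by apply: ub_le_sup; [case: hsA|split=> //; exists t].
have rd : `|r - s| < d by rewrite ltr_norml; rewrite -/s in rs; lra.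
have reach (s' : R) : 0 <= s' <= 1 -> r < s' -> `|s' - s| < d -> A s'.
  move=> s'01 rs' s'd; split=> //; exists (rcons t s').
  by apply: (extend r) => //; exact: hd.
have s1' : s = 1.
  apply/eqP; rewrite eq_le s1 /= leNgt; apply/negP => sl1.
  pose s' := Num.min (s + d / 2) 1.
  have d2 : 0 < d / 2 by rewrite divr_gt0.
  have ss' : s < s' by rewrite lt_min sl1 ltrDl d2.
  have As' : A s'.
    apply: reach; first by rewrite (le_trans s0 (ltW ss')) ge_min lexx orbT.
      exact: le_lt_trans ss'.
    have : s' <= s + d / 2 by rewrite ge_min lexx.
    by rewrite ger0_norm ?subr_ge0 ?(ltW ss')//; lra.
  by have := ub_le_sup hsA.2 As'; rewrite leNgt ss'.
have [_ [t' [pt' lt' ut']]] : A 1.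
  have [r1|r1] := eqVneq r 1; first by move: lt ut; rewrite r1 => ? ?; split; [rewrite ler01 lexx|exists t].
  apply: reach; rewrite ?ler01 ?lexx//; first by rewrite lt_neqAle r1; lra.
  by rewrite s1' subrr normr0.
rewrite c0 c1 in ut'; apply: le_trans ut' _; rewrite ler_wpM2l//.
exact: le_trans (h _ pt' lt') (ltW lL).
Qed.

End PathDist.

(** * Slits in a box *)

(** An interval is not countable, as it is not a null set. *)
Lemma interval_avoid (R : realType) (f : nat -> R) (x y : R) : x < y ->
  exists2 t, x < t < y & forall j, f j <> t.
Proof.
move=> xy; apply: contrapT => none.
have sub : `]x, y[%classic `<=` range f.
  move=> t /=; rewrite in_itv /= => txy; apply: contrapT => nt; apply: none.
  by exists t => // j fj; apply: nt; exists j.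
have cf : countable (range f) by apply: sub_countable (card_image_le _ _) _; exact: countableP.
have := countable_lebesgue_measure0 (sub_countable (subset_card_le sub) cf).
rewrite lebesgue_measure_itv /= lte_fin xy -EFinB => /eqP.
by rewrite eqe subr_eq0 gt_eqF.
Qed.

Lemma finite_radius (R : realType) (P : nat -> R -> Prop) N :
  (forall j e e', e' <= e -> P j e -> P j e') ->
  (forall j, (j < N)%N -> exists2 e, 0 < e & P j e) ->
  exists2 e, 0 < e & forall j, (j < N)%N -> P j e.
Proof.
move=> anti; elim: N => [|N ih] h; first by exists 1.
have [e e0 eP] := ih (fun j jN => h j (ltnW jN)).
have [e' e'0 e'P] := h N (ltnSn N).
exists (Num.min e e') => [|j]; first by rewrite lt_min e0.
rewrite ltnS leq_eqVlt => /orP[/eqP ->|jN].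
  by apply: anti e'P; rewrite ge_min lexx orbT.
by apply: anti (eP j jN); rewrite ge_min lexx.
Qed.

Lemma between_bounds (R : realType) (p q t : R) : 0 <= t <= 1 ->
  Num.min p q <= p + t * (q - p) <= Num.max p q.
Proof.
move=> /andP[t0 t1]; have t1' : 0 <= 1 - t by rewrite subr_ge0.
have [pq|qp] := leP p q.
  have h1 : 0 <= t * (q - p) by rewrite mulr_ge0 ?subr_ge0.
  have h2 : 0 <= (1 - t) * (q - p) by rewrite mulr_ge0 ?subr_ge0.
  by rewrite mulrBl mul1r in h2; lra.
have h1 : t * (q - p) <= 0 by rewrite mulr_ge0_le0 ?subr_le0 ?(ltW qp).
have h2 : (1 - t) * (q - p) <= 0 by rewrite mulr_ge0_le0 ?subr_le0 ?(ltW qp).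
by rewrite mulrBl mul1r in h2; lra.
Qed.

(** The data of the theorem with the parameters of the slits made explicit. The
    dimension is [m.+2] and the slits are orthogonal to the axis of [ord0]. *)
Record slits (R : realType) (m : nat) := Slits {
  low : 'rV[R]_m.+2; high : 'rV[R]_m.+2;
  low_lt_high : forall i, low 0 i < high 0 i;
  sset : nat -> set 'rV[R]_m.+2;
  sx : nat -> R; sl : nat -> R; sc : nat -> 'rV[R]_m.+2;
  sl_gt0 : forall j, 0 < sl j;
  ssetE : forall j, sset j = [set y : 'rV[R]_m.+2 | forall i : 'I_m.+2,
    if i == ord0 then y 0 i = sx j else sc j 0 i <= y 0 i <= sc j 0 i + sl j];
  sset_in : forall j, sset j `<=` open_box low high;
  sep : R; sep_gt0 : 0 < sep;
  slits_sep : forall j k y z, j <> k -> sset j y -> sset k z ->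
    sep * Num.min (sl j) (sl k) <= euclid_dist y z }.

Section SlitGeometry.
Variables (R : realType) (m : nat) (Q : slits R m).
Local Notation V := 'rV[R]_m.+2.
Local Notation ed := (@euclid_dist R m.+2).
Local Notation I := (open_box (low Q) (high Q)).
Local Notation SN := (slit_domain I (sset Q)).
Implicit Types (x y z w : V) (N j : nat).

Definition upd (z : V) (i : 'I_m.+2) (v : R) : V := \row_k if k == i then v else z 0 k.

Lemma updE z i v k : upd z i v 0 k = if k == i then v else z 0 k.
Proof. by rewrite mxE. Qed.

Definition center j : V := \row_i if i == ord0 then sx Q j else sc Q j 0 i + sl Q j / 2.

Lemma center_in j : sset Q j (center j).
Proof.
rewrite ssetE => i; rewrite /= mxE; case: eqP => // _.
by have := sl_gt0 Q j; lra.
Qed.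

Lemma corner_bounds j i : if i == ord0 then is_true (low Q 0 i < sx Q j < high Q 0 i)
  else low Q 0 i < sc Q j 0 i /\ sc Q j 0 i + sl Q j < high Q 0 i.
Proof.
have l0 := sl_gt0 Q j; case: eqP => [->|/eqP i0].
  by have := sset_in (center_in j) ord0; rewrite mxE eqxx.
have up v : 0 <= v <= 1 -> low Q 0 i < sc Q j 0 i + v * sl Q j < high Q 0 i.
  move=> v01; have := @sset_in _ _ Q j (upd (center j) i (sc Q j 0 i + v * sl Q j)) _ i.
  rewrite updE eqxx; apply; rewrite ssetE => k; rewrite /= updE.
  have := center_in j; rewrite ssetE => /(_ k).
  by case: (k =P i) => [->|//]; rewrite (negbTE i0) => _; nra.
have u0 : low Q 0 i < sc Q j 0 i by have := up 0; rewrite mul0r addr0; lra.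
by have := up 1; rewrite mul1r; lra.
Qed.

Lemma slit_closed j z : ~ sset Q j z -> exists2 e, 0 < e &
  forall w, (forall i, `|w 0 i - z 0 i| < e) -> ~ sset Q j w.
Proof.
rewrite ssetE /= => nz.
have [i nzi] : exists i, ~ (if i == ord0 then z 0 i = sx Q j
    else sc Q j 0 i <= z 0 i <= sc Q j 0 i + sl Q j).
  by apply/existsNP.
move: nzi; case: (i =P ord0) => [i0 zi|/eqP i0 /negP].
  exists `|z 0 i - sx Q j|; first by rewrite normr_gt0 subr_eq0; exact/eqP.
  move=> w wz /(_ i); rewrite i0 eqxx -i0 => wi.
  by have := wz i; rewrite wi distrC ltxx.
rewrite negb_and -!ltNge => /orP[zi|zi].
  exists (sc Q j 0 i - z 0 i); first by rewrite subr_gt0.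
  move=> w wz /(_ i); rewrite (negbTE i0) => wi.
  by have := wz i; rewrite ltr_norml; lra.
exists (z 0 i - (sc Q j 0 i + sl Q j)); first by rewrite subr_gt0.
move=> w wz /(_ i); rewrite (negbTE i0) => wi.
by have := wz i; rewrite ltr_norml; lra.
Qed.

Lemma slits_closed N z : (forall j, (j < N)%N -> ~ sset Q j z) -> exists2 e, 0 < e &
  forall w, (forall i, `|w 0 i - z 0 i| < e) -> forall j, (j < N)%N -> ~ sset Q j w.
Proof.
move=> nz; have [e e0 h] := @finite_radius R (fun j e =>
  forall w, (forall i, `|w 0 i - z 0 i| < e) -> ~ sset Q j w) N
  (fun j e e' le h w wz => h w (fun i => lt_le_trans (wz i) le))
  (fun j jN => slit_closed (nz j jN)).
by exists e => // w wz j jN; exact: h jN w wz.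
Qed.

Lemma SNP N z : SN N z <-> I z /\ forall j, (j < N)%N -> ~ sset Q j z.
Proof.
split=> -[Iz nz]; split=> //; first by move=> j jN jz; apply: nz; exists j.
by case=> j /= jN jz; exact: nz jN jz.
Qed.

Lemma box_open z : I z -> exists2 e, 0 < e &
  forall w, (forall i, `|w 0 i - z 0 i| < e) -> I w.
Proof.
move=> Iz; have [e e0 h] : exists2 e, 0 < e & forall k, (k < m.+2)%N ->
    forall i : 'I_m.+2, i = k :> nat -> e <= z 0 i - low Q 0 i /\ e <= high Q 0 i - z 0 i.
  apply: finite_radius => [j e e' le h i ij|k km]; first by have [] := h i ij; lra.
  exists (Num.min (z 0 (Ordinal km) - low Q 0 (Ordinal km))
      (high Q 0 (Ordinal km) - z 0 (Ordinal km))).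
    by rewrite lt_min !subr_gt0; have := Iz (Ordinal km).
  move=> i ik; have -> : i = Ordinal km by exact/val_inj.
  by rewrite !ge_min !lexx orbT.
exists e => // w wz i; have [] := h i (ltn_ord i) i erefl.
by have := wz i; rewrite ltr_norml; lra.
Qed.

Lemma SN_open N z : SN N z -> exists2 e, 0 < e &
  forall w, (forall i, `|w 0 i - z 0 i| < e) -> SN N w.
Proof.
move=> /SNP[/box_open[e e0 h] /slits_closed[e' e'0 h']].
exists (Num.min e e') => [|w wz]; first by rewrite lt_min e0.
apply/SNP; split; [apply: h|apply: h'] => i;
  by apply: lt_le_trans (wz i) _; rewrite ge_min lexx ?orbT.
Qed.

Lemma box_convex x y (t : R) : I x -> I y -> 0 <= t <= 1 -> I (x + t *: (y - x)).
Proof.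
move=> Ix Iy t01 i; have /andP[+ +] := between_bounds (x 0 i) (y 0 i) t01.
rewrite !mxE ge_min le_max; have := Ix i; have := Iy i.
by move=> ? ? /orP[] ? /orP[] ?; apply/andP; split; lra.
Qed.

Definition vfree N (t : R) := forall j, (j < N)%N -> sx Q j <> t.

Lemma vfree_slit N z j : vfree N (z 0 ord0) -> (j < N)%N -> ~ sset Q j z.
Proof. by move=> vz jN; rewrite ssetE => /(_ ord0); rewrite eqxx => /esym; exact: vz. Qed.

Lemma vertical_dist N z w : I z -> I w -> z 0 ord0 = w 0 ord0 -> vfree N (z 0 ord0) ->
  (path_dist (SN N) z w <= (ed z w)%:E)%E.
Proof.
move=> Iz Iw zw vz; apply: path_dist_segment => t t01; apply/SNP; split.
  exact: box_convex.
move=> j jN; apply: vfree_slit jN.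
by rewrite !mxE -zw subrr mulr0 addr0.
Qed.

Lemma ball_dist N z e w w' : (forall w, (forall i, `|w 0 i - z 0 i| < e) -> SN N w) ->
  (forall i, `|w 0 i - z 0 i| < e) -> (forall i, `|w' 0 i - z 0 i| < e) ->
  (path_dist (SN N) w w' <= (ed w w')%:E)%E.
Proof.
move=> h wz w'z; apply: path_dist_segment => t t01; apply: h => i.
have /andP[+ +] := between_bounds (w 0 i) (w' 0 i) t01.
have := wz i; have := w'z i; rewrite !mxE !ltr_norml ge_min le_max.
by move=> ? ? /orP[] ? /orP[] ?; apply/andP; split; lra.
Qed.

Lemma ed_upd z i v : ed z (upd z i v) = `|z 0 i - v|.
Proof.
apply/eqP; rewrite -(eqrXn2 (n := 2)) ?ed_ge0// ed_sqr (bigD1 i)//= big1.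
  by rewrite updE eqxx addr0 real_normK ?num_real.
by move=> k ki; rewrite updE (negbTE ki) subrr expr0n.
Qed.

(** The finitely many slits removed meet finitely many vertical hyperplanes, so a
    small horizontal shift leaves them. *)
Lemma perturb N z e : SN N z -> 0 < e -> exists v, let z' := upd z ord0 v in
  [/\ SN N z', vfree N v, `|z 0 ord0 - v| < e & (path_dist (SN N) z z' <= e%:E)%E].
Proof.
move=> /[dup] Sz /SN_open[d d0 hd] e0.
have [|v v01 vf] := @interval_avoid R (sx Q) (z 0 ord0) (z 0 ord0 + Num.min d e).
  by rewrite ltrDl lt_min d0.
have vd : `|v - z 0 ord0| < Num.min d e by rewrite ger0_norm; lra.
have near i : `|upd z ord0 v 0 i - z 0 i| < d.
  rewrite updE; case: eqP => [->|_]; last by rewrite subrr normr0.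
  by apply: lt_le_trans vd _; rewrite ge_min lexx.
have ve : `|z 0 ord0 - v| < e.
  by rewrite distrC (lt_le_trans vd)// ge_min lexx orbT.
have zz i : `|z 0 i - z 0 i| < d by rewrite subrr normr0.
have zv : (path_dist (SN N) z (upd z ord0 v) <= e%:E)%E.
  by apply: le_trans (ball_dist hd zz near) _; rewrite lee_fin ed_upd ltW.
by exists v; split=> //; exact: hd.
Qed.

(** The first of the coordinates along which the slits extend. *)
Definition i1 : 'I_m.+2 := lift ord0 ord0.

Lemma i1_neq0 : (i1 == ord0) = false.
Proof. by []. Qed.

(** Two points are joined by a vertical segment, a segment in a hyperplane that
    no slit meets, and another vertical segment. *)
Lemma detour N z w h : I z -> I w -> vfree N (z 0 ord0) -> vfree N (w 0 ord0) ->
  (forall t : R, 0 <= t <= 1 ->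
     SN N (upd z i1 h + t *: (upd w i1 h - upd z i1 h))) ->
  (path_dist (SN N) z w <=
    (`|z 0 i1 - h| + `|w 0 i1 - h| + \sum_i `|z 0 i - w 0 i|)%:E)%E.
Proof.
move=> Iz Iw vz vw seg.
have /SNP[Iz' _] : SN N (upd z i1 h) by have := seg 0; rewrite scale0r addr0; apply; lra.
have /SNP[Iw' _] : SN N (upd w i1 h).
  by have := seg 1; rewrite scale1r addrC subrK; apply; lra.
rewrite addrAC !EFinD; apply: le_trans (path_dist_triangle _ _ (upd w i1 h) _) _.
apply: leeD.
  apply: le_trans (path_dist_triangle _ _ (upd z i1 h) _) _; apply: leeD.
    by rewrite -ed_upd; apply: vertical_dist => //; rewrite updE.
  apply: le_trans (path_dist_segment seg) _; rewrite lee_fin (le_trans (ed_le_sum _ _))//.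
  apply: ler_sum => i _; rewrite !updE; case: ifP => // _; by rewrite subrr normr0.
rewrite path_dist_sym -ed_upd; apply: vertical_dist => //; by rewrite updE.
Qed.

Definition boxsize : R := \sum_i (high Q 0 i - low Q 0 i).

Lemma box_coord z w i : I z -> I w -> `|z 0 i - w 0 i| <= high Q 0 i - low Q 0 i.
Proof. by move=> /(_ i) ? /(_ i) ?; rewrite ler_norml; lra. Qed.

Lemma side_le_boxsize i : high Q 0 i - low Q 0 i <= boxsize.
Proof.
rewrite /boxsize (bigD1 i)//= lerDl sumr_ge0// => k _.
by rewrite subr_ge0 ltW// low_lt_high.
Qed.

Lemma boxsize_gt0 : 0 < boxsize.
Proof. by apply: lt_le_trans (side_le_boxsize ord0); rewrite subr_gt0 low_lt_high. Qed.

(** The stages have uniformly bounded path metrics: near the top face there is a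
    hyperplane that misses the finitely many slits removed. *)
Lemma path_dist_bounded N z w : SN N z -> SN N w ->
  (path_dist (SN N) z w <= (5 * boxsize)%:E)%E.
Proof.
move=> Sz Sw; have [v [Sz' vz _ dz]] := perturb Sz boxsize_gt0.
have [v' [Sw' vw _ dw]] := perturb Sw boxsize_gt0.
have top j : sc Q j 0 i1 + sl Q j < high Q 0 i1 by have := corner_bounds j i1 => /= -[]; lra.
have [e e0 he] : exists2 e, 0 < e &
    forall j, (j < N)%N -> sc Q j 0 i1 + sl Q j < high Q 0 i1 - e.
  apply: finite_radius => [j e e' le h|j _]; first by lra.
  by exists ((high Q 0 i1 - (sc Q j 0 i1 + sl Q j)) / 2); have := top j; lra.
pose h := Num.max (high Q 0 i1 - e) ((low Q 0 i1 + high Q 0 i1) / 2).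
have lh := low_lt_high Q i1.
have h1 : low Q 0 i1 < h < high Q 0 i1.
  by rewrite lt_max gt_max; apply/andP; split; [apply/orP; right|apply/andP; split]; lra.
have h2 : high Q 0 i1 - e <= h by rewrite le_max lexx.
have /SNP[Iz' _] := Sz'; have /SNP[Iw' _] := Sw'.
have Ih z' : I z' -> I (upd z' i1 h).
  by move=> Iz i; rewrite updE; case: eqP => [->|_].
have dzw : (path_dist (SN N) (upd z ord0 v) (upd w ord0 v') <= (3 * boxsize)%:E)%E.
  apply: le_trans (detour Iz' Iw' _ _ _ (h := h)) _.
  - by rewrite updE.
  - by rewrite updE.
  - move=> t t01; apply/SNP; split; first by apply: box_convex => //; exact: Ih.
    move=> j jN; rewrite ssetE => /(_ i1); rewrite i1_neq0 !mxE eqxx subrr mulr0 addr0.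
    by have := he j jN; lra.
  - have hz u : I u -> `|u 0 i1 - h| <= boxsize.
      move=> /(_ i1) Iu; apply: le_trans (side_le_boxsize i1); rewrite ler_norml; lra.
    have : \sum_i `|upd z ord0 v 0 i - upd w ord0 v' 0 i| <= boxsize.
      by apply: ler_sum => i _; exact: box_coord.
    rewrite lee_fin; have := hz _ Iz'; have := hz _ Iw'; lra.
rewrite (_ : 5 * boxsize = boxsize + 3 * boxsize + boxsize); last by ring.
rewrite !EFinD; apply: le_trans (path_dist_triangle _ _ (upd w ord0 v') _) _.
apply: leeD; last by rewrite path_dist_sym.
by apply: le_trans (path_dist_triangle _ _ (upd z ord0 v) _) _; exact: leeD.
Qed.

End SlitGeometry.

Section StageDist.
Variables (R : realType) (m : nat) (Q : slits R m).
Local Notation V := 'rV[R]_m.+2.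
Local Notation ed := (@euclid_dist R m.+2).
Local Notation I := (open_box (low Q) (high Q)).
Local Notation SN := (slit_domain I (sset Q)).
Local Notation i1 := (i1 m).
Implicit Types (x y z w : V) (N j : nat) (e r : R).

(** A neighbourhood in the sup norm. *)
Definition nears j e z := forall i, if i == ord0 then `|z 0 i - sx Q j| < e : Prop
  else sc Q j 0 i - e < z 0 i < sc Q j 0 i + sl Q j + e.

Lemma near_nears j e z z' : sset Q j z' -> (forall i, `|z 0 i - z' 0 i| < e) -> nears j e z.
Proof.
rewrite ssetE => jz' zz' i; have := jz' i; have := zz' i.
by case: eqP => [->|_]; rewrite ?ltr_norml; [move=> ? <- |lra].
Qed.

Lemma nears_near j e z : 0 < e -> nears j e z ->
  exists2 z', sset Q j z' & forall i, `|z 0 i - z' 0 i| < e.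
Proof.
move=> e0 nz.
exists (\row_i if i == ord0 then sx Q j else
  Num.max (sc Q j 0 i) (Num.min (z 0 i) (sc Q j 0 i + sl Q j))).
  rewrite ssetE => i; rewrite /= mxE; case: eqP => // _.
  by have := sl_gt0 Q j; rewrite le_max lexx ge_max ge_min lexx orbT andbT; lra.
move=> i; rewrite mxE; have := nz i; case: eqP => [//|_].
have := sl_gt0 Q j; rewrite ltr_norml /Num.max /Num.min.
by do ?case: ifPn; rewrite -?leNgt => *; apply/andP; split; lra.
Qed.

Lemma nears_isolated N j : exists2 e, 0 < e & forall z, nears j e z ->
  I z /\ forall k, (k < N)%N -> k <> j -> ~ sset Q k z.
Proof.
have [e1 e10 h1] : exists2 e, 0 < e & forall k, (k < m.+2)%N ->
    forall i : 'I_m.+2, i = k :> nat -> if i == ord0 then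
      low Q 0 i + e <= sx Q j /\ sx Q j + e <= high Q 0 i
    else low Q 0 i + e <= sc Q j 0 i /\ sc Q j 0 i + sl Q j + e <= high Q 0 i.
  apply: finite_radius => [k e e' le h i ik|k km].
    by have := h i ik; case: ifP => _ []; lra.
  have := corner_bounds Q j (Ordinal km); case: ifP => [km0 h|km0 [h h']].
    exists (Num.min (sx Q j - low Q 0 (Ordinal km)) (high Q 0 (Ordinal km) - sx Q j)).
      by rewrite lt_min !subr_gt0.
    move=> i ik; have -> : i = Ordinal km by exact/val_inj.
    by rewrite km0 -!lerBrDl !ge_min !lexx orbT.
  exists (Num.min (sc Q j 0 (Ordinal km) - low Q 0 (Ordinal km))
    (high Q 0 (Ordinal km) - (sc Q j 0 (Ordinal km) + sl Q j))).
    by rewrite lt_min !subr_gt0 h.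
  move=> i ik; have -> : i = Ordinal km by exact/val_inj.
  by rewrite km0 -!lerBrDl !ge_min !lexx orbT.
have [e2 e20 h2] : exists2 e, 0 < e & forall k, (k < N)%N ->
    e * m.+2%:R <= sep Q * Num.min (sl Q j) (sl Q k).
  apply: finite_radius => [k e e' le|k kN].
    by apply: le_trans; rewrite ler_wpM2r.
  exists (sep Q * Num.min (sl Q j) (sl Q k) / m.+2%:R); last by rewrite divfK.
  by rewrite divr_gt0// mulr_gt0 ?sep_gt0// lt_min !sl_gt0.
exists (Num.min e1 e2) => [|z nz]; first by rewrite lt_min e10.
have e0 : 0 < Num.min e1 e2 by rewrite lt_min e10.
have m1 : Num.min e1 e2 <= e1 by rewrite ge_min lexx.
have m2 : Num.min e1 e2 <= e2 by rewrite ge_min lexx orbT.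
split=> [i|k kN kj kz].
  have := h1 i (ltn_ord i) i erefl; have := nz i.
  by case: ifP => _; rewrite ?ltr_norml => + []; lra.
have [z' jz' zz'] := nears_near e0 nz.
have := slits_sep (fun jk => kj (esym jk)) jz' kz.
apply/negP; rewrite -ltNge ed_sym; apply: lt_le_trans (h2 k kN).
apply: le_lt_trans (ed_le_sum _ _) _.
apply: lt_le_trans (_ : \sum_(i < m.+2) Num.min e1 e2 <= _).
  by apply: ltr_sum => //; apply/hasP; exists ord0; rewrite ?mem_index_enum.
by rewrite sumr_const card_ord -[X in X <= _]mulr_natr ler_wpM2r.
Qed.

(** Slits do not accumulate at each other at a given stage, so a curve may run
    along the slit up to an edge, around it, and back on the other side. *)
Lemma around_slit N j r : 0 < r -> exists2 e, 0 < e & forall z w, SN N z -> SN N w ->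
  nears j e z -> nears j e w -> (path_dist (SN N) z w <= (m.+3%:R * sl Q j + r)%:E)%E.
Proof.
move=> r0; have [t t0 iso] := nears_isolated N j.
pose e := Num.min (t / 2) (r / (2 * m%:R + 12)).
have d0 : 0 < 2 * m%:R + 12 :> R by rewrite ltr_wpDl.
have e0 : 0 < e by rewrite lt_min !divr_gt0.
have et : 2 * e <= t by rewrite mulrC -ler_pdivlMr// ge_min lexx.
have er : e * (2 * m%:R + 12) <= r by rewrite -ler_pdivlMr// ge_min lexx orbT.
exists e => // z w Sz Sw nz nw.
have [v [Sz' vz zv dz]] := perturb Sz e0; have [v' [Sw' vw wv dw]] := perturb Sw e0.
pose h := sc Q j 0 i1 + sl Q j + e; have l0 := sl_gt0 Q j.
have dzw : (path_dist (SN N) (upd z ord0 v) (upd w ord0 v') <=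
    (m.+3%:R * sl Q j + (r - 2 * e))%:E)%E.
  have /SNP[Iz' _] := Sz'; have /SNP[Iw' _] := Sw'.
  apply: le_trans (detour Iz' Iw' _ _ _ (h := h)) _.
  - by rewrite updE.
  - by rewrite updE.
  - move=> a a01; set y := (X in SN N X).
    have ny : nears j t y.
      move=> i; rewrite /y !mxE; case: (i =P ord0) => [->|/eqP i0] /=.
        have /andP[] := between_bounds v v' a01.
        have := nz ord0; have := nw ord0; rewrite /= ge_min le_max.
        move: zv wv; rewrite !ltr_norml => ? ? ? ? /orP[] ? /orP[] ?; lra.
      case: eqP => [->|_]; first by rewrite subrr mulr0 addr0 /h; lra.
      have /andP[] := between_bounds (z 0 i) (w 0 i) a01.
      have := nz i; have := nw i; rewrite (negbTE i0) ge_min le_max.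
      by move=> ? ? /orP[] ? /orP[] ?; lra.
    have [Iy niso] := iso y ny; apply/SNP; split=> // k kN.
    have [->|/eqP kj] := eqVneq k j; last exact: niso.
    rewrite ssetE => /(_ i1) /=; rewrite /y !mxE /= subrr mulr0 addr0 /h; lra.
  rewrite lee_fin.
  have b1 u : nears j e u -> `|u 0 i1 - h| <= sl Q j + 2 * e.
    by move=> /(_ i1) /= nu; rewrite ler_norml /h; lra.
  have bz : `|upd z ord0 v 0 i1 - h| <= sl Q j + 2 * e by rewrite updE; exact: b1.
  have bw : `|upd w ord0 v' 0 i1 - h| <= sl Q j + 2 * e by rewrite updE; exact: b1.
  have bs : \sum_i `|upd z ord0 v 0 i - upd w ord0 v' 0 i| <=
      4 * e + m.+1%:R * (sl Q j + 2 * e).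
    rewrite big_ord_recl; apply: lerD.
      rewrite !updE /=; have := nz ord0; have := nw ord0 => /=.
      by move: zv wv; rewrite ler_norml !ltr_norml; lra.
    apply: (@le_trans _ _ (\sum_(i < m.+1) (sl Q j + 2 * e))).
      apply: ler_sum => i _; rewrite !updE /=; have := nz (lift ord0 i); have := nw (lift ord0 i).
      by rewrite /= ler_norml; lra.
    by rewrite sumr_const card_ord -[X in X <= _]mulr_natl.
  move: bs er; rewrite -[m.+3%:R]natr1 -[m.+2%:R]natr1 -[m.+1%:R]natr1; nra.
rewrite (_ : _ + r = e + (m.+3%:R * sl Q j + (r - 2 * e)) + e); last by ring.
rewrite !(EFinD _ e) EFinD; apply: le_trans (path_dist_triangle _ _ (upd w ord0 v') _) _.
apply: leeD; last by rewrite path_dist_sym.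
by apply: le_trans (path_dist_triangle _ _ (upd z ord0 v) _) _; exact: leeD.
Qed.

(** A point of the closed box off the removed slits has a neighbourhood whose part
    in the box is convex in the stage. *)
Lemma local_convex N z : (forall j, (j < N)%N -> ~ sset Q j z) -> exists2 e, 0 < e &
  (forall w, I w -> (forall i, `|w 0 i - z 0 i| < e) -> SN N w) /\
  forall w w', I w -> I w' -> (forall i, `|w 0 i - z 0 i| < e) ->
    (forall i, `|w' 0 i - z 0 i| < e) -> (path_dist (SN N) w w' <= (ed w w')%:E)%E.
Proof.
move=> /slits_closed[e e0 h]; exists e => //.
have SNe w : I w -> (forall i, `|w 0 i - z 0 i| < e) -> SN N w.
  by move=> Iw wz; apply/SNP; split=> //; exact: h.
split=> // w w' Iw Iw' wz w'z; apply: path_dist_segment => t t01.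
apply: SNe => [|i]; first exact: box_convex.
have /andP[+ +] := between_bounds (w 0 i) (w' 0 i) t01.
have := wz i; have := w'z i; rewrite !mxE !ltr_norml ge_min le_max.
by move=> ? ? /orP[] ? /orP[] ?; apply/andP; split; lra.
Qed.

Fact pd_seal : {f : nat -> V -> V -> R | f = fun N z w => fine (path_dist (SN N) z w)}.
Proof. by exists (fun N z w => fine (path_dist (SN N) z w)). Qed.

Definition pd N z w : R := sval pd_seal N z w.

Lemma pd_def N z w : pd N z w = fine (path_dist (SN N) z w).
Proof. by rewrite /pd (svalP pd_seal). Qed.

Lemma pdE N z w : SN N z -> SN N w -> path_dist (SN N) z w = (pd N z w)%:E.
Proof.
move=> Sz Sw; rewrite pd_def fineK// ge0_fin_numE ?path_dist_ge0//.
by apply: le_lt_trans (path_dist_bounded Sz Sw) _; rewrite ltry.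
Qed.

Lemma pd_ge0 N z w : 0 <= pd N z w.
Proof. by rewrite pd_def; exact/fine_ge0/path_dist_ge0. Qed.

Lemma pd_sym N z w : pd N z w = pd N w z.
Proof. by rewrite !pd_def path_dist_sym. Qed.

Lemma pd_triangle N y z w : SN N z -> SN N y -> SN N w ->
  pd N z w <= pd N z y + pd N y w.
Proof.
by move=> Sz Sy Sw; rewrite -lee_fin EFinD -!pdE//; exact: path_dist_triangle.
Qed.

Lemma pd_ge_ed N z w : SN N z -> SN N w -> ed z w <= pd N z w.
Proof. by move=> Sz Sw; rewrite -lee_fin -pdE//; exact: path_dist_ge. Qed.

Lemma pd_le N z w r : SN N z -> SN N w ->
  (path_dist (SN N) z w <= r%:E)%E -> pd N z w <= r.
Proof. by move=> Sz Sw; rewrite pdE. Qed.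

Lemma pd_ltE N z w r : SN N z -> SN N w ->
  pd N z w < r -> (path_dist (SN N) z w < r%:E)%E.
Proof. by move=> Sz Sw; rewrite pdE. Qed.

Lemma pd_bounded N z w : SN N z -> SN N w -> pd N z w <= 5 * boxsize Q.
Proof. by move=> Sz Sw; apply: pd_le => //; exact: path_dist_bounded. Qed.

Lemma pd_xx N z : SN N z -> pd N z z = 0.
Proof.
move=> Sz; apply/eqP; rewrite eq_le pd_ge0 andbT; apply: pd_le => //.
rewrite -(ed_xx z); apply: path_dist_segment => t _.
by rewrite subrr scaler0 addr0.
Qed.

Lemma pd_mono i j z w : (i <= j)%N -> SN j z -> SN j w -> pd i z w <= pd j z w.
Proof.
move=> ij Sz Sw; have sub := slit_domain_sub (I := I) (s := sset Q) ij.
apply: pd_le; [exact: sub|exact: sub|rewrite -pdE//].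
exact: path_dist_le.
Qed.

End StageDist.

(** * The slit space as a metric space *)

Definition evt (P : nat -> Prop) := exists K, forall k, (K <= k)%N -> P k.

Lemma evt_and P P' : evt P -> evt P' -> evt (fun k => P k /\ P' k).
Proof.
move=> [K h] [K' h']; exists (maxn K K') => k; rewrite geq_max => /andP[kK kK'].
by split; [exact: h|exact: h'].
Qed.

Lemma evt_mono (P P' : nat -> Prop) : (forall k, P k -> P' k) -> evt P -> evt P'.
Proof. by move=> PP' [K h]; exists K => k /h /PP'. Qed.

Lemma evt_ex P : evt P -> exists k, P k.
Proof. by move=> [K h]; exists K; exact: h. Qed.

Lemma cvg_evt (R : realType) (f : nat -> R) (l : R) : f @ \oo --> l <->
  forall e, 0 < e -> evt (fun k => `|f k - l| < e).
Proof.
split=> [fl e e0|h].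
  have /cvgrPdist_lt/(_ e e0)[K _ hK] := fl.
  by exists K => k kK; rewrite distrC; exact: hK.
apply/cvgrPdist_lt => e e0; have [K hK] := h e e0.
by exists K => // k kK; rewrite distrC; exact: hK.
Qed.

Lemma cvg0_evt (R : realType) (f : nat -> R) : (forall k, 0 <= f k) ->
  ((fun k => (f k)%:E) @ \oo --> 0%E) <-> forall e, 0 < e -> evt (fun k => f k < e).
Proof.
move=> f0; have -> : ((fun k => (f k)%:E) @ \oo --> 0%E) <-> (f @ \oo --> (0 : R)).
  split=> h; first by have [_] := (fine_cvgP _ _).1 h.
  by apply/fine_cvgP; split; [exact: nearW|].
rewrite cvg_evt; split=> h e /h; apply: evt_mono => k; by rewrite subr0 ger0_norm.
Qed.

Lemma vanishing_seq (R : realType) : exists2 f : nat -> R, forall k, 0 < f k &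
  forall e, 0 < e -> evt (fun k => f k < e).
Proof.
exists (fun k => k.+1%:R^-1) => [k|e e0]; first by rewrite invr_gt0.
have [K hK] := ltr_add_invr (y := 0) (x := e) e0; rewrite add0r in hK.
exists K => k kK; apply: le_lt_trans hK.
by rewrite lef_pV2 ?posrE// ler_nat ltnS.
Qed.

Lemma cauchy_converges (R : realType) (f : nat -> R) :
  (forall e, 0 < e -> exists K, forall k l, (K <= k)%N -> (K <= l)%N -> `|f k - f l| < e) ->
  exists l, forall e, 0 < e -> evt (fun k => `|f k - l| < e).
Proof.
move=> h; suff /cauchy_cvgP/cvg_ex[l fl] : cauchy (f @ \oo) by exists l; exact/cvg_evt.
apply: cauchy_exP => e e0; have [K hK] := h e e0; exists (f K); exists K => // k kK.
exact: hK.
Qed.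

Section SlitSpaceMetric.
Variables (R : realType) (m : nat) (Q : slits R m).
Local Notation V := 'rV[R]_m.+2.
Local Notation ed := (@euclid_dist R m.+2).
Local Notation I := (open_box (low Q) (high Q)).
Local Notation SN := (slit_domain I (sset Q)).
Local Notation pd := (pd Q).
Local Notation X := (slit_space I (sset Q)).
Implicit Types (x y z w : V) (N j : nat) (e r : R) (p q : X).

Fact d_seal : {f : X -> X -> R | f = @slit_dist R m.+2 I (sset Q)}.
Proof. by exists (@slit_dist R m.+2 I (sset Q)). Qed.

Definition d p q : R := sval d_seal p q.

Lemma d_def p q : d p q = slit_dist p q.
Proof. by rewrite /d (svalP d_seal). Qed.

Fact tau_seal : {f : X -> V | f = @tau0 R m.+2 I (sset Q)}.
Proof. by exists (@tau0 R m.+2 I (sset Q)). Qed.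

Definition tau p : V := sval tau_seal p.

Lemma tau_def p : tau p = tau0 p.
Proof. by rewrite /tau (svalP tau_seal). Qed.

Definition rp p N : nat -> V := cauchy_repr (sval p N).

Lemma rp_in p N k : SN N (rp p N k).
Proof. exact: (cauchy_reprP (sval p N)).1. Qed.

Lemma SN_cauchyP N (u : nat -> V) : (forall k, SN N (u k)) ->
  cauchy_in (SN N) (path_dist (SN N)) u <-> forall e, 0 < e ->
    exists K, forall k l, (K <= k)%N -> (K <= l)%N -> pd N (u k) (u l) < e.
Proof.
move=> uS; split=> [[_ h] e /h[K hK]|h]; first by exists K => k l kK lK; rewrite -lte_fin -pdE// hK.
by split=> // e /h[K hK]; exists K => k l kK lK; rewrite pdE// lte_fin hK.
Qed.

Lemma rp_cauchy p N e : 0 < e ->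
  exists K, forall k l, (K <= k)%N -> (K <= l)%N -> pd N (rp p N k) (rp p N l) < e.
Proof. exact: (SN_cauchyP (rp_in p N)).1 (cauchy_reprP _) e. Qed.

Lemma class_refl N (u : nat -> V) : cauchy_in (SN N) (path_dist (SN N)) u ->
  cauchy_class (SN N) (path_dist (SN N)) u u.
Proof.
move=> cu; split=> //; have uS := cu.1.
rewrite (_ : (fun k => _) = fun=> 0%E); first exact: cvg_cst.
by apply/funext => k; rewrite pdE// pd_xx.
Qed.

Lemma class_close N (u v : nat -> V) :
  cauchy_in (SN N) (path_dist (SN N)) u -> cauchy_class (SN N) (path_dist (SN N)) u v <->
  cauchy_in (SN N) (path_dist (SN N)) v /\ forall e, 0 < e -> evt (fun k => pd N (u k) (v k) < e).
Proof.
move=> [uS cu]; split=> -[[vS cv] uv]; split=> //.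
  apply/cvg0_evt => [k|]; first exact: pd_ge0.
  by rewrite (_ : (fun k => _) = fun k => path_dist (SN N) (u k) (v k))//; apply/funext => k; rewrite pdE.
rewrite (_ : (fun k => _) = fun k => (pd N (u k) (v k))%:E); last first.
  by apply/funext => k; rewrite pdE.
by apply/cvg0_evt => // k; exact: pd_ge0.
Qed.

Lemma class_eq N (u v : nat -> V) : cauchy_in (SN N) (path_dist (SN N)) u ->
  cauchy_in (SN N) (path_dist (SN N)) v ->
  (forall e, 0 < e -> evt (fun k => pd N (u k) (v k) < e)) ->
  cauchy_class (SN N) (path_dist (SN N)) u = cauchy_class (SN N) (path_dist (SN N)) v.
Proof.
move=> cu cv uv; have uS := cu.1; have vS := cv.1.
apply/seteqP; split=> w /class_close => [/(_ cu)|/(_ cv)] [cw hw]; have wS := cw.1.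
  apply/class_close => //; split=> // e e0; have e2 : 0 < e / 2 by rewrite divr_gt0.
  apply: evt_mono (evt_and (uv _ e2) (hw _ e2)) => k [h1 h2].
  have := pd_triangle (vS k) (uS k) (wS k); rewrite (pd_sym _ _ (v k) (u k)); lra.
apply/class_close => //; split=> // e e0; have e2 : 0 < e / 2 by rewrite divr_gt0.
apply: evt_mono (evt_and (uv _ e2) (hw _ e2)) => k [h1 h2].
have := pd_triangle (uS k) (vS k) (wS k); lra.
Qed.

Lemma sval_class p N :
  sval (sval p N) = cauchy_class (SN N) (path_dist (SN N)) (rp p N).
Proof. by rewrite /rp /cauchy_repr; case: cid2 => u cu uE. Qed.

Lemma in_completion_close N (u : nat -> V) (cu : cauchy_in (SN N) (path_dist (SN N)) u) e :
  0 < e -> evt (fun k => pd N (u k) (cauchy_repr (in_completion cu) k) < e).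
Proof.
have : cauchy_class (SN N) (path_dist (SN N)) u (cauchy_repr (in_completion cu)).
  have cr := cauchy_reprP (in_completion cu).
  have <- : cauchy_class (SN N) (path_dist (SN N)) (cauchy_repr (in_completion cu)) =
      cauchy_class (SN N) (path_dist (SN N)) u.
    by rewrite {1}/cauchy_repr; case: cid2 => v cv vE; exact/esym/vE.
  exact: class_refl.
by move=> /(class_close _ cu)[_]; apply.
Qed.

Lemma rp_coherent p i j e : (i <= j)%N -> 0 < e ->
  evt (fun k => pd i (rp p i k) (rp p j k) < e).
Proof.
move=> ij e0; have := svalP p i j ij; rewrite /stage_map /completion_map.
set cu := cauchy_in_le _ _ _ => pE.
have := class_refl cu; rewrite -/(rp p j).
have -> : cauchy_class (SN i) (path_dist (SN i)) (rp p j) = sval (sval p i).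
  by rewrite -pE.
rewrite sval_class => /(class_close _ (cauchy_reprP _)) [_ h].
exact: h.
Qed.

(** Compatibility of the sequences is only asked up to null sequences, since a
    point of a stage is a class of Cauchy sequences. *)
Lemma mkX (v : nat -> nat -> V) : (forall N k, SN N (v N k)) ->
  (forall N e, 0 < e ->
    exists K, forall k l, (K <= k)%N -> (K <= l)%N -> pd N (v N k) (v N l) < e) ->
  (forall i j e, (i <= j)%N -> 0 < e -> evt (fun k => pd i (v i k) (v j k) < e)) ->
  exists p, forall N e, 0 < e -> evt (fun k => pd N (rp p N k) (v N k) < e).
Proof.
move=> vS vC coh.
have cv N : cauchy_in (SN N) (path_dist (SN N)) (v N).
  by apply/(SN_cauchyP (vS N)) => e; exact: vC.
have compat i j (ij : (i <= j)%N) :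
    stage_map ij (in_completion (cv j)) = in_completion (cv i).
  apply/eq_exist; apply: class_eq => [|//|e e0].
    by apply: cauchy_in_le (cauchy_reprP _); [exact: slit_domain_sub|exact/path_dist_le/slit_domain_sub].
  have e2 : 0 < e / 2 by rewrite divr_gt0.
  apply: evt_mono (evt_and (coh i j _ ij e2) (in_completion_close (cv j) e2)) => k [h1 h2].
  have sub := slit_domain_sub (I := I) (s := sset Q) ij.
  have S1 : SN j (cauchy_repr (in_completion (cv j)) k) := (cauchy_reprP _).1 k.
  have := pd_triangle (sub _ S1) (sub _ (vS j k)) (vS i k).
  have := pd_mono ij S1 (vS j k); rewrite (pd_sym _ j _ (v j k)) (pd_sym _ i (v j k)); lra.
exists (exist _ (fun N => in_completion (cv N)) compat) => N e e0.
apply: evt_mono (in_completion_close (cv N) e0) => k; by rewrite pd_sym.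
Qed.

Fact sdist_seal : {f : nat -> X -> X -> R |
  f = fun N p q => fine (completion_dist (sval p N) (sval q N))}.
Proof. by exists (fun N p q => fine (completion_dist (sval p N) (sval q N))). Qed.

Definition sdist N p q : R := sval sdist_seal N p q.

Lemma sdist_def N p q : sdist N p q = fine (completion_dist (sval p N) (sval q N)).
Proof. by rewrite /sdist (svalP sdist_seal). Qed.

Lemma sdist_cvg p q N : exists l, completion_dist (sval p N) (sval q N) = l%:E /\
  forall e, 0 < e -> evt (fun k => `|pd N (rp p N k) (rp q N k) - l| < e).
Proof.
have [e e0|l hl] := @cauchy_converges R (fun k => pd N (rp p N k) (rp q N k)).
  have e2 : 0 < e / 2 by rewrite divr_gt0.
  have [K hK] := rp_cauchy p N e2; have [K' hK'] := rp_cauchy q N e2.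
  exists (maxn K K') => k l; rewrite !geq_max => /andP[kK kK'] /andP[lK lK'].
  have h1 := hK k l kK lK; have h2 := hK' k l kK' lK'.
  have t1 := pd_triangle (rp_in p N k) (rp_in p N l) (rp_in q N k).
  have t2 := pd_triangle (rp_in p N l) (rp_in q N l) (rp_in q N k).
  have t3 := pd_triangle (rp_in p N l) (rp_in p N k) (rp_in q N l).
  have t4 := pd_triangle (rp_in p N k) (rp_in q N k) (rp_in q N l).
  rewrite (pd_sym _ N (rp q N l)) in t2; rewrite (pd_sym _ N (rp p N l) (rp p N k)) in t3.
  by rewrite ltr_norml; lra.
exists l; split=> //; rewrite /completion_dist.
have <- : limn (fun k => (pd N (rp p N k) (rp q N k))%:E) = l%:E.
  by apply: cvg_lim => //; apply/fine_cvgP; split; [exact: nearW|exact/cvg_evt].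
congr (lim (_ @ \oo)); apply/funext => k; rewrite -pdE//; exact: rp_in.
Qed.

Lemma sdistE p q N : completion_dist (sval p N) (sval q N) = (sdist N p q)%:E.
Proof. by have [l [e _]] := sdist_cvg p q N; rewrite sdist_def e. Qed.

Lemma sdistP p q N e : 0 < e ->
  evt (fun k => `|pd N (rp p N k) (rp q N k) - sdist N p q| < e).
Proof. by have [l [h hl]] := sdist_cvg p q N; rewrite sdist_def h; exact: hl. Qed.

Lemma sdist_mono p q i j : (i <= j)%N -> sdist i p q <= sdist j p q.
Proof.
move=> ij; apply/ler_addgt0Pr => e e0; have e4 : 0 < e / 4 by rewrite divr_gt0.
have [k [[[h1 h2] h3] h4]] := evt_ex (evt_and (evt_and (evt_and (sdistP p q i e4)
  (sdistP p q j e4)) (rp_coherent p ij e4)) (rp_coherent q ij e4)).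
have sub := slit_domain_sub (I := I) (s := sset Q) ij.
have pj := rp_in p j k; have qj := rp_in q j k.
have t1 := pd_triangle (rp_in p i k) (sub _ pj) (rp_in q i k).
have t2 := pd_triangle (sub _ pj) (sub _ qj) (rp_in q i k).
have t3 := pd_mono ij pj qj.
rewrite (pd_sym _ i (rp q j k)) in t2; move: h1 h2; rewrite !ltr_norml; lra.
Qed.

Lemma sdist_bounded p q N : sdist N p q <= 5 * boxsize Q.
Proof.
apply/ler_addgt0Pr => e e0; have [k] := evt_ex (sdistP p q N e0).
by have := pd_bounded (rp_in p N k) (rp_in q N k); rewrite ltr_norml; lra.
Qed.

Lemma slit_distE p q : d p q = limn (fun N => sdist N p q) /\
  cvgn (fun N => sdist N p q).
Proof.
have c : cvgn (fun N => sdist N p q).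
  apply: nondecreasing_is_cvgn => [i j|]; first exact: sdist_mono.
  by exists (5 * boxsize Q) => _ [N _ <-]; exact: sdist_bounded.
split=> //; rewrite d_def /slit_dist -[RHS]/(fine (limn (fun N => sdist N p q))%:E) -EFin_lim//.
by congr (fine (lim (_ @ \oo))); apply/funext => N; rewrite sdistE.
Qed.

Lemma sdist_le p q N : sdist N p q <= d p q.
Proof.
have [-> c] := slit_distE p q; apply: (@nondecreasing_cvgn_le _ (fun N => sdist N p q)) => //.
by move=> i j; exact: sdist_mono.
Qed.

Lemma d_le_sdist p q r : (forall N, sdist N p q <= r) -> d p q <= r.
Proof.
by move=> h; have [-> c] := slit_distE p q; apply: limr_le => //; apply: nearW.
Qed.

(** [z] lies within [e] of the image of [p] in the [N]-th stage. All estimates on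
    the slit space go through such approximations. *)
Definition apx p N e z := SN N z /\ evt (fun k => pd N (rp p N k) z < e).

Lemma apx_ex p N e : 0 < e -> exists z, apx p N e z.
Proof.
move=> /(rp_cauchy p N)[K hK]; exists (rp p N K); split; first exact: rp_in.
by exists K => k kK; exact: hK.
Qed.

Lemma apx_sdist_ge p q N e e' z w : apx p N e z -> apx q N e' w ->
  pd N z w <= sdist N p q + e + e'.
Proof.
move=> [Sz hz] [Sw hw]; apply/ler_addgt0Pr => r r0.
have [k [[h1 h2] h3]] := evt_ex (evt_and (evt_and hz hw) (sdistP p q N r0)).
have t1 := pd_triangle Sz (rp_in p N k) Sw.
have t2 := pd_triangle (rp_in p N k) (rp_in q N k) Sw.
rewrite (pd_sym _ N z (rp p N k)) in t1; rewrite ltr_norml in h3; lra.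
Qed.

Lemma apx_sdist_le p q N e e' z w : apx p N e z -> apx q N e' w ->
  sdist N p q <= pd N z w + e + e'.
Proof.
move=> [Sz hz] [Sw hw]; apply/ler_addgt0Pr => r r0.
have [k [[h1 h2] h3]] := evt_ex (evt_and (evt_and hz hw) (sdistP p q N r0)).
have t1 := pd_triangle (rp_in p N k) Sz (rp_in q N k).
have t2 := pd_triangle Sz Sw (rp_in q N k).
rewrite (pd_sym _ N w) in t2; rewrite ltr_norml in h3; lra.
Qed.

Lemma apx_ge p q N e e' z w : apx p N e z -> apx q N e' w ->
  pd N z w <= d p q + e + e'.
Proof. by move=> pz qw; have := apx_sdist_ge pz qw; have := sdist_le p q N; lra. Qed.

Lemma d_le p q r : (forall N e, 0 < e -> exists z w,
  [/\ apx p N e z, apx q N e w & pd N z w <= r + e]) -> d p q <= r.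
Proof.
move=> h; apply: d_le_sdist => N; apply/ler_addgt0Pr => e e0.
have e3 : 0 < e / 3 by rewrite divr_gt0.
have [z [w [pz qw zw]]] := h N _ e3.
by have := apx_sdist_le pz qw; lra.
Qed.

Lemma d_ge0 p q : 0 <= d p q.
Proof.
apply/ler_addgt0Pr => e e0; have e2 : 0 < e / 2 by rewrite divr_gt0.
have [z pz] := apx_ex p 0 e2; have [w qw] := apx_ex q 0 e2.
by have := apx_ge pz qw; have := pd_ge0 Q 0 z w; lra.
Qed.

Lemma d_xx p : d p p = 0.
Proof.
apply/eqP; rewrite eq_le d_ge0 andbT; apply: d_le => N e e0.
have [z pz] := apx_ex p N e0; exists z, z; split=> //.
by rewrite pd_xx ?add0r ?ltW//; case: pz.
Qed.

Lemma d_sym p q : d p q = d q p.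
Proof.
suff h p' q' : d p' q' <= d q' p' by apply/eqP; rewrite eq_le !h.
apply: d_le => N e e0; have e2 : 0 < e / 2 by rewrite divr_gt0.
have [z pz] := apx_ex p' N e2; have [w qw] := apx_ex q' N e2.
have := apx_ge qw pz; rewrite pd_sym => h.
have up (p0 : X) z0 : apx p0 N (e / 2) z0 -> apx p0 N e z0.
  by case=> S hS; split=> //; apply: evt_mono hS => k hk; lra.
by exists z, w; split; [exact: up|exact: up|lra].
Qed.

Lemma apx_weak p N e e' z : e <= e' -> apx p N e z -> apx p N e' z.
Proof. by move=> ee' [S hS]; split=> //; apply: evt_mono hS => k hk; lra. Qed.

Lemma d_triangle q p (p' : X) : d p p' <= d p q + d q p'.
Proof.
apply: d_le => N e e0; have e4 : 0 < e / 4 by rewrite divr_gt0.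
have e4e : e / 4 <= e by lra.
have [z pz] := apx_ex p N e4; have [w qw] := apx_ex q N e4; have [v rv] := apx_ex p' N e4.
exists z, v; split; [exact: apx_weak pz|exact: apx_weak rv|].
have := pd_triangle pz.1 qw.1 rv.1; have := apx_ge pz qw; have := apx_ge qw rv; lra.
Qed.

Lemma d_eq0 p q : d p q = 0 -> p = q.
Proof.
move=> pq; case: p q pq => p hp [q hq] pq; apply: eq_exist; apply: functional_extensionality_dep => N.
pose P : X := exist _ p hp; pose P' : X := exist _ q hq.
have -> : p N = sval P N by []. have -> : q N = sval P' N by [].
have : sval (sval P N) = sval (sval P' N).
  rewrite !sval_class; apply: class_eq => [||e e0]; try exact: cauchy_reprP.
  have := sdist_le P P' N; rewrite [d P P']pq => s0.
  apply: evt_mono (sdistP P P' N e0) => k; rewrite ltr_norml; lra.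
by case: (sval P N) (sval P' N) => A hA [B hB] /= AB; exact: eq_exist.
Qed.

Lemma apx_down p i j e e' z : (i <= j)%N -> e < e' -> apx p j e z -> apx p i e' z.
Proof.
move=> ij ee' [Sz hz]; have sub := slit_domain_sub (I := I) (s := sset Q) ij.
split; first exact: sub.
have e0 : 0 < e' - e by rewrite subr_gt0.
apply: evt_mono (evt_and hz (rp_coherent p ij e0)) => k [h1 h2].
have := pd_triangle (rp_in p i k) (sub _ (rp_in p j k)) (sub _ Sz).
have := pd_mono ij (rp_in p j k) Sz; lra.
Qed.

(** At each stage, approximations of the points of the sequence with errors tending
    to zero form a Cauchy sequence. *)
Lemma d_complete (P : nat -> X) : (forall e, 0 < e ->
    exists K, forall k l, (K <= k)%N -> (K <= l)%N -> d (P k) (P l) < e) ->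
  exists p, forall e, 0 < e -> evt (fun k => d (P k) p < e).
Proof.
move=> PC.
have [iv iv0 small] := vanishing_seq R.
have [v hv] : exists v : nat -> nat -> V, forall N k, apx (P k) N (iv k) (v N k).
  have [v hv] := choice (fun Nk : nat * nat => apx_ex (P Nk.2) Nk.1 (iv0 Nk.2)).
  by exists (fun N k => v (N, k)) => N k; exact: (hv (N, k)).
have [|||p hp] := @mkX v.
- by move=> N k; case: (hv N k).
- move=> N e e0; have e3 : 0 < e / 3 by rewrite divr_gt0.
  have [K hK] := PC _ e3; have [K' hK'] := small _ e3.
  exists (maxn K K') => k l; rewrite !geq_max => /andP[kK kK'] /andP[lK lK'].
  have := apx_ge (hv N k) (hv N l); have := hK k l kK lK.
  by have /= := hK' k kK'; have /= := hK' l lK'; lra.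
- move=> i j e ij e0; have e4 : 0 < e / 4 by rewrite divr_gt0.
  apply: evt_mono (small _ e4) => k /= ke.
  have ke2 : iv k < e / 2 by lra.
  have := apx_ge (hv i k) (apx_down ij ke2 (hv j k)); rewrite d_xx; lra.
exists p => e e0; have e2 : 0 < e / 2 by rewrite divr_gt0.
have [K hK] := PC _ e2; exists K => k kK.
suff : d (P k) p <= e / 2 by lra.
apply: d_le => N r r0; have r4 : 0 < r / 4 by rewrite divr_gt0.
have r4r : r / 4 <= r by lra.
have [z Pz] := apx_ex (P k) N r4.
have [K1 hK1] := rp_cauchy p N r4; have [K2 hK2] := hp N _ r4; have [K3 hK3] := small _ r4.
pose l := maxn (maxn K1 K2) (maxn K3 K).
have [lK1 lK2 lK3 lK] : [/\ (K1 <= l)%N, (K2 <= l)%N, (K3 <= l)%N & (K <= l)%N].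
  by rewrite !leq_max !leqnn !orbT.
have Sv : SN N (v N l) by case: (hv N l).
exists z, (v N l); split; first exact: apx_weak Pz.
  split=> //; exists l => k' k'l.
  have := pd_triangle (rp_in p N k') (rp_in p N l) Sv.
  by have := hK1 k' l (leq_trans lK1 k'l) lK1; have /= := hK2 l lK2; lra.
have := apx_ge Pz (hv N l); have := hK k l kK lK; have /= := hK3 l lK3; lra.
Qed.

Lemma tau_cvg p e : 0 < e -> evt (fun k => forall i, `|rp p 0 k 0 i - tau p 0 i| < e).
Proof.
rewrite tau_def => e0; have c : cvg (rp p 0%N @ \oo).
  apply/cauchy_cvgP; apply: cauchy_exP => r r0; have [K hK] := rp_cauchy p 0 r0.
  exists (rp p 0%N K); exists K => // k kK; split=> // i j; rewrite ord1.
  apply: le_lt_trans (hK K k _ kK) => //; rewrite /ball /=.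
  apply: le_trans (coord_le_ed _ _ _) _; exact: pd_ge_ed (rp_in _ _ _) (rp_in _ _ _).
have := c _ (nbhs_rV (tau0 p) e0) => -[K _ hK]; exists K => k kK i; exact: hK.
Qed.

Lemma apx_tau p N e z : apx p N e z -> forall i, `|z 0 i - tau p 0 i| <= e.
Proof.
move=> [Sz hz] i; apply/ler_addgt0Pr => r r0; have r2 : 0 < r / 2 by rewrite divr_gt0.
have [k [[h1 h2] h3]] := evt_ex (evt_and (evt_and hz (tau_cvg p r2)) (rp_coherent p (leq0n N) r2)).
have sub := slit_domain_sub (I := I) (s := sset Q) (leq0n N).
have := coord_le_ed z (rp p N k) i; have := pd_ge_ed Sz (rp_in p N k).
have := coord_le_ed (rp p 0 k) (rp p N k) i.
have := pd_ge_ed (rp_in p 0 k) (sub _ (rp_in p N k)); have := h2 i.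
rewrite (pd_sym _ N z) ltr_norml !ler_norml; lra.
Qed.

Lemma tau_lipschitz p q i : `|tau p 0 i - tau q 0 i| <= d p q.
Proof.
apply/ler_addgt0Pr => e e0; have e4 : 0 < e / 4 by rewrite divr_gt0.
have [z pz] := apx_ex p 0 e4; have [w qw] := apx_ex q 0 e4.
have := apx_ge pz qw; have := apx_tau pz i; have := apx_tau qw i.
have := pd_ge_ed pz.1 qw.1; have := coord_le_ed z w i; rewrite !ler_norml; lra.
Qed.

End SlitSpaceMetric.

(** * Points of the slit space *)
Section Points.
Variables (R : realType) (m : nat) (Q : slits R m).
Local Notation V := 'rV[R]_m.+2.
Local Notation ed := (@euclid_dist R m.+2).
Local Notation I := (open_box (low Q) (high Q)).
Local Notation SN := (slit_domain I (sset Q)).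
Local Notation pd := (pd Q).
Local Notation X := (slit_space I (sset Q)).
Local Notation tau := (@tau R m Q).
Implicit Types (x y z w : V) (N j : nat) (e r : R) (p q : X).

Definition cbox z := forall i, low Q 0 i <= z 0 i <= high Q 0 i.

Definition offslits z := forall j, ~ sset Q j z.

(** The hyperplane at t meets no slit, so that movement inside it is free at every
    stage. All but countably many t are of this kind. *)
Definition generic (t : R) := forall j, sx Q j <> t.

Lemma generic_off z : generic (z 0 ord0) -> offslits z.
Proof. by move=> g j; rewrite ssetE => /(_ ord0); rewrite eqxx => /esym; exact: g. Qed.

Lemma tau_cbox p : cbox (tau p).
Proof.
move=> i; suff h r : 0 < r -> low Q 0 i <= tau p 0 i + r /\ tau p 0 i <= high Q 0 i + r.
  by apply/andP; split; apply/ler_addgt0Pr => r /h[].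
move=> r0; have [z pz] := apx_ex p 0 r0.
by have := apx_tau pz i; have /SNP[/(_ i)] := pz.1; rewrite ler_norml; lra.
Qed.

Definition mid : V := \row_i ((low Q 0 i + high Q 0 i) / 2).

Definition inner (t : R) z : V := z + t *: (mid - z).

Lemma inner_in t z : cbox z -> 0 < t <= 1 -> I (inner t z).
Proof.
move=> zb t01 i; rewrite !mxE; have := zb i; have := low_lt_high Q i => lh zi.
have -> : z 0 i + t * ((low Q 0 i + high Q 0 i) / 2 - z 0 i) =
  (1 - t) * z 0 i + t * ((low Q 0 i + high Q 0 i) / 2) by ring.
have t0 : 0 <= 1 - t by lra.
have h1 : 0 <= (1 - t) * (z 0 i - low Q 0 i) by rewrite mulr_ge0//; lra.
have h2 : 0 <= (1 - t) * (high Q 0 i - z 0 i) by rewrite mulr_ge0//; lra.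
have h3 : 0 < t * ((high Q 0 i - low Q 0 i) / 2) by rewrite mulr_gt0//; lra.
by rewrite !mulrBl !mul1r !mulrBr in h1 h2 h3; apply/andP; split; lra.
Qed.

Lemma inner_near t z i : cbox z -> 0 <= t -> `|inner t z 0 i - z 0 i| <= t * boxsize Q.
Proof.
move=> zb t0; rewrite !mxE addrAC subrr add0r normrM ger0_norm// ler_wpM2l//.
apply: le_trans (side_le_boxsize Q i); have := zb i; have := low_lt_high Q i.
by rewrite ler_norml; lra.
Qed.

Lemma inner_small z e : cbox z -> 0 < e -> exists2 t, 0 < t <= 1 &
  forall s, 0 < s <= t -> forall i, `|inner s z 0 i - z 0 i| < e.
Proof.
move=> zb e0; have b0 := boxsize_gt0 Q.
exists (Num.min 1 (e / (2 * boxsize Q))).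
  by rewrite lt_min ltr01 ge_min lexx andbT divr_gt0// mulr_gt0.
move=> s /andP[s0]; rewrite le_min => /andP[s1 se] i.
apply: le_lt_trans (inner_near i zb (ltW s0)) _.
have : s * (2 * boxsize Q) <= e by rewrite -ler_pdivlMr// mulr_gt0.
have sb : 0 < s * boxsize Q by rewrite mulr_gt0.
by rewrite mulrCA; lra.
Qed.

Lemma ed_small z w e : (forall i, `|z 0 i - w 0 i| < e / m.+2%:R) -> ed z w < e.
Proof.
move=> h; apply: le_lt_trans (ed_le_sum _ _) _.
have -> : e = \sum_(i < m.+2) e / m.+2%:R.
  by rewrite sumr_const card_ord -[RHS]mulr_natr divfK.
by apply: ltr_sum => [|i _]; [apply/hasP; exists ord0; rewrite ?mem_index_enum|exact: h].
Qed.

Lemma rp_tau p N e : 0 < e -> evt (fun k => forall i, `|rp p N k 0 i - tau p 0 i| < e).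
Proof.
move=> e0; have e2 : 0 < e / 2 by rewrite divr_gt0.
have sub := slit_domain_sub (I := I) (s := sset Q) (leq0n N).
apply: evt_mono (evt_and (tau_cvg p e2) (rp_coherent p (leq0n N) e2)) => k [h1 h2] i.
have := h1 i; have := coord_le_ed (rp p 0 k) (rp p N k) i.
have := pd_ge_ed (rp_in p 0 k) (sub _ (rp_in p N k)).
by rewrite ler_norml !ltr_norml; lra.
Qed.

(** Over a point of no removed slit, all nearby points of the box approximate. *)
Lemma apx_near p N e : (forall j, (j < N)%N -> ~ sset Q j (tau p)) -> 0 < e ->
  exists2 r, 0 < r & forall w, I w -> (forall i, `|w 0 i - tau p 0 i| < r) -> apx p N e w.
Proof.
move=> off e0; have [r1 r10 [inS short]] := local_convex off.
have [q qE q0] : exists2 q, e / m.+2%:R = q & 0 < q by exists (e / m.+2%:R); rewrite ?divr_gt0.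
pose r2 := q / 2; have r20 : 0 < r2 by rewrite divr_gt0.
pose r := Num.min r1 r2; have r0 : 0 < r by rewrite lt_min r10.
have rr1 : r <= r1 by rewrite ge_min lexx.
have rr2 : r <= r2 by rewrite ge_min lexx orbT.
exists r => // w Iw wt; have wt1 i := lt_le_trans (wt i) rr1.
split; first exact: inS.
apply: evt_mono (rp_tau p N r0) => k pt.
have /SNP[Ip _] := rp_in p N k; have pt1 i := lt_le_trans (pt i) rr1.
apply: le_lt_trans (_ : ed (rp p N k) w < e).
  by apply: pd_le; [exact: rp_in|exact: inS|exact: short].
apply: ed_small => i; rewrite qE; have := pt i; have := wt i.
by rewrite /r2 in rr2; rewrite !ltr_norml; lra.
Qed.

(** Off the slits, a neighbourhood in the box is convex at each stage, so two
    points over the same one have approximations at small distance. *)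
Lemma fiber_unique p q : tau p = tau q -> offslits (tau p) -> p = q.
Proof.
move=> pq off; apply: d_eq0; apply/eqP; rewrite eq_le d_ge0 andbT.
apply: d_le => N e e0.
have [r1 r10 h1] := apx_near (fun j (_ : (j < N)%N) => off j) e0.
have off' : offslits (tau q) by rewrite -pq.
have [r2 r20 h2] := apx_near (fun j (_ : (j < N)%N) => off' j) e0.
have [||t t01 ht] := @inner_small (tau p) (Num.min r1 r2); first exact: tau_cbox.
  by rewrite lt_min r10.
have tt : 0 < t <= t by rewrite lexx; lra.
exists (inner t (tau p)), (inner t (tau p)); split.
- apply: h1 => [|i]; first by apply: inner_in => //; exact: tau_cbox.
  by apply: lt_le_trans (ht _ tt i) _; rewrite ge_min lexx.
- apply: h2 => [|i]; first by apply: inner_in => //; exact: tau_cbox.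
  by rewrite -pq; apply: lt_le_trans (ht _ tt i) _; rewrite ge_min lexx orbT.
rewrite pd_xx ?add0r ?ltW//.
have [||+ _] := h1 (inner t (tau p)) => //; first by apply: inner_in => //; exact: tau_cbox.
by move=> i; apply: lt_le_trans (ht _ tt i) _; rewrite ge_min lexx.
Qed.

(** A sequence of the box whose tail is, for every stage, joined by segments there
    defines a point of the slit space over its limit. *)
Lemma point_of_seq (u : nat -> V) z : (forall e, 0 < e -> evt (fun k => forall i, `|u k 0 i - z 0 i| < e)) ->
  (forall N, exists K, forall k l, (K <= k)%N -> (K <= l)%N ->
     SN N (u k) /\ (path_dist (SN N) (u k) (u l) <= (ed (u k) (u l))%:E)%E) ->
  exists p, tau p = z.
Proof.
move=> uz uS; have [K hK] := choice uS.
have edz e : 0 < e -> exists L, forall k l, (L <= k)%N -> (L <= l)%N -> ed (u k) (u l) < e.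
  move=> e0; have [q qE q0] : exists2 q, e / m.+2%:R = q & 0 < q.
    by exists (e / m.+2%:R); rewrite ?divr_gt0.
  have [|L hL] := uz (q / 2); first by rewrite divr_gt0.
  exists L => k l kL lL; apply: ed_small => i; rewrite qE.
  by have := hL k kL i; have := hL l lL i; rewrite !ltr_norml; lra.
have uSN N k : (K N <= k)%N -> SN N (u k) by move=> kK; have [] := hK N k k kK kK.
have upd N k l : (K N <= k)%N -> (K N <= l)%N -> pd N (u k) (u l) <= ed (u k) (u l).
  by move=> kK lK; have [Sk h] := hK N k l kK lK; apply: pd_le => //; exact: uSN.
have [|N e e0|i j e ij e0|p hp] := @mkX R m Q (fun N k => u (maxn k (K N))).
- by move=> N k; apply: uSN; rewrite leq_maxr.
- have [L hL] := edz e e0; exists L => k l kL lL.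
  apply: le_lt_trans (hL (maxn k (K N)) (maxn l (K N)) _ _).
  + by apply: upd; rewrite leq_maxr.
  + by rewrite leq_max kL.
  + by rewrite leq_max lL.
- have [L hL] := edz e e0; exists (maxn L (K i)) => k; rewrite geq_max => /andP[kL kK].
  apply: le_lt_trans (hL (maxn k (K i)) (maxn k (K j)) _ _).
  + by apply: upd; rewrite ?leq_maxr// leq_max kK.
  + by rewrite leq_max kL.
  + by rewrite leq_max kL.
exists p; apply/rowP => i; apply/eqP; rewrite -subr_eq0 -normr_le0.
apply/ler_addgt0Pl => e e0; rewrite addr0; have e3 : 0 < e / 3 by rewrite divr_gt0.
have [L hL] := uz _ e3; have [L' hL'] := hp 0%N _ e3; have [L'' hL''] := tau_cvg p e3.
pose k := maxn L (maxn L' L'').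
have [kL kL' kL''] : [/\ (L <= k)%N, (L' <= k)%N & (L'' <= k)%N].
  by rewrite !leq_max !leqnn !orbT.
have [kL1 kK] : (L <= maxn k (K 0%N))%N /\ (K 0%N <= maxn k (K 0%N))%N.
  by rewrite leq_maxr leq_max kL.
have := hL _ kL1 i; have /= := hL' _ kL'; have := hL'' _ kL'' i.
have := coord_le_ed (rp p 0 k) (u (maxn k (K 0%N))) i.
have := pd_ge_ed (rp_in p 0 k) (uSN _ _ kK).
by rewrite !ltr_norml !ler_norml; lra.
Qed.

Lemma point_over z : cbox z -> offslits z -> exists p, tau p = z.
Proof.
move=> zb off; have [iv iv0 small] := vanishing_seq R.
pose v k := Num.min (iv k) 1; have v01 k : 0 < v k <= 1.
  by rewrite lt_min iv0 ltr01 ge_min lexx orbT.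
have near e : 0 < e -> evt (fun k => forall i, `|inner (v k) z 0 i - z 0 i| < e).
  move=> e0; have [t t01 ht] := inner_small zb e0.
  have t0 : 0 < t by case/andP: t01.
  apply: evt_mono (small t t0) => k kt; apply: ht; have /andP[-> _] /= := v01 k.
  by rewrite ge_min ltW.
apply: (@point_of_seq (fun k => inner (v k) z)) => // N.
have [e e0 [inS short]] := local_convex (fun j (_ : (j < N)%N) => off j).
have [K hK] := near e e0; exists K => k l kK lK.
by split; [apply: inS|apply: short] => //; (try exact: inner_in); exact: hK.
Qed.

Lemma point_over_slit j z : sset Q j z -> exists p, tau p = z.
Proof.
move=> jz; have [iv iv0 small] := vanishing_seq R.
have z0 : z 0 ord0 = sx Q j by have := jz; rewrite ssetE => /(_ ord0); rewrite eqxx.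
apply: (@point_of_seq (fun k => upd z ord0 (sx Q j + iv k))) => [e e0|N].
  apply: evt_mono (small e e0) => k /= ke i; rewrite updE; case: eqP => [->|_].
    by rewrite z0 addrC addKr ger0_norm// ltW.
  by rewrite subrr normr0.
have [e e0 iso] := nears_isolated Q N j; have [K hK] := small e e0.
have inS (v : R) : 0 < v < e -> SN N (upd z ord0 (sx Q j + v)).
  move=> v0; have [|Iy off] := iso (upd z ord0 (sx Q j + v)).
    apply: (near_nears jz) => i; rewrite updE; case: eqP => [->|_].
      by rewrite z0 addrC addKr ger0_norm; lra.
    by rewrite subrr normr0.
  apply/SNP; split=> // k kN; have [->|/eqP kj] := eqVneq k j; last exact: off.
  by rewrite ssetE => /(_ ord0) /=; rewrite updE /=; lra.
exists K => k l kK lK; have /= ke := hK k kK; have /= le := hK l lK.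
have := iv0 k; have := iv0 l => l0 k0.
split; first by apply: inS; rewrite k0.
apply: path_dist_segment => t t01.
have -> : upd z ord0 (sx Q j + iv k) + t *: (upd z ord0 (sx Q j + iv l) - upd z ord0 (sx Q j + iv k))
    = upd z ord0 (sx Q j + (iv k + t * (iv l - iv k))).
  apply/rowP => i; rewrite !mxE; case: ifP => _; first by ring.
  by rewrite subrr mulr0 addr0.
apply: inS; have /andP[+ +] := between_bounds (iv k) (iv l) t01.
by rewrite ge_min le_max => /orP[] ? /orP[] ?; apply/andP; split; lra.
Qed.

(** Two points are at Euclidean distance at most when the segment joining their
    projections, pushed into the box, eventually avoids every slit. *)
Lemma slide p q : offslits (tau p) -> offslits (tau q) ->
  (forall N, exists2 t, 0 < t <= 1 & forall s, 0 < s <= t ->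
    forall v : R, 0 <= v <= 1 -> forall j, (j < N)%N ->
      ~ sset Q j (inner s (tau p) + v *: (inner s (tau q) - inner s (tau p)))) ->
  d p q <= ed (tau p) (tau q).
Proof.
move=> offp offq seg; apply: d_le => N e e0.
have [r1 r10 h1] := apx_near (fun j (_ : (j < N)%N) => offp j) e0.
have [r2 r20 h2] := apx_near (fun j (_ : (j < N)%N) => offq j) e0.
have [t1 t101 ht1] := inner_small (tau_cbox p) r10.
have [t2 t201 ht2] := inner_small (tau_cbox q) r20.
have [t3 t301 ht3] := seg N.
pose s := Num.min t1 (Num.min t2 t3).
have s0 : 0 < s by rewrite !lt_min; apply/and3P; split; lra.
have st1 : 0 < s <= t1 by rewrite s0 ge_min lexx.
have st2 : 0 < s <= t2 by rewrite s0 !ge_min lexx orbT.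
have st3 : 0 < s <= t3 by rewrite s0 !ge_min lexx !orbT.
have s1 : 0 < s <= 1 by lra.
have Ip := inner_in (tau_cbox p) s1; have Iq := inner_in (tau_cbox q) s1.
have ap : apx p N e (inner s (tau p)) by apply: h1 => //; exact: ht1.
have aq : apx q N e (inner s (tau q)) by apply: h2 => //; exact: ht2.
exists (inner s (tau p)), (inner s (tau q)); split=> //.
apply: (@le_trans _ _ (ed (tau p) (tau q))); last by rewrite lerDl ltW.
apply: (@le_trans _ _ (ed (inner s (tau p)) (inner s (tau q)))).
  apply: pd_le; [exact: ap.1|exact: aq.1|].
  apply: path_dist_segment => v v01; apply/SNP; split; first exact: box_convex.
  by move=> j jN; exact: ht3.
rewrite -(ler_pXn2r (n := 2)) ?nnegrE ?ed_ge0// !ed_sqr; apply: ler_sum => i _.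
rewrite !mxE.
have -> : tau p 0 i + s * ((low Q 0 i + high Q 0 i) / 2 - tau p 0 i) -
  (tau q 0 i + s * ((low Q 0 i + high Q 0 i) / 2 - tau q 0 i)) =
  (1 - s) * (tau p 0 i - tau q 0 i) by ring.
rewrite exprMn ler_piMl ?sqr_ge0// expr_le1//; lra.
Qed.

(** The segment lies in a hyperplane that meets no slit. *)
Lemma vertical_slide p q : tau p 0 ord0 = tau q 0 ord0 -> generic (tau p 0 ord0) ->
  d p q <= ed (tau p) (tau q).
Proof.
move=> pq g; apply: slide => [||N]; [exact: generic_off|by apply: generic_off; rewrite -pq|].
have [e e0 he] : exists2 e, 0 < e & forall j, (j < N)%N -> e <= `|sx Q j - tau p 0 ord0|.
  apply: finite_radius => [j e e' le|j jN]; first exact: le_trans.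
  exists `|sx Q j - tau p 0 ord0| => //; rewrite normr_gt0 subr_eq0; exact/eqP/g.
have [t t01 ht] := inner_small (tau_cbox p) e0.
exists t => // s st v v01 j jN; rewrite ssetE => /(_ ord0) /= h.
have := ht s st ord0; rewrite ltNge => /negP; apply; apply: le_trans (he j jN) _.
by rewrite -h !mxE pq; rewrite -pq subrr mulr0 addr0.
Qed.

Definition edge t : V := upd (low Q) ord0 t.

Lemma edge_cbox t : low Q 0 ord0 <= t <= high Q 0 ord0 -> cbox (edge t).
Proof.
move=> tb i; rewrite updE; case: eqP => [->//|_].
by rewrite lexx /= ltW// low_lt_high.
Qed.

Lemma edge_off t : offslits (edge t).
Proof.
move=> j; rewrite ssetE => /(_ (i1 m)) /=; rewrite updE /=.
by have := corner_bounds Q j (i1 m) => /= -[]; lra.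
Qed.

(** The slits stay at a positive distance from this edge of the box at each stage. *)
Lemma edge_slide p q t t' : tau p = edge t -> tau q = edge t' -> d p q <= `|t - t'|.
Proof.
move=> pt qt; have -> : `|t - t'| = ed (tau p) (tau q).
  have -> : tau q = upd (tau p) ord0 t'.
    by rewrite pt qt; apply/rowP => i; rewrite !updE; case: eqP.
  by rewrite ed_upd pt updE.
apply: slide => [||N]; [rewrite pt; exact: edge_off|rewrite qt; exact: edge_off|].
have [e e0 he] : exists2 e, 0 < e &
    forall j, (j < N)%N -> low Q 0 (i1 m) + e <= sc Q j 0 (i1 m).
  apply: finite_radius => [j e e' le|j jN]; first by lra.
  have := corner_bounds Q j (i1 m) => /= -[h _].
  by exists (sc Q j 0 (i1 m) - low Q 0 (i1 m)); lra.
have [u u01 hu] := inner_small (tau_cbox p) e0.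
exists u => // s su v v01 j jN; rewrite ssetE => /(_ (i1 m)) /= h.
have := hu s su (i1 m); have := he j jN; move: h.
by rewrite !mxE pt qt !updE /= subrr mulr0 addr0 ltr_norml; lra.
Qed.

Lemma box_boundary z : cbox z -> ~ I z -> boundary I z.
Proof.
move=> zb nI; split; last by move=> /interior_subset.
move=> B /nbhs_ballP[e /= e0 eB].
have [u u01 hu] := inner_small zb e0.
have uu : 0 < u <= u by rewrite lexx; lra.
exists (inner u z); split; first by apply: inner_in => //; lra.
by apply: eB; split=> // i j; rewrite ord1 /ball /= distrC; exact: hu.
Qed.

Lemma edge_boundary t : low Q 0 ord0 <= t <= high Q 0 ord0 -> boundary I (edge t).
Proof.
move=> tb; apply: box_boundary; first exact: edge_cbox.
by move=> /(_ (i1 m)); rewrite updE /= ltxx.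
Qed.

Lemma slit_diam j p q : sset Q j (tau p) -> sset Q j (tau q) -> d p q <= m.+3%:R * sl Q j.
Proof.
move=> jp jq; apply: d_le => N e e0.
have [r r0 hr] := around_slit Q N j e0.
pose r' := Num.min (r / 2) e; have r'0 : 0 < r' by rewrite lt_min e0 divr_gt0.
have r'e : r' <= e by rewrite ge_min lexx orbT.
have r'r : r' < r.
  apply: (@le_lt_trans _ _ (r / 2)); first by rewrite ge_min lexx.
  by rewrite ltr_pdivrMr// mulr_natr mulr2n ltrDl.
have [z pz] := apx_ex p N r'0; have [w qw] := apx_ex q N r'0.
exists z, w; split; [exact: apx_weak pz|exact: apx_weak qw|].
apply: pd_le; [exact: pz.1|exact: qw.1|apply: hr; [exact: pz.1|exact: qw.1| |]].
  by apply: (near_nears jp) => i; exact: le_lt_trans (apx_tau pz i) r'r.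
by apply: (near_nears jq) => i; exact: le_lt_trans (apx_tau qw i) r'r.
Qed.

End Points.

(** * Porosity makes balls large *)
Lemma between_perturbed (R : realType) (a b t a' b' e : R) :
  Num.min a b < t < Num.max a b -> e < `|t - a| -> e < `|t - b| ->
  `|a' - a| <= e -> `|b' - b| <= e -> Num.min a' b' <= t <= Num.max a' b'.
Proof.
have h (p q p' q' : R) : p <= q -> p < t < q -> e < `|t - p| -> e < `|t - q| ->
    `|p' - p| <= e -> `|q' - q| <= e -> p' <= t <= q'.
  move=> pq /andP[pt tq].
  rewrite gtr0_norm ?subr_gt0// ltr0_norm ?subr_lt0// !ler_norml => ? ? ? ?.
  by apply/andP; split; lra.
have [ab|/ltW ba] := leP a b => tab ta tb a'a b'b.
  have /andP[h1 h2] := h _ _ _ _ ab tab ta tb a'a b'b.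
  by rewrite ge_min le_max h1 h2 orbT.
have /andP[h1 h2] := h _ _ _ _ ba tab tb ta b'b a'a.
by rewrite ge_min le_max h1 h2 orbT.
Qed.

Section Regularity.
Variables (R : realType) (m : nat) (Q : slits R m).
Local Notation V := 'rV[R]_m.+2.
Local Notation ed := (@euclid_dist R m.+2).
Local Notation I := (open_box (low Q) (high Q)).
Local Notation SN := (slit_domain I (sset Q)).
Local Notation X := (slit_space I (sset Q)).
Local Notation tau := (@tau R m Q).
Implicit Types (x y z w : V) (N j : nat) (e r : R) (p q : X).

Definition porous_slits := porous (@slit_dist R m.+2 I (sset Q))
  (@peripheral_spheres R m.+2 I (sset Q)).

Hypothesis por : porous_slits.

Lemma slit_width j : exists p q, [/\ sset Q j (tau p), sset Q j (tau q) & sl Q j <= d p q].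
Proof.
have l0 := sl_gt0 Q j.
pose z t : V := \row_i if i == ord0 then sx Q j else sc Q j 0 i + t * sl Q j.
have jz t : 0 <= t <= 1 -> sset Q j (z t).
  move=> t01; rewrite ssetE => i /=; rewrite mxE; case: eqP => // _.
  have h1 : 0 <= t * sl Q j by apply: mulr_ge0; lra.
  have h2 : 0 <= (1 - t) * sl Q j by apply: mulr_ge0; lra.
  by rewrite mulrBl mul1r in h2; apply/andP; split; lra.
have j0 : sset Q j (z 0) by apply: jz; rewrite lexx ler01.
have j1 : sset Q j (z 1) by apply: jz; rewrite lexx ler01.
have [p pz] := point_over_slit j0; have [q qz] := point_over_slit j1.
exists p, q; rewrite pz qz; split=> //.
apply: le_trans (tau_lipschitz p q (i1 m)); rewrite pz qz !mxE /=.
by rewrite ler_normr; apply/orP; right; lra.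
Qed.

(** In small balls porosity provides a slit, as the outer boundary does not fit. *)
Lemma porous_slit : exists2 A, 0 < A & exists2 r1, 0 < r1 &
  forall p r, 0 < r < r1 -> exists j, (forall q, sset Q j (tau q) -> d p q < r) /\ r / A <= sl Q j.
Proof.
have [A A0 hA] := por; have lh := low_lt_high Q ord0.
have tb0 : low Q 0 ord0 <= low Q 0 ord0 <= high Q 0 ord0 by rewrite lexx ltW.
have tb1 : low Q 0 ord0 <= high Q 0 ord0 <= high Q 0 ord0 by rewrite lexx ltW.
have [p0 p0E] := point_over (edge_cbox tb0) (@edge_off R m Q _).
have [p1 p1E] := point_over (edge_cbox tb1) (@edge_off R m Q _).
have far : high Q 0 ord0 - low Q 0 ord0 <= d p0 p1.
  apply: le_trans (tau_lipschitz p0 p1 ord0).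
  by rewrite p0E p1E !updE eqxx ler_normr; apply/orP; right; lra.
exists (A * m.+3%:R); first by rewrite mulr_gt0.
exists ((high Q 0 ord0 - low Q 0 ord0) / 2) => [|p r /andP[r0 r1]]; first by lra.
have [|E [sE Er dE]] := hA p r r0.
  apply: lt_le_trans (_ : d p0 p1 <= _); first by lra.
  rewrite d_def; apply: ub_le_sup; last by exists p0 => //; exists p1.
  exists (2 * (d p0 p0 + 5 * boxsize Q)) => _ [q _ [q' _ <-]].
  have b0 := boxsize_gt0 Q.
  have : d q q' <= 5 * boxsize Q by apply: d_le_sdist => N; exact: sdist_bounded.
  rewrite d_xx -d_def; lra.
case: sE => [[j _ jE]|EE]; last first.
  have E0 : E p0 by rewrite EE /outer_boundary /= -tau_def p0E; exact: edge_boundary.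
  have E1 : E p1 by rewrite EE /outer_boundary /= -tau_def p1E; exact: edge_boundary.
  have := Er _ E0; have := Er _ E1; rewrite /= -!d_def => h1 h0.
  by have := d_triangle p p0 p1; rewrite (d_sym p0 p); lra.
exists j; split=> [q jq|].
  by rewrite d_def; apply: Er; rewrite -jE /= -tau_def.
have : diam (@slit_dist R m.+2 I (sset Q)) E <= m.+3%:R * sl Q j.
  apply: ge_sup => [|_ [q Eq [q' Eq' <-]]].
    have [q [q' [jq _ _]]] := slit_width j.
    by exists (slit_dist q q), q; [|exists q => //]; rewrite -jE /= -tau_def.
  by rewrite -jE /= -tau_def in Eq; rewrite -jE /= -tau_def in Eq'; rewrite -d_def; exact: slit_diam.
move=> /(le_trans dE) h; rewrite invfM mulrA ler_pdivrMr//.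
by rewrite [sl Q j * _]mulrC.
Qed.

(** Ahlfors regularity from below: a ball of radius r contains the generic points
    over a Euclidean box with sides comparable to r. Near the centre of a slit
    provided by porosity there is a second one, which relative separation keeps at
    a horizontal distance comparable to r; a curve between them crosses all the
    vertical slices in between, and movement inside a slice is free. *)
Lemma ball_contains_box : exists2 c, 0 < c & exists2 r0, 0 < r0 &
  forall p r, 0 < r < r0 -> exists lo hi : V,
    [/\ forall i, c * r <= hi 0 i - lo 0 i,
        forall i, low Q 0 i <= lo 0 i /\ hi 0 i <= high Q 0 i
      & forall q, (forall i, lo 0 i < tau q 0 i < hi 0 i) -> generic Q (tau q 0 ord0) ->
          d p q < r].
Proof.
have [A A0 [r1 r10 hA]] := porous_slit; have s0 := sep_gt0 Q.
have q0 : 0 < Num.min 1 (4 * A)^-1 by rewrite lt_min ltr01 invr_gt0 mulr_gt0.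
pose B : R := m.+3%:R * A; have B0 : 0 < B by rewrite mulr_gt0.
pose c := Num.min (2 * B)^-1 (sep Q * Num.min 1 (4 * A)^-1 / B).
have c0 : 0 < c by rewrite lt_min !(invr_gt0, divr_gt0, mulr_gt0).
exists c => //; exists r1 => // p r /andP[r0 rr1].
have m3 : 1 <= m.+3%:R :> R by rewrite ler1n.
pose r' := r / m.+3%:R; have r'0 : 0 < r' by rewrite divr_gt0.
have r'r : r' <= r by rewrite ler_pdivrMr// ler_peMr// ltW.
have rE : r = r' * m.+3%:R by rewrite divfK.
have [|j [jr jA]] := hA p r'; first by rewrite r'0 (le_lt_trans r'r).
have l0 := sl_gt0 Q j.
have lr : sl Q j < 2 * r'.
  have [q [q' [jq jq' /le_lt_trans]]] := slit_width j; apply.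
  have := jr q jq; have := jr q' jq'; have := d_triangle p q q'.
  by rewrite (d_sym q p); lra.
have [pc pcE] := point_over_slit (center_in Q j).
have dpc : d p pc < r' by apply: jr; rewrite pcE; exact: center_in.
pose r2 := sl Q j / 4; have r20 : 0 < r2 by rewrite divr_gt0.
have [|k [kr kA]] := hA pc r2; first by rewrite r20 /=; rewrite /r2; lra.
have kj : j <> k.
  move=> jk; have [q [q' [jq jq' h]]] := slit_width j.
  have := kr q; have := kr q'; rewrite -jk => /(_ jq') h1 /(_ jq) h2.
  by have := d_triangle pc q q'; rewrite (d_sym q pc) /r2 in h1 h2 *; lra.
have [pk pkE] := point_over_slit (center_in Q k).
have dk : d pc pk < r2 by apply: kr; rewrite pkE; exact: center_in.
have gap : sep Q * Num.min (sl Q j) (sl Q k) <= `|sx Q k - sx Q j|.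
  have jz : sset Q j (upd (center Q k) ord0 (sx Q j)).
    rewrite ssetE => i /=; rewrite updE; case: eqP => // /eqP i0.
    have := tau_lipschitz pc pk i; rewrite pcE pkE [center Q j 0 i]mxE (negbTE i0).
    by rewrite ler_norml; rewrite /r2 in dk; lra.
  have := slits_sep kj jz (center_in Q k); rewrite ed_sym ed_upd.
  by rewrite [center Q k 0 ord0]mxE eqxx.
have gap' : c * r <= `|sx Q k - sx Q j|.
  apply: le_trans gap.
  have h1 : sl Q j * Num.min 1 (4 * A)^-1 <= Num.min (sl Q j) (sl Q k).
    rewrite le_min; apply/andP; split.
      by rewrite ler_piMr ?(ltW l0)// ge_min lexx.
    apply: le_trans kA; rewrite /r2 -mulrA -invfM; apply: ler_wpM2l; first exact: ltW.
    by rewrite ge_min lexx orbT.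
  apply: le_trans (_ : sep Q * (sl Q j * Num.min 1 (4 * A)^-1) <= _); last by apply: ler_wpM2l; [exact: ltW|].
  apply: le_trans (_ : sep Q * (r' / A * Num.min 1 (4 * A)^-1) <= _); last first.
    apply: ler_wpM2l; first exact: ltW.
    by apply: ler_wpM2r; first exact: ltW.
  apply: le_trans (_ : sep Q * Num.min 1 (4 * A)^-1 / B * r <= _).
    by apply: ler_wpM2r; [exact: ltW|rewrite ge_min lexx orbT].
  rewrite rE /B invfM le_eqVlt; apply/orP; left; apply/eqP.
  by field; rewrite !gt_eqF.
have cl : c * r <= sl Q j / 2.
  apply: le_trans (_ : r' / A / 2 <= _); last by rewrite ler_wpM2r.
  apply: le_trans (_ : (2 * B)^-1 * r <= _); first by apply: ler_wpM2r; [exact: ltW|rewrite ge_min lexx].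
  rewrite rE /B !invfM le_eqVlt; apply/orP; left; apply/eqP.
  by field; rewrite !gt_eqF.
pose lo : V := \row_i if i == ord0 then Num.min (sx Q j) (sx Q k) else center Q j 0 i - r2.
pose hi : V := \row_i if i == ord0 then Num.max (sx Q j) (sx Q k) else center Q j 0 i + r2.
exists lo, hi; split=> [i|i|q qb qg].
- rewrite !mxE; case: eqP => // _; last by rewrite /r2; lra.
  by apply: le_trans gap' _; rewrite ler_norml /Num.min /Num.max; case: ifP => h; lra.
- rewrite !mxE; case: eqP => [->|/eqP i0].
    have /= := corner_bounds Q j ord0; have /= := corner_bounds Q k ord0.
    by rewrite le_min ge_max => /andP[? ?] /andP[? ?]; split; apply/andP; split; exact: ltW.
  by have := corner_bounds Q j i; rewrite (negbTE i0) /r2 => -[? ?]; split; lra.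
have lr2 : r2 < r' / 2 by rewrite /r2; lra.
have : d pc q <= (2 * m%:R + 3) * r2.
  apply: d_le => N e e0.
  have t0 := qb ord0; rewrite !mxE eqxx in t0.
  set t := tau q 0 ord0 in t0 qg.
  pose e' := Num.min (Num.min ((r2 - d pc pk) / 3) (e / (2 * (m.+1%:R + 1))))
    (Num.min `|t - sx Q j| `|t - sx Q k| / 2).
  have nj : 0 < `|t - sx Q j| by rewrite normr_gt0 subr_eq0; apply/eqP => tj; exact: (qg j).
  have nk : 0 < `|t - sx Q k| by rewrite normr_gt0 subr_eq0; apply/eqP => tj; exact: (qg k).
  have m10 : 0 < m.+1%:R + 1 :> R by rewrite ltr_wpDl.
  have e'0 : 0 < e'.
    rewrite !lt_min; apply/andP; split; [apply/andP; split|].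
    - by rewrite divr_gt0// subr_gt0.
    - by rewrite divr_gt0// mulr_gt0.
    - by rewrite divr_gt0// lt_min nj nk.
  have e'1 : e' <= (r2 - d pc pk) / 3 by rewrite !ge_min lexx.
  have e'2 : e' * (m.+1%:R + 1) <= e / 2.
    have : e' <= e / (2 * (m.+1%:R + 1)) by rewrite !ge_min lexx orbT.
    by rewrite invfM mulrA -ler_pdivlMr.
  have e'e : e' <= e.
    have : e' * 1 <= e' * (m.+1%:R + 1) by rewrite ler_pM2l// lerDr.
    lra.
  have e'3 : e' < `|t - sx Q j| /\ e' < `|t - sx Q k|.
    have h : e' <= Num.min `|t - sx Q j| `|t - sx Q k| / 2 by rewrite !ge_min lexx !orbT.
    have h1 : Num.min `|t - sx Q j| `|t - sx Q k| <= `|t - sx Q j| by rewrite ge_min lexx.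
    have h2 : Num.min `|t - sx Q j| `|t - sx Q k| <= `|t - sx Q k| by rewrite ge_min lexx orbT.
    lra.
  have [z pz] := apx_ex pc N e'0; have [z' pz'] := apx_ex pk N e'0.
  have Iq : I (tau q).
    move=> i; have := qb i; rewrite !mxE; case: eqP => [->|/eqP i0] h.
      have /= /andP[j1 j2] := corner_bounds Q j ord0.
      have /= /andP[k1 k2] := corner_bounds Q k ord0; case/andP: h => h1 h2.
      by apply/andP; split; [apply: lt_trans h1|apply: lt_trans h2 _];
        rewrite ?lt_min ?gt_max ?j1 ?j2.
    by have := corner_bounds Q j i; rewrite (negbTE i0) => -[? ?]; rewrite /r2 in h; apply/andP; split; lra.
  have aq : apx q N e (tau q).
    have off : offslits Q (tau q) by exact: generic_off.
    have [r3 r30 hr3] := apx_near (fun i (_ : (i < N)%N) => off i) e0.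
    by apply: hr3 => // i; rewrite subrr normr0.
  exists z, (tau q); split=> //; first exact: apx_weak pz.
  have zz' : (path_dist (SN N) z z' < r2%:E)%E.
    apply: pd_ltE; [exact: pz.1|exact: pz'.1|].
    by have := apx_ge pz pz'; lra.
  have zj : forall i, `|z 0 i - center Q j 0 i| <= e' by move=> i; have := apx_tau pz i; rewrite pcE.
  have z'k : `|z' 0 ord0 - sx Q k| <= e'.
    by have := apx_tau pz' ord0; rewrite pkE [center Q k 0 ord0]mxE eqxx.
  have zj0 := zj ord0; rewrite mxE eqxx in zj0.
  have [|y [Sy yt zy]] := path_dist_cross (v := t) (i := ord0) zz'.
    by case: e'3 => ? ?; exact: between_perturbed t0 _ _ zj0 z'k.
  have Sq : SN N (tau q) by case: aq.
  have /SNP[Iy _] := Sy.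
  have yq : (path_dist (SN N) y (tau q) <= (ed y (tau q))%:E)%E.
    by apply: vertical_dist; rewrite ?yt// => i _; exact: qg.
  have edyq : ed y (tau q) <= m.+1%:R * (2 * r2 + e').
    apply: le_trans (ed_le_sum _ _) _; rewrite big_ord_recl yt subrr normr0 add0r.
    apply: le_trans (_ : \sum_(i < m.+1) (2 * r2 + e') <= _); last first.
      by rewrite sumr_const card_ord -[X in X <= _]mulr_natl.
    apply: ler_sum => i _.
    have zy' : ed z y < r2 by rewrite -lte_fin; apply: le_lt_trans (path_dist_ge _ _ _) zy.
    have := coord_le_ed z y (lift ord0 i); have := zj (lift ord0 i).
    have := qb (lift ord0 i); rewrite !mxE /= !ler_norml; lra.
  have : pd Q N z (tau q) <= r2 + ed y (tau q).
    apply: pd_le => //; first exact: pz.1.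
    apply: le_trans (path_dist_triangle _ _ y _) _; rewrite EFinD; apply: leeD => //.
    exact: ltW.
  have m1E : m.+1%:R = m%:R + 1 :> R by rewrite -natr1.
  move=> h; apply: le_trans h _; move: edyq e'2; rewrite m1E => edyq e'2.
  have -> : (2 * m%:R + 3) * r2 + e = r2 + (m%:R + 1) * (2 * r2) + e by ring.
  rewrite mulrDr in edyq; rewrite mulrDr mulr1 in e'2; lra.
have m3E : m.+3%:R = m%:R + 3 :> R by rewrite -addn3 natrD.
have m0 : 0 <= 2 * m%:R + 3 :> R by rewrite addr_ge0// mulr_ge0.
have h : (2 * m%:R + 3) * r2 <= (2 * m%:R + 3) * (r' / 2) by rewrite ler_wpM2l// ltW.
have := d_triangle pc p q; rewrite rE m3E.
have -> : r' * (m%:R + 3) = (2 * m%:R + 3) * (r' / 2) + 3 * r' / 2 by field.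
lra.
Qed.

End Regularity.

(** * Packing of boxes *)
Section Packing.
Variables (R : realType) (n : nat).
Local Notation V := 'rV[R]_n.
Implicit Types (B : V * V) (s : seq (V * V)).

(** Boxes are given by their lower and upper corners; they are separated when a
    coordinate in r tells them apart. *)
Definition sepr (r : seq 'I_n) B B' : bool :=
  has (fun i => (B.2 0 i <= B'.1 0 i) || (B'.2 0 i <= B.1 0 i)) r.

Definition volr (r : seq 'I_n) B : R := \prod_(i <- r) (B.2 0 i - B.1 0 i).

Definition inbox (lo hi : V) B :=
  forall i, [/\ lo 0 i <= B.1 0 i, B.1 0 i <= B.2 0 i & B.2 0 i <= hi 0 i].

Lemma volr_ge0 (lo hi : V) r B : inbox lo hi B -> 0 <= volr r B.
Proof. by move=> Bb; apply: prodr_ge0 => i _; rewrite subr_ge0; case: (Bb i). Qed.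

(** Integrate the total weight above a point over [a, b]. *)
Lemma weighted_intervals (T : eqType) (s : seq T) (u v w : T -> R) (a b W : R) :
  a <= b -> 0 <= W -> (forall j, j \in s -> [/\ a <= u j, u j <= v j, v j <= b & 0 <= w j]) ->
  (forall t, a <= t <= b -> \sum_(j <- s | u j < t < v j) w j <= W) ->
  \sum_(j <- s) w j * (v j - u j) <= W * (b - a).
Proof.
move=> ab W0 h hW; pose mu := @lebesgue_measure R.
(* weights are made nonnegative off s to apply the integral of a sum *)
pose w' j := Num.max 0 (w j); have w'0 j : 0 <= w' j by rewrite le_max lexx.
have w'E j : j \in s -> w' j = w j by move=> /h[_ _ _ ?]; rewrite /w' max_r.
pose f j (t : R) : \bar R := ((w' j)%:E * (\1_(`]u j, v j[%classic) t)%:E)%E.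
have mf j : measurable_fun `[a, b]%classic (EFin \o (\1_(`]u j, v j[%classic) : R -> R)).
  apply/measurable_EFinP; apply: measurable_funTS; exact: measurable_indic.
have If j : j \in s -> (\int[mu]_(t in `[a, b]) f j t = (w j * (v j - u j))%:E)%E.
  move=> js; have [auj uvj vbj w0] := h j js; rewrite -(w'E j js).
  rewrite ge0_integralZl_EFin//; last exact: (mf j).
  rewrite integral_indic// EFinM; congr (_ * _)%E.
  have -> : `]u j, v j[%classic `&` `[a, b]%classic = `]u j, v j[%classic.
    by apply/setIidl => t /=; rewrite !in_itv /= => ?; lra.
  transitivity (mu `]u j, v j[%classic) => //.
  rewrite /mu lebesgue_measure_itv /= lte_fin; case: ltP => // vu.
  by have -> : v j = u j; [lra|rewrite subrr].
rewrite -lee_fin -sumEFin (eq_big_seq (fun j => \int[mu]_(t in `[a, b]) f j t)%E); last first.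
  by move=> j js; rewrite If.
have f0 j t : (0 <= f j t)%E by rewrite /f -EFinM lee_fin mulr_ge0.
have mfj j : measurable_fun `[a, b]%classic (f j).
  by apply: measurable_funeM; exact: mf.
rewrite -ge0_integral_sum//.
apply: (@le_trans _ _ (\int[mu]_(t in `[a, b]) (cst W%:E t))%E).
  apply: ge0_le_integral => //.
  - by move=> t _; exact: sume_ge0.
  - exact: emeasurable_sum.
  move=> t /=; rewrite in_itv /= => tab.
  rewrite (eq_big_seq (fun j => (if u j < t < v j then w j else 0)%:E)); last first.
    move=> j js; rewrite /f (w'E j js) indicE.
    have -> : (t \in `]u j, v j[%classic) = (u j < t < v j).
      by apply/idP/idP; rewrite inE /= in_itv.
    by case: ifP; rewrite ?mule1 ?mule0.
  by rewrite sumEFin lee_fin -big_mkcond; exact: hW.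
rewrite integral_cst// (_ : _ `[a, b]%classic = mu `[a, b]%classic)//.
rewrite /mu lebesgue_measure_itv /= lte_fin; case: ltP => [_|ba].
  by rewrite -EFinB -EFinM.
by have -> : b = a; [lra|rewrite mule0 subrr mulr0].
Qed.

Lemma packr r s (lo hi : V) : (forall i, lo 0 i <= hi 0 i) -> pairwise (sepr r) s ->
  (forall B, B \in s -> inbox lo hi B) -> \sum_(B <- s) volr r B <= volr r (lo, hi).
Proof.
move=> lh; elim: r s => [|i r ih] s ps hs.
  have -> : volr [::] (lo, hi) = 1 by rewrite /volr big_nil.
  case: s ps hs => [|B [|B' s]] //= _ _; first by rewrite big_nil.
  by rewrite big_cons big_nil /volr big_nil addr0.
rewrite /volr big_cons -/(volr r (lo, hi)) mulrC.
rewrite (eq_bigr (fun B => volr r B * (B.2 0 i - B.1 0 i))); last first.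
  by move=> B _; rewrite /volr big_cons mulrC.
apply: weighted_intervals => //.
- by apply: (@volr_ge0 lo hi) => k; split=> //=.
- by move=> B Bs; have [? ? ?] := hs B Bs i; split=> //; exact: volr_ge0 (hs B Bs).
move=> t tb; rewrite -big_filter; apply: ih.
  set s' := [seq B <- s | _].
  have : pairwise (sepr (i :: r)) s' by apply: subseq_pairwise ps; exact: filter_subseq.
  have : all (fun B : V * V => B.1 0 i < t < B.2 0 i) s' by exact: filter_all.
  elim: s' => //= B s' IH /andP[Bt s't] /andP[hB hs'].
  rewrite IH// andbT; apply/allP => B' B's; have /allP/(_ _ B's) := hB.
  have /allP/(_ _ B's) B't := s't; rewrite /sepr /=.
  by case/orP=> // /orP[]; lra.
by move=> B; rewrite mem_filter => /andP[_]; exact: hs.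
Qed.

Definition vol B : R := \prod_i (B.2 0 i - B.1 0 i).

Definition bsep B B' : bool :=
  [exists i, (B.2 0 i <= B'.1 0 i) || (B'.2 0 i <= B.1 0 i)].

(** By induction on the coordinates: the boxes above a value of the first one are
    separated by the others. *)
Lemma packing s (lo hi : V) : (forall i, lo 0 i <= hi 0 i) -> pairwise bsep s ->
  (forall B, B \in s -> inbox lo hi B) -> \sum_(B <- s) vol B <= vol (lo, hi).
Proof.
move=> lh ps hs; apply: packr => //; apply: sub_pairwise ps => B B' /existsP[i hi'].
by apply/hasP; exists i; rewrite ?mem_index_enum.
Qed.

Lemma bsepPn B B' : (forall i, B.1 0 i < B.2 0 i) -> (forall i, B'.1 0 i < B'.2 0 i) ->
  ~~ bsep B B' -> exists lo hi : V, [/\ forall i, lo 0 i < hi 0 i,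
    forall i, B.1 0 i <= lo 0 i /\ hi 0 i <= B.2 0 i &
    forall i, B'.1 0 i <= lo 0 i /\ hi 0 i <= B'.2 0 i].
Proof.
move=> hB hB' /existsPn nB.
exists (\row_i Num.max (B.1 0 i) (B'.1 0 i)), (\row_i Num.min (B.2 0 i) (B'.2 0 i)).
split=> i; rewrite !mxE; last 2 first.
- by rewrite le_max ge_min !lexx.
- by rewrite le_max ge_min !lexx !orbT.
have := nB i; rewrite negb_or -!ltNge => /andP[h1 h2].
by rewrite gt_max !lt_min hB hB' h1 h2.
Qed.

End Packing.

Section Compactness.
Variables (R : realType) (m : nat) (Q : slits R m).
Local Notation V := 'rV[R]_m.+2.
Local Notation I := (open_box (low Q) (high Q)).
Local Notation X := (slit_space I (sset Q)).
Local Notation tau := (@tau R m Q).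
Implicit Types (x y z w : V) (N j : nat) (e r : R) (p q : X).

Hypothesis por : porous_slits Q.

Lemma generic_in_box (lo hi : V) : (forall i, lo 0 i < hi 0 i) ->
  exists2 z : V, forall i, lo 0 i < z 0 i < hi 0 i & generic Q (z 0 ord0).
Proof.
move=> lh; have [t tb tg] := interval_avoid (sx Q) (lh ord0).
exists (\row_i if i == ord0 then t else (lo 0 i + hi 0 i) / 2) => [i|].
  by rewrite mxE; case: eqP => [->//|_]; have := lh i; lra.
by rewrite mxE eqxx => j; exact: tg.
Qed.

(** A box that witnesses the lower regularity of the ball of radius r at p. *)
Definition reg_box (c r : R) p (B : V * V) :=
  [/\ forall i, c * r <= B.2 0 i - B.1 0 i,
      inbox (low Q) (high Q) B &
      forall q, (forall i, B.1 0 i < tau q 0 i < B.2 0 i) -> generic Q (tau q 0 ord0) -> d p q < r].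

Lemma reg_boxes : exists2 c, 0 < c & exists2 r0, 0 < r0 &
  forall p r, 0 < r < r0 -> exists B, reg_box c r p B.
Proof.
have [c c0 [r0 r00 h]] := ball_contains_box por; exists c => //; exists r0 => // p r rr.
have [lo [hi [h1 h2 h3]]] := h p r rr; exists (lo, hi); split=> // i.
have [lo1 hi1] := h2 i; split=> //=; rewrite -subr_ge0; apply: le_trans (h1 i).
by case/andP: rr => r0' _; rewrite mulr_ge0 ?ltW.
Qed.

Lemma reg_box_lt c r p B : 0 < c -> 0 < r -> reg_box c r p B -> forall i, B.1 0 i < B.2 0 i.
Proof. by move=> c0 r0 [h _ _] i; rewrite -subr_gt0; apply: lt_le_trans (h i); rewrite mulr_gt0. Qed.

Lemma vol_reg_box c r p B : 0 < c -> 0 < r -> reg_box c r p B -> (c * r) ^+ m.+2 <= vol B.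
Proof.
move=> c0 r0 [h _ _]; have cr : 0 <= c * r by rewrite mulr_ge0 ?ltW.
have -> : (c * r) ^+ m.+2 = \prod_(i < m.+2) (c * r) by rewrite prodr_const card_ord.
rewrite /vol; apply: ler_prod => i _.
by rewrite cr h.
Qed.

Lemma reg_box_point c r p (lo hi : V) B : reg_box c r p B -> (forall i, lo 0 i < hi 0 i) ->
  (forall i, B.1 0 i <= lo 0 i /\ hi 0 i <= B.2 0 i) ->
  exists q, [/\ forall i, lo 0 i < tau q 0 i < hi 0 i, generic Q (tau q 0 ord0) & d p q < r].
Proof.
move=> [h1 h2 h3] lh sub; have [z zb zg] := generic_in_box lh.
have zc : cbox Q z.
  by move=> i; have := zb i; have [? ?] := sub i; have [? ? ?] := h2 i; lra.
have [q qz] := point_over zc (generic_off zg).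
exists q; rewrite qz; split=> //; apply: h3; rewrite qz// => i.
by have := zb i; have [? ?] := sub i; lra.
Qed.

(** A common point would be the image of a point of both balls. *)
Lemma reg_box_sep c r p B r' p' B' : 0 < c -> 0 < r -> 0 < r' ->
  reg_box c r p B -> reg_box c r' p' B' -> r + r' <= d p p' -> bsep B B'.
Proof.
move=> c0 r0 r'0 hB hB' pp'; apply: contraT => nB.
have [lo [hi [lh sB sB']]] := bsepPn (reg_box_lt c0 r0 hB) (reg_box_lt c0 r'0 hB') nB.
have [q [qb qg dq]] := reg_box_point hB lh sB.
have dq' : d p' q < r'.
  case: hB' => _ _; apply=> // i; have [? ?] := sB' i; have /andP[? ?] := qb i.
  by apply/andP; split; lra.
have := d_triangle q p p'; rewrite (d_sym q p'); lra.
Qed.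

Lemma separated_bound e : 0 < e -> exists M, forall s : seq X,
  pairwise (fun p q => e <= d p q) s -> (size s <= M)%N.
Proof.
move=> e0; have [c c0 [r0 r00 hr]] := reg_boxes.
pose r := Num.min (e / 2) (r0 / 2); have rr : 0 < r < r0.
  rewrite lt_min gt_min !divr_gt0//=; apply/orP; right.
  by rewrite ltr_pdivrMr// mulr_natr mulr2n ltrDl.
have re2 : r <= e / 2 by rewrite ge_min lexx.
have re : r + r <= e by lra.
have r00' : 0 < r by case/andP: rr.
have [B hB] := choice (fun p => hr p r rr).
have cr : 0 < (c * r) ^+ m.+2 by rewrite exprn_gt0// mulr_gt0.
have [M hM] : exists M : nat, vol (low Q, high Q) < M%:R * (c * r) ^+ m.+2.
  exists (Num.truncn (vol (low Q, high Q) / (c * r) ^+ m.+2)).+1.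
  by rewrite -ltr_pdivrMr// truncnS_gt.
exists M => s ps; have : \sum_(C <- map B s) vol C <= vol (low Q, high Q).
  apply: packing => [i||C /mapP[p _ ->]]; first exact/ltW/low_lt_high.
    rewrite pairwise_map; apply: sub_pairwise ps => p q pq.
    exact: reg_box_sep (hB p) (hB q) (le_trans re pq).
  by case: (hB p).
rewrite big_map => sM; rewrite -(ler_nat R) -(ler_pM2r cr) ltW//.
apply: le_lt_trans hM; apply: le_trans sM.
rewrite mulr_natl -sum1_size -sumrMnr; apply: ler_sum => p _.
by rewrite mulr1n; exact: vol_reg_box (hB p).
Qed.

(** Packing the boxes of small separated balls bounds their number; so the space is
    totally bounded, and it is complete. *)
Lemma d_compact (P : nat -> X) :
  exists p, forall e (K : nat), 0 < e -> exists2 k, (K <= k)%N & d (P k) p < e.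
Proof.
have [U [UU ooU]] := ultraFilterLemma (_ : ProperFilter \oo).
have near e : 0 < e -> exists q, U [set k | d (P k) q < e].
  move=> e0; apply: contrapT => none.
  have far q : U [set k | e <= d (P k) q].
    have [//|] := in_ultra_setVsetC [set k | d (P k) q < e] UU.
      by move=> h; exfalso; apply: none; exists q.
    by apply: filterS => k /= /negP; rewrite -leNgt.
  have [M hM] := separated_bound e0.
  have [s ps sM] : exists2 s : seq X, pairwise (fun p q => e <= d p q) s & size s = M.+1.
    elim: M.+1 => [|L [s ps sL]]; first by exists [::].
    have : U [set k | all (fun q => e <= d (P k) q) s].
      elim: s {ps sL} => [|q s ihs]; first exact: filterS filterT.
      by apply: filterS2 (far q) ihs => k /= -> ->.
    by move=> /filter_ex[k hk]; exists (P k :: s); rewrite /= ?hk ?ps ?sL.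
  by have := hM s ps; rewrite sM ltnn.
have [iv iv0 small] := vanishing_seq R.
have [c hc] := choice (fun k => near (iv k) (iv0 k)).
have [e e0|p hp] := @d_complete R m Q c.
  have e2 : 0 < e / 2 by rewrite divr_gt0.
  have [K hK] := small _ e2; exists K => k l /hK /= ke /hK /= le.
  have [j [/= h1 h2]] := filter_ex (filterI (hc k) (hc l)).
  by have := d_triangle (P j) (c k) (c l); rewrite (d_sym (c k) (P j)); lra.
exists p => e K e0; have e2 : 0 < e / 2 by rewrite divr_gt0.
have [k [/= h1 h2]] := evt_ex (evt_and (small _ e2) (hp _ e2)).
have KU : U [set j | (K <= j)%N] by apply: ooU; exact: nbhs_infty_ge.
have [j [/= h3 h4]] := filter_ex (filterI (hc k) KU).
by exists j => //; have := d_triangle (c k) (P j) p; lra.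
Qed.

(** By compactness, since the projection is one-to-one off the slits. *)
Lemma tau_inv_cont p e : offslits Q (tau p) -> 0 < e ->
  exists2 r, 0 < r & forall q, (forall i, `|tau q 0 i - tau p 0 i| < r) -> d q p < e.
Proof.
move=> off e0; apply: contrapT => none; have [iv iv0 small] := vanishing_seq R.
have bad k : exists q, (forall i, `|tau q 0 i - tau p 0 i| < iv k) /\ e <= d q p.
  apply: contrapT => h; apply: none; exists (iv k) => // q qp.
  by rewrite ltNge; apply/negP => eq; apply: h; exists q.
have [P hP] := choice bad; have [p' hp'] := d_compact P.
have pp' : tau p' = tau p.
  apply/rowP => i; apply/eqP; rewrite -subr_eq0 -normr_le0.
  apply/ler_addgt0Pl => r r0; rewrite addr0; have r2 : 0 < r / 2 by rewrite divr_gt0.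
  have [K hK] := small _ r2; have [k /hK /= kr dk] := hp' _ K r2.
  have := tau_lipschitz (P k) p' i; have := (hP k).1 i; rewrite ler_norml !ltr_norml.
  by rewrite ler_norml; lra.
have p'p : p' = p by apply: fiber_unique => //; rewrite pp'.
have [k _ dk] := hp' _ 0%N e0; have := (hP k).2.
by rewrite -p'p leNgt dk.
Qed.

End Compactness.

(** * Filling the box by thin neighbourhoods of slits *)
Section Fill.
Variables (R : realType) (m : nat) (Q : slits R m).
Local Notation V := 'rV[R]_m.+2.
Local Notation I := (open_box (low Q) (high Q)).
Local Notation X := (slit_space I (sset Q)).
Local Notation tau := (@tau R m Q).
Implicit Types (x y z w : V) (N j : nat) (e r : R) (p q : X).

Hypothesis por : porous_slits Q.

(** The j-th slit thickened in the first direction by a small multiple of its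
    length. *)
Definition thin (kappa : R) j : V * V :=
  (\row_i if i == ord0 then sx Q j - kappa * sl Q j else sc Q j 0 i,
   \row_i if i == ord0 then sx Q j + kappa * sl Q j else sc Q j 0 i + sl Q j).

Variable kappa : R.
Hypothesis kappa01 : 0 < kappa <= 8^-1.

Local Notation th := (thin kappa).

Lemma thin_lt j i : (th j).1 0 i < (th j).2 0 i.
Proof.
have l0 := sl_gt0 Q j; have k0 : 0 < kappa * sl Q j.
  by rewrite mulr_gt0//; case/andP: kappa01.
by rewrite !mxE; case: eqP => _; lra.
Qed.

Lemma vol_thin j : vol (th j) = 2 * kappa * sl Q j ^+ m.+2.
Proof.
rewrite /vol big_ord_recl !mxE eqxx.
rewrite (eq_bigr (fun=> sl Q j)) => [|i _]; last by rewrite !mxE /=; ring.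
by rewrite prodr_const card_ord [in RHS]exprS; move: (_ ^+ m.+1) => q; ring.
Qed.

Definition fill (D : V * V) (w : R) := exists L : seq nat,
  [/\ pairwise (@bsep R m.+2) (map th L),
      forall j, j \in L -> inbox D.1 D.2 (th j) & w <= \sum_(j <- L) vol (th j)].

Lemma vol_cut (lo hi : V) i v :
  vol (lo, upd hi i v) + vol (upd lo i v, hi) = vol (lo, hi).
Proof.
rewrite /vol /= (bigD1 i)//= [X in _ + X](bigD1 i)//= [RHS](bigD1 i)//= !updE eqxx.
rewrite (eq_bigr (fun k => hi 0 k - lo 0 k)) => [|k /negbTE ki]; last by rewrite updE ki.
rewrite [X in _ + _ * X](eq_bigr (fun k => hi 0 k - lo 0 k)) => [|k /negbTE ki]; last by rewrite updE ki.
by rewrite -mulrDl; congr (_ * _); ring.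
Qed.

Lemma fill_cut (lo hi : V) i (v w1 w2 : R) : lo 0 i <= v <= hi 0 i ->
  fill (lo, upd hi i v) w1 -> fill (upd lo i v, hi) w2 -> fill (lo, hi) (w1 + w2).
Proof.
move=> /andP[lv vh] [L1 [p1 b1 v1]] [L2 [p2 b2 v2]]; exists (L1 ++ L2); split.
- rewrite map_cat pairwise_cat p1 p2 !andbT; apply/allrelP => B B' /mapP[j jL ->] /mapP[k kL ->].
  apply/existsP; exists i; apply/orP; left.
  have [_ _] := b1 j jL i; have [+ _ _] := b2 k kL i.
  by rewrite /= !updE eqxx => h1 h2; exact: le_trans h2 h1.
- move=> j; rewrite mem_cat => /orP[/b1|/b2] h k; have [] := h k; rewrite /= updE;
    case: eqP => [->|_] ? ? ?; split=> //.
    exact: le_trans vh.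
  exact: le_trans lv _.
- by rewrite big_cat /= lerD.
Qed.

Lemma fill_le D (w w' : R) : w' <= w -> fill D w -> fill D w'.
Proof. by move=> ww' [L [h1 h2 h3]]; exists L; split=> //; exact: le_trans h3. Qed.

(** Cut off pieces of length h, one direction after the other. *)
Lemma fill_subdivide (a h : R) : 0 < h ->
  (forall lo hi : V, inbox (low Q) (high Q) (lo, hi) ->
    (forall i, h <= hi 0 i - lo 0 i <= 2 * h) -> fill (lo, hi) (a * vol (lo, hi))) ->
  forall lo hi : V, inbox (low Q) (high Q) (lo, hi) ->
    (forall i, h <= hi 0 i - lo 0 i) -> fill (lo, hi) (a * vol (lo, hi)).
Proof.
move=> h0 cube.
suff sub (r : seq 'I_m.+2) : forall lo hi : V, inbox (low Q) (high Q) (lo, hi) ->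
    (forall i, h <= hi 0 i - lo 0 i) -> (forall i, i \notin r -> hi 0 i - lo 0 i <= 2 * h) ->
    fill (lo, hi) (a * vol (lo, hi)).
  by move=> lo hi lhb lhh; apply: (sub (enum 'I_m.+2)) => // i; rewrite mem_enum.
elim: r => [|i r ih] lo hi lhb lhh small.
  by apply: cube => // i; rewrite lhh small.
have [k hk] : exists k : nat, hi 0 i - lo 0 i <= k.+2%:R * h.
  exists (Num.truncn ((hi 0 i - lo 0 i) / h)); rewrite -ler_pdivrMr//.
  by apply/ltW/(lt_trans (truncnS_gt _)); rewrite ltr_nat.
elim: k lo lhb lhh small hk => [|k ihk] lo lhb lhh small hk.
  by apply: ih => // l lr; have [->//|li] := eqVneq l i; apply: small; rewrite inE negb_or li.
have [sm|lg] := leP (hi 0 i - lo 0 i) (2 * h).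
  by apply: ih => // l lr; have [->//|li] := eqVneq l i; apply: small; rewrite inE negb_or li.
have [b1 b2 b3] := lhb i; rewrite /= in b1 b2 b3.
have -> : a * vol (lo, hi) = a * vol (lo, upd hi i (lo 0 i + h)) +
    a * vol (upd lo i (lo 0 i + h), hi) by rewrite -mulrDr vol_cut.
have cutb : lo 0 i <= lo 0 i + h <= hi 0 i by apply/andP; split; lra.
apply: (fill_cut cutb).
  apply: ih => [l|l|l lr].
  - by have := lhb l; rewrite /= updE; case: eqP => [->|//] _; split; lra.
  - by rewrite updE; case: eqP => [->|_//]; lra.
  - by rewrite updE; case: eqP => [->|/eqP li]; [lra|apply: small; rewrite inE negb_or li].
apply: ihk => [l|l|l lr|].
- by have := lhb l; rewrite /= updE; case: eqP => [->|//] _; split; lra.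
- by rewrite updE; case: eqP => [->|_//]; lra.
- by rewrite updE; case: eqP => [li|_]; [move: lr; rewrite li inE eqxx|exact: small].
- by rewrite updE eqxx; move: hk; rewrite -[k.+3%:R]natr1 mulrDl mul1r; lra.
Qed.

(** The rest of a box around a thin box is cut into boxes by the hyperplanes of its
    faces, taken in turn. *)
Lemma fill_around (a : R) j :
  (forall lo hi : V, inbox (low Q) (high Q) (lo, hi) -> fill (lo, hi) (a * vol (lo, hi))) ->
  forall lo hi : V, inbox (low Q) (high Q) (lo, hi) -> inbox lo hi (th j) ->
    fill (lo, hi) (vol (th j) + a * (vol (lo, hi) - vol (th j))).
Proof.
move=> rest.
suff sub (r : seq 'I_m.+2) : forall lo hi : V, inbox (low Q) (high Q) (lo, hi) ->
    inbox lo hi (th j) ->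
    (forall i, i \notin r -> lo 0 i = (th j).1 0 i /\ hi 0 i = (th j).2 0 i) ->
    fill (lo, hi) (vol (th j) + a * (vol (lo, hi) - vol (th j))).
  by move=> lo hi lhb jb; apply: (sub (enum 'I_m.+2)) => // i; rewrite mem_enum.
elim: r => [|i r ih] lo hi lhb jb same.
  have -> : (lo, hi) = th j.
    rewrite [th j]surjective_pairing; congr (_, _); apply/rowP => i; by have [] := same i isT.
  rewrite subrr mulr0 addr0; exists [:: j]; split=> //=.
  - by move=> k; rewrite inE => /eqP -> l; split=> //; exact/ltW/thin_lt.
  - by rewrite big_cons big_nil addr0.
have [b1 b2 b3] := lhb i; have [c1 c2 c3] := jb i; rewrite /= in b1 b2 b3.
set v1 := (th j).1 0 i in c1 c2; set v2 := (th j).2 0 i in c2 c3.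
have lt12 : v1 < v2 by exact: thin_lt.
have e1 := vol_cut lo hi i v1; have e2 := vol_cut (upd lo i v1) hi i v2.
have uu (z : V) (s t : R) : upd (upd z i s) i t = upd z i t.
  by apply/rowP => k; rewrite !updE; case: eqP.
rewrite uu in e2.
have -> : vol (th j) + a * (vol (lo, hi) - vol (th j)) = a * vol (lo, upd hi i v1) +
    ((vol (th j) + a * (vol (upd lo i v1, upd hi i v2) - vol (th j))) + a * vol (upd lo i v2, hi)).
  by rewrite -e1 -e2; ring.
apply: (@fill_cut _ _ i v1); first by lra.
  by apply: rest => k; have := lhb k; rewrite /= updE; case: eqP => [->|//] _; split; lra.
apply: (@fill_cut _ _ i v2); first by rewrite updE eqxx; lra.
  apply: ih => [k|k|k kr].
  - by have := lhb k; rewrite /= !updE; case: eqP => [->|//] _; split; lra.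
  - change [/\ upd lo i v1 0 k <= (th j).1 0 k, (th j).1 0 k <= (th j).2 0 k &
      (th j).2 0 k <= upd hi i v2 0 k].
    rewrite (updE lo) (updE hi); have [->|ki] := eqVneq k i; last exact: (jb k).
    by split; [exact: lexx|exact: (ltW lt12)|exact: lexx].
  - rewrite (updE lo) (updE hi); have [->//|ki] := eqVneq k i.
    by apply: same; rewrite inE negb_or ki.
rewrite uu; apply: rest => k; have := lhb k; rewrite /= updE; case: eqP => [->|//] _; split; lra.
Qed.

(** Porosity at a generic point over the middle of the box. *)
Lemma thin_in_cube : exists2 c, 0 < c <= 1 & exists2 h0, 0 < h0 &
  forall h (lo hi : V), 0 < h < h0 -> inbox (low Q) (high Q) (lo, hi) ->
    (forall i, h <= hi 0 i - lo 0 i <= 2 * h) ->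
    exists2 j, inbox lo hi (th j) & c * vol (lo, hi) <= vol (th j).
Proof.
have [A A0 [r1 r10 hA]] := porous_slit por; have /andP[k0 k8] := kappa01.
pose c := 2 * kappa / (16 * A) ^+ m.+2.
have c0 : 0 < c by apply: divr_gt0; [apply: mulr_gt0|apply/exprn_gt0/mulr_gt0].
exists (Num.min c 1); first by rewrite lt_min c0 ltr01 ge_min lexx orbT.
exists (8 * r1) => [|h lo hi /andP[h0 h1] lhb sides]; first by rewrite mulr_gt0.
have [|z zb zg] := @generic_in_box R m Q
    (\row_i ((lo 0 i + hi 0 i) / 2 - h / 8)) (\row_i ((lo 0 i + hi 0 i) / 2 + h / 8)).
  by move=> i; rewrite !mxE; lra.
have zc : cbox Q z.
  move=> i; have := zb i; have := sides i; have [] := lhb i; rewrite /= !mxE; lra.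
have [p pz] := point_over zc (generic_off zg).
have [|j [jp jA]] := hA p (h / 8); first by lra.
have l0 := sl_gt0 Q j.
have near w : sset Q j w -> forall i, `|z 0 i - w 0 i| < h / 8.
  move=> jw i; have [q qw] := point_over_slit jw.
  have := tau_lipschitz p q i; rewrite pz qw => /le_lt_trans; apply.
  by apply: jp; rewrite qw.
have corner t : 0 <= t <= 1 -> sset Q j (\row_i if i == ord0 then sx Q j else sc Q j 0 i + t * sl Q j).
  move=> t01; rewrite ssetE => i /=; rewrite mxE; case: eqP => // _.
  have h1' : 0 <= t * sl Q j by apply: mulr_ge0; lra.
  have h2' : 0 <= (1 - t) * sl Q j by apply: mulr_ge0; lra.
  by rewrite mulrBl mul1r in h2'; apply/andP; split; lra.
have n0 : forall i, `|z 0 i - (if i == ord0 then sx Q j else sc Q j 0 i)| < h / 8.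
  move=> i; have := near _ (corner 0 _) i; rewrite mxE mul0r addr0; apply; lra.
have n1 : forall i, `|z 0 i - (if i == ord0 then sx Q j else sc Q j 0 i + sl Q j)| < h / 8.
  move=> i; have := near _ (corner 1 _) i; rewrite mxE mul1r; apply; lra.
have lh : sl Q j < h / 4.
  by have := n0 (i1 m); have := n1 (i1 m); rewrite /= !ltr_norml; lra.
have kl : kappa * sl Q j <= h / 8.
  apply: le_trans (_ : 8^-1 * sl Q j <= _); first by rewrite ler_wpM2r// ltW.
  by move: lh; lra.
have kl0 : 0 < kappa * sl Q j by rewrite mulr_gt0.
exists j.
  move=> i; have := sides i; have := zb i; have := n0 i; have := n1 i; rewrite !mxE.
  by case: eqP => _; rewrite !ltr_norml; split; lra.
have volC : vol (lo, hi) <= (2 * h) ^+ m.+2.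
  have -> : (2 * h) ^+ m.+2 = \prod_(i < m.+2) (2 * h) by rewrite prodr_const card_ord.
  by apply: ler_prod => i _ /=; have := sides i; lra.
apply: le_trans (_ : c * (2 * h) ^+ m.+2 <= _).
  apply: ler_pM => //; last by rewrite ge_min lexx.
    by rewrite le_min ltW// ler01.
  by apply: prodr_ge0 => i _ /=; have := sides i; lra.
rewrite vol_thin /c -mulrA; apply: ler_wpM2l; first by rewrite mulr_ge0// ltW.
rewrite -exprVn -exprMn; apply: lerXn2r; rewrite ?nnegrE.
- by apply: mulr_ge0; [rewrite invr_ge0; apply/ltW/mulr_gt0|apply/ltW/mulr_gt0].
- exact: ltW.
apply: le_trans jA; rewrite le_eqVlt; apply/orP; left; apply/eqP.
by field; rewrite gt_eqF.
Qed.

Lemma vol_box_ge0 (lo hi : V) : inbox (low Q) (high Q) (lo, hi) -> 0 <= vol (lo, hi).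
Proof. by move=> h; apply: prodr_ge0 => i _; rewrite subr_ge0; case: (h i). Qed.

(** The thin box inside each cube of a subdivision covers a definite proportion c,
    so each step multiplies the uncovered proportion by 1 - c. *)
Lemma fill_box (eta : R) : 0 < eta -> forall lo hi : V, inbox (low Q) (high Q) (lo, hi) ->
  fill (lo, hi) ((1 - eta) * vol (lo, hi)).
Proof.
have [c c01 [h0 h00 hc]] := thin_in_cube.
have step (a : R) : a <= 1 ->
    (forall lo hi : V, inbox (low Q) (high Q) (lo, hi) -> fill (lo, hi) (a * vol (lo, hi))) ->
    forall lo hi : V, inbox (low Q) (high Q) (lo, hi) ->
      fill (lo, hi) ((1 - (1 - c) * (1 - a)) * vol (lo, hi)).
  move=> a1 rest lo hi lhb.
  have [[i i0]|pos] := pselect (exists i, hi 0 i - lo 0 i <= 0).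
    exists [::]; split=> //; rewrite big_nil /vol (bigD1 i)//=.
    have [_ /= b _] := lhb i; have -> : hi 0 i - lo 0 i = 0 by lra.
    by rewrite mul0r mulr0.
  have [h hh0 hs] : exists2 h, 0 < h < h0 & forall i, h <= hi 0 i - lo 0 i.
    have [h h1 h2] : exists2 h, 0 < h & forall k, (k < m.+2)%N ->
        forall i : 'I_m.+2, i = k :> nat -> h <= hi 0 i - lo 0 i.
      apply: finite_radius => [k e e' le h i ik|k km]; first exact: le_trans le (h i ik).
      exists (hi 0 (Ordinal km) - lo 0 (Ordinal km)).
        by rewrite ltNge; apply/negP => h; apply: pos; exists (Ordinal km).
      by move=> i ik; have -> : i = Ordinal km by exact/val_inj.
    exists (Num.min h (h0 / 2)) => [|i].
      rewrite lt_min gt_min h1 divr_gt0//=; apply/orP; right.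
      by rewrite ltr_pdivrMr// mulr_natr mulr2n ltrDl.
    by apply: le_trans _ (h2 i (ltn_ord i) i erefl); rewrite ge_min lexx.
  have /andP[h1 _] := hh0.
  apply: (fill_subdivide h1) => // lo' hi' lhb' sides.
  have [j jb jv] := hc h lo' hi' hh0 lhb' sides.
  apply: fill_le (fill_around rest lhb' jb).
  have v0 := vol_box_ge0 lhb'.
  have : (1 - a) * (c * vol (lo', hi')) <= (1 - a) * vol (th j).
    by apply: ler_wpM2l => //; lra.
  lra.
have iter (k : nat) : forall lo hi : V, inbox (low Q) (high Q) (lo, hi) ->
    fill (lo, hi) ((1 - (1 - c) ^+ k) * vol (lo, hi)).
  elim: k => [|k ih].
    move=> lo hi lhb; exists [::]; split=> //.
    by rewrite big_nil expr0 subrr mul0r.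
  have k1 : 1 - (1 - c) ^+ k <= 1 by rewrite gerBl exprn_ge0//; lra.
  have := step _ k1 ih; rewrite exprS.
  by rewrite (_ : 1 - (1 - (1 - c) ^+ k) = (1 - c) ^+ k)//; ring.
move=> eta0 lo hi lhb; have [|||k hk] := @geometric_small R (1 - c) 1 eta => //; first lra.
apply: fill_le (iter k lo hi lhb); apply: ler_wpM2r; first exact: vol_box_ge0.
by have := hk k (leqnn k); rewrite mul1r; lra.
Qed.

End Fill.

(** * Functions that jump across slits *)
Section Jump.
Variables (R : realType) (m : nat) (Q : slits R m).
Local Notation V := 'rV[R]_m.+2.
Local Notation ed := (@euclid_dist R m.+2).
Local Notation I := (open_box (low Q) (high Q)).
Local Notation SN := (slit_domain I (sset Q)).
Local Notation X := (slit_space I (sset Q)).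
Local Notation tau := (@tau R m Q).
Implicit Types (x y z w : V) (N j : nat) (e r : R) (p q : X).

Variable kappa : R.
Hypothesis kappa01 : 0 < kappa <= 8^-1.

Local Notation th := (thin Q kappa).

Let kl_bounds j : 0 < kappa * sl Q j <= sl Q j / 8.
Proof.
have l0 := sl_gt0 Q j; case/andP: kappa01 => k0 k8; rewrite mulr_gt0//= mulrC.
by rewrite ler_wpM2l// ltW.
Qed.

(** The distance from the vertical part of z to the outside of the vertical part
    of the j-th slit, cut at the width of the thin box. *)
Definition depth j z : R := \big[Num.min/kappa * sl Q j]_(i | i != ord0)
  Num.min (z 0 i - sc Q j 0 i) (sc Q j 0 i + sl Q j - z 0 i).

Lemma depth_le j z : depth j z <= kappa * sl Q j.
Proof. exact: bigmin_le_id. Qed.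

Lemma depth_le_coord j z i : i != ord0 ->
  depth j z <= z 0 i - sc Q j 0 i /\ depth j z <= sc Q j 0 i + sl Q j - z 0 i.
Proof.
move=> i0; have : depth j z <= Num.min (z 0 i - sc Q j 0 i) (sc Q j 0 i + sl Q j - z 0 i).
  exact: bigmin_le_cond.
by rewrite le_min => /andP[].
Qed.

Lemma depth_ge j z (v : R) : v <= kappa * sl Q j ->
  (forall i, i != ord0 -> v <= z 0 i - sc Q j 0 i /\ v <= sc Q j 0 i + sl Q j - z 0 i) ->
  v <= depth j z.
Proof. by move=> v1 v2; apply: le_bigmin => // i i0; rewrite le_min; apply/andP; exact: v2. Qed.

Lemma depth_lipschitz j z w (r : R) : (forall i, `|z 0 i - w 0 i| <= r) ->
  depth j z - depth j w <= r.
Proof.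
move=> zw; have r0 : 0 <= r by apply: le_trans (zw ord0).
rewrite lerBlDl -lerBlDr; apply: depth_ge; first by have := depth_le j z; lra.
by move=> i i0; have := zw i; have [] := depth_le_coord j z i0; rewrite ler_norml; lra.
Qed.

(** Added to the first coordinate, this makes it constant on either side of the
    slit near the core of its thin box; it vanishes outside the thin box and is
    discontinuous only at the slit. *)
Definition slit_jump j z : R :=
  if sx Q j < z 0 ord0 then Num.max 0 (sx Q j + depth j z - z 0 ord0)
  else Num.min 0 (sx Q j - depth j z - z 0 ord0).

Lemma jump_le j z : `|slit_jump j z| <= kappa * sl Q j.
Proof.
have h1 := depth_le j z; have /andP[h2 h3] := kl_bounds j; rewrite /slit_jump.
case: ltP => sz; case: (lerP 0) => h; rewrite ?normr0 ?(ltW h2)//; rewrite ler_norml; apply/andP; split; lra.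
Qed.

Lemma jump_neq0 j z : slit_jump j z != 0 ->
  sx Q j < z 0 ord0 < sx Q j + depth j z \/ sx Q j - depth j z < z 0 ord0 <= sx Q j.
Proof.
rewrite /slit_jump; case: ltP => sz; case: (lerP 0) => h; rewrite ?eqxx// => h0; [left|right].
  by move: h; rewrite le_eqVlt eq_sym (negbTE h0) /= => h; lra.
by rewrite andbT; lra.
Qed.

Lemma jump_supp j z : slit_jump j z != 0 -> forall i, (th j).1 0 i < z 0 i < (th j).2 0 i.
Proof.
have := depth_le j z => dz /jump_neq0 jz i; rewrite !mxE.
have [i0|i0] := eqVneq i ord0; first by rewrite i0; case: jz => /andP[h1 h2]; have := kl_bounds j; lra.
have [h1 h2] := depth_le_coord j z i0; have : 0 < depth j z by case: jz => /andP[]; lra.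
by lra.
Qed.

Lemma jump_local j z : ~ sset Q j z -> exists2 e, 0 < e & forall w w' : V,
  (forall i, `|w 0 i - z 0 i| < e) -> (forall i, `|w' 0 i - z 0 i| < e) ->
  `|slit_jump j w - slit_jump j w'| <= 2 * ed w w'.
Proof.
move=> zs.
have lip (w w' : V) (b : bool) : `|(if b then Num.max 0 (sx Q j + depth j w - w 0 ord0)
      else Num.min 0 (sx Q j - depth j w - w 0 ord0)) -
     (if b then Num.max 0 (sx Q j + depth j w' - w' 0 ord0)
      else Num.min 0 (sx Q j - depth j w' - w' 0 ord0))| <= 2 * ed w w'.
  have h1 : depth j w - depth j w' <= ed w w'.
    by apply: depth_lipschitz => i; exact: coord_le_ed.
  have h2 : depth j w' - depth j w <= ed w w'.
    by rewrite ed_sym; apply: depth_lipschitz => i; exact: coord_le_ed.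
  have := coord_le_ed w w' ord0; rewrite !ler_norml => h3.
  move: (ed w w') (depth j w) (depth j w') (w 0 ord0) (w' 0 ord0) h1 h2 h3.
  move=> E a b' c c' h1 h2 /andP[h3 h4].
  by case: b; case: (lerP 0) => h5; case: (lerP 0) => h6; apply/andP; split; lra.
have [z0|z0] := eqVneq (z 0 ord0) (sx Q j); last first.
  exists `|z 0 ord0 - sx Q j|; first by rewrite normr_gt0 subr_eq0.
  move=> w w' wz w'z; have := lip w w' (sx Q j < z 0 ord0).
  suff side (v : V) : (forall i, `|v 0 i - z 0 i| < `|z 0 ord0 - sx Q j|) ->
      (sx Q j < v 0 ord0) = (sx Q j < z 0 ord0) by rewrite /slit_jump !side.
  move/(_ ord0); case: (ltrgtP (sx Q j) (z 0 ord0)) z0 => // h _.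
  - by rewrite ltr_norml => ?; lra.
  - by rewrite ltr_norml => ?; apply/negbTE; rewrite -leNgt; lra.
have [i [i0 zi]] : exists i, i != ord0 /\
    (z 0 i - sc Q j 0 i < 0 \/ sc Q j 0 i + sl Q j - z 0 i < 0).
  apply: contrapT => none; apply: zs; rewrite ssetE => i /=; case: eqP => [->//|/eqP i0].
  apply/andP; split; rewrite leNgt; apply/negP => h; apply: none; exists i; split=> //.
    by left; lra.
  by right; lra.
have [e e0 ez] : exists2 e, 0 < e & z 0 i - sc Q j 0 i <= - e \/ sc Q j 0 i + sl Q j - z 0 i <= - e.
  case: zi => h; [exists (sc Q j 0 i - z 0 i)|exists (z 0 i - sc Q j 0 i - sl Q j)]; lra.
exists e => // w w' wz w'z.
suff zero (v : V) : (forall i, `|v 0 i - z 0 i| < e) -> slit_jump j v = 0.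
  by rewrite !zero// subrr normr0 mulr_ge0// ed_ge0.
move/(_ i); rewrite ltr_norml => vz; have [h1 h2] := depth_le_coord j v i0.
have : depth j v < 0 by lra.
rewrite /slit_jump => dv; case: ltP => sv; case: (lerP 0) => //; lra.
Qed.

(** The part of the thin box where the depth is maximal, with some room; it takes
    up most of the thin box. *)
Definition core j : V * V :=
  (\row_i if i == ord0 then sx Q j - kappa * sl Q j * (1 - kappa)
          else sc Q j 0 i + 2 * (kappa * sl Q j),
   \row_i if i == ord0 then sx Q j + kappa * sl Q j * (1 - kappa)
          else sc Q j 0 i + sl Q j - 2 * (kappa * sl Q j)).

Lemma core_sub (lo hi : V) j : inbox lo hi (th j) -> inbox lo hi (core j).
Proof.
move=> h i; have := kl_bounds j; have [] := h i; have := sl_gt0 Q j.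
have [k0 k8] := andP kappa01; rewrite !mxE; case: eqP => _ l0 h1 h2 h3 /andP[h4 h5].
  have h6 : 0 <= kappa * sl Q j * kappa by apply/ltW/mulr_gt0.
  have h7 : kappa * sl Q j * kappa <= kappa * sl Q j * 1 by apply: ler_wpM2l; lra.
  by rewrite mulrBr mulr1 in h7 *; split; lra.
by split; lra.
Qed.

Lemma core_bsep j k : bsep (th j) (th k) -> bsep (core j) (core k).
Proof.
have bd i : inbox (th i).1 (th i).2 (core i).
  by apply: core_sub => l; rewrite !lexx; split=> //; exact/ltW/thin_lt.
move=> /existsP[i h]; apply/existsP; exists i.
have [h1 h2 h3] := bd j i; have [h4 h5 h6] := bd k i.
by case/orP: h => h; apply/orP; [left|right]; lra.
Qed.

Lemma vol_core j : (1 - 4 * m.+2%:R * kappa) * vol (th j) <= vol (core j).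
Proof.
have l0 := sl_gt0 Q j; have [k0 k8] := andP kappa01.
have t0 i : 0 <= (th j).2 0 i - (th j).1 0 i by rewrite subr_ge0 ltW// thin_lt.
have side i : (1 - 4 * kappa) * ((th j).2 0 i - (th j).1 0 i) <= (core j).2 0 i - (core j).1 0 i.
  rewrite !mxE; case: eqP => _.
    have h6 : 0 <= kappa * sl Q j * kappa by apply/ltW/mulr_gt0/k0/mulr_gt0.
    lra.
  have h6 : 0 <= kappa * sl Q j by apply/ltW/mulr_gt0.
  lra.
apply: le_trans (_ : \prod_(i < m.+2) ((1 - 4 * kappa) * ((th j).2 0 i - (th j).1 0 i)) <= _); last first.
  by apply: ler_prod => i _; rewrite side andbT mulr_ge0//; lra.
rewrite big_split /= prodr_const card_ord; apply: ler_wpM2r; first exact: prodr_ge0.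
elim: m.+2 => [|k ih]; first by rewrite mulr0 mul0r subr0 expr0.
rewrite exprS; apply: le_trans (_ : (1 - 4 * kappa) * (1 - 4 * k%:R * kappa) <= _); last first.
  by apply: ler_wpM2l => //; lra.
have : 0 <= k%:R * (kappa * kappa) by rewrite mulr_ge0// mulr_ge0// ltW.
rewrite -natr1; lra.
Qed.

End Jump.

Section JumpFunction.
Variables (R : realType) (m : nat) (Q : slits R m).
Local Notation V := 'rV[R]_m.+2.
Local Notation ed := (@euclid_dist R m.+2).
Local Notation I := (open_box (low Q) (high Q)).
Local Notation SN := (slit_domain I (sset Q)).
Local Notation X := (slit_space I (sset Q)).
Local Notation tau := (@tau R m Q).
Local Notation d := (@d R m Q).
Implicit Types (x y z w : V) (j : nat) (e r : R) (p q : X).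

Section Jumps.
Variable kappa : R.
Hypothesis kappa01 : 0 < kappa <= 8^-1.

Local Notation th := (thin Q kappa).
Local Notation jump := (slit_jump Q kappa).
Local Notation core := (core Q kappa).

Variable L : seq nat.
Hypothesis sepL : pairwise (@bsep R m.+2) (map th L).
Variable N : nat.
Hypothesis ltN : forall j, j \in L -> (j < N)%N.

(** Disjoint thin boxes have disjoint supports. *)
Lemma jump_sum (s : seq nat) z : pairwise (@bsep R m.+2) (map th s) ->
  (forall k, k \in s -> jump k z = 0) /\ \sum_(k <- s) jump k z = 0 \/
  exists j, [/\ j \in s, \sum_(k <- s) jump k z = jump j z &
    forall k, k \in s -> k != j -> jump k z = 0].
Proof.
elim: s => [|j s ih] /=; first by left; rewrite big_nil.
move=> /andP[sepj /ih{}ih]; rewrite big_cons.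
have [j0|j0] := eqVneq (jump j z) 0.
  rewrite j0 add0r; case: ih => [[h1 h2]|[k [h1 h2 h3]]]; [left|right].
    by split=> // k; rewrite inE => /orP[/eqP ->|/h1].
  exists k; split=> [||l]; rewrite ?inE ?h1 ?orbT//.
  by move=> /orP[/eqP ->//|/h3].
have none k : k \in s -> jump k z = 0.
  move=> ks; apply/eqP; apply: contraT => k0.
  have /allP/(_ (th k) (map_f _ ks))/existsP[i] := sepj.
  have := jump_supp kappa01 j0 i; have := jump_supp kappa01 k0 i.
  by move=> /andP[h1 h2] /andP[h3 h4] /orP[]; lra.
right; exists j; split=> [||k]; first by rewrite inE eqxx.
  by rewrite big_seq big1 ?addr0.
by rewrite inE => /orP[/eqP ->|ks _]; [rewrite eqxx|exact: none].
Qed.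

Let u z : R := z 0 ord0 + \sum_(j <- L) jump j z.

Lemma jumps_close z : `|u z - z 0 ord0| <= kappa * boxsize Q.
Proof.
rewrite /u addrAC subrr add0r; have /andP[k0 _] := kappa01.
case: (jump_sum z sepL) => [[_ ->]|[j [jL -> _]]].
  by rewrite normr0 mulr_ge0 ?ltW// boxsize_gt0.
apply: le_trans (jump_le Q kappa01 j z) _; apply: ler_wpM2l; first exact: ltW.
have := corner_bounds Q j (i1 m); rewrite /=; have := side_le_boxsize Q (i1 m); lra.
Qed.

(** Each jump is 2-Lipschitz near a point off its slit, and at most two of them
    count for two points; with the first coordinate itself this adds up to 5. *)
Lemma jumps_local z : SN N z -> exists2 e, 0 < e & forall w w' : V,
  (forall i, `|w 0 i - z 0 i| < e) -> (forall i, `|w' 0 i - z 0 i| < e) ->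
  `|u w - u w'| <= 5 * ed w w'.
Proof.
move=> /SNP[_ off].
have [e e0 eP] : exists2 e, 0 < e & forall j, (j < N)%N -> forall w w' : V,
    (forall i, `|w 0 i - z 0 i| < e) -> (forall i, `|w' 0 i - z 0 i| < e) ->
    `|jump j w - jump j w'| <= 2 * ed w w'.
  apply: finite_radius => [j e e' le h w w' wz w'z|j jN].
    by apply: h => i; [exact: lt_le_trans (wz i) le|exact: lt_le_trans (w'z i) le].
  exact: jump_local (off j jN).
exists e => // w w' wz w'z; rewrite /u.
have h j : j \in L -> `|jump j w - jump j w'| <= 2 * ed w w' by move=> jL; apply: eP => //; exact: ltN.
have := coord_le_ed w w' ord0; have := ed_ge0 w w'; move: (ed w w') h => E h E0.
rewrite ler_norml => /andP[c1 c2].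
suff : `|\sum_(j <- L) jump j w - \sum_(j <- L) jump j w'| <= 4 * E.
  by rewrite !ler_norml => /andP[? ?]; apply/andP; split; lra.
case: (jump_sum w sepL) => [[z1 ->]|[j [jL -> z1]]];
  case: (jump_sum w' sepL) => [[z2 ->]|[k [kL -> z2]]].
- by rewrite subrr normr0; lra.
- by have := h k kL; rewrite z1// => /le_trans; apply; lra.
- by have := h j jL; rewrite z2// => /le_trans; apply; lra.
have := h j jL; have := h k kL; have [->|jk] := eqVneq j k; first by lra.
have kj : k != j by rewrite eq_sym.
by rewrite (z1 k kL kj) (z2 j jL jk) sub0r subr0 normrN !ler_norml => /andP[? ?] /andP[? ?]; apply/andP; split; lra.
Qed.

Lemma jumps_lipschitz z w : SN N z -> SN N w -> `|u z - u w| <= 5 * pd Q N z w.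
Proof.
move=> Sz Sw; apply/ler_addgt0Pr => e e0.
have -> : 5 * pd Q N z w + e = 5 * (pd Q N z w + e / 5) by field.
apply: (@path_dist_lipschitz _ _ (SN N)) => //.
  by apply: pd_ltE => //; rewrite ltrDl divr_gt0.
by move=> x Sx _; have [r r0 h] := jumps_local Sx; exists r => // x1 x2 _ _; exact: h.
Qed.

Definition near_core j r z := forall i, (core j).1 0 i - r < z 0 i < (core j).2 0 i + r.

Lemma jumps_near_core j z : j \in L -> near_core j (kappa ^+ 2 * sl Q j) z -> ~ sset Q j z ->
  z 0 ord0 <> sx Q j /\
  u z = if sx Q j < z 0 ord0 then sx Q j + kappa * sl Q j else sx Q j - kappa * sl Q j.
Proof.
move=> jL nz zs; have /andP[k0 k8] := kappa01; have l0 := sl_gt0 Q j.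
have kl0 : 0 < kappa * sl Q j by exact: mulr_gt0.
have kl8 : kappa * sl Q j <= 8^-1 * sl Q j by rewrite ler_wpM2r// ltW.
have kkl : kappa ^+ 2 * sl Q j <= kappa * sl Q j.
  by apply: ler_wpM2r; [exact: ltW|rewrite expr2 ger_pMl//; lra].
have kkl0 : 0 < kappa ^+ 2 * sl Q j by rewrite mulr_gt0// exprn_gt0.
have vert i : i != ord0 -> kappa * sl Q j < z 0 i - sc Q j 0 i /\
    kappa * sl Q j < sc Q j 0 i + sl Q j - z 0 i.
  by move=> i0; have := nz i; rewrite !mxE (negbTE i0) => /andP[h1 h2]; split; lra.
have dz : depth Q kappa j z = kappa * sl Q j.
  apply/eqP; rewrite eq_le depth_le /=; apply: depth_ge => // i /vert[h1 h2]; split; lra.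
have hor : sx Q j - kappa * sl Q j < z 0 ord0 < sx Q j + kappa * sl Q j.
  have := nz ord0; rewrite !mxE eqxx mulrBr mulr1 (_ : _ * kappa = kappa ^+ 2 * sl Q j); last by ring.
  by move=> /andP[h1 h2]; apply/andP; split; lra.
have z0 : z 0 ord0 <> sx Q j.
  move=> z0; apply: zs; rewrite ssetE => i /=; case: eqP => [->//|/eqP/vert[h1 h2]].
  by apply/andP; split; lra.
split=> //.
have jz : jump j z = if sx Q j < z 0 ord0 then sx Q j + kappa * sl Q j - z 0 ord0
    else sx Q j - kappa * sl Q j - z 0 ord0.
  rewrite /slit_jump dz; case/andP: hor => h1 h2.
  by case: ifP => _; [rewrite max_r//; lra|rewrite min_r//; lra].
have jz0 : jump j z != 0 by rewrite jz; case/andP: hor => h1 h2; case: ifP => _; lra.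
rewrite /u; have -> : \sum_(k <- L) jump k z = jump j z.
  case: (jump_sum z sepL) => [[h _]|[k [kL -> h]]]; first by rewrite h ?eqxx in jz0.
  by have [->//|jk] := eqVneq j k; rewrite h ?eqxx in jz0.
by rewrite jz; case: ifP => _; ring.
Qed.

(** Along a short curve that starts near the core and avoids the slit, the side on
    which it runs cannot change. *)
Lemma jumps_constant j z w : j \in L -> SN N z -> SN N w ->
  near_core j (kappa ^+ 2 * sl Q j / 2) z -> pd Q N z w < kappa ^+ 2 * sl Q j / 2 -> u z = u w.
Proof.
move=> jL Sz Sw nz zw; apply/eqP; rewrite -subr_eq0 -normr_le0.
rewrite -(mul0r (kappa ^+ 2 * sl Q j / 2)).
apply: (@path_dist_lipschitz _ _ (SN N)) => //; first exact: pd_ltE.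
move=> x Sx zx.
have nx (v : V) : (forall i, `|v 0 i - x 0 i| < kappa ^+ 2 * sl Q j / 2 - ed z x) ->
    near_core j (kappa ^+ 2 * sl Q j) v.
  move=> vx i; have := coord_le_ed z x i; have := vx i; have := nz i.
  move: (ed z x) (_ * sl Q j) => E S /andP[h1 h2]; rewrite ltr_norml ler_norml.
  by move=> /andP[h3 h4] /andP[h5 h6]; apply/andP; split; lra.
have off (v : V) : SN N v -> ~ sset Q j v by move=> /SNP[_]; apply; exact: ltN.
have xx : near_core j (kappa ^+ 2 * sl Q j) x.
  by apply: nx => i; rewrite subrr normr0 subr_gt0.
have [x0 _] := jumps_near_core jL xx (off x Sx).
exists (Num.min (kappa ^+ 2 * sl Q j / 2 - ed z x) `|x 0 ord0 - sx Q j|).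
  by rewrite lt_min subr_gt0 zx normr_gt0 subr_eq0; exact/eqP.
move=> z1 z2 S1 S2 h1 h2.
have side (v : V) : (forall i, `|v 0 i - x 0 i| <
    Num.min (kappa ^+ 2 * sl Q j / 2 - ed z x) `|x 0 ord0 - sx Q j|) ->
    (sx Q j < v 0 ord0) = (sx Q j < x 0 ord0).
  move/(_ ord0); rewrite lt_min => /andP[_].
  case: (ltrgtP (sx Q j) (x 0 ord0)) => // h; last by move: x0; rewrite h.
  - by rewrite ltr_norml => ?; lra.
  - by rewrite ltr_norml => ?; apply/negbTE; rewrite -leNgt; lra.
have n1 : near_core j (kappa ^+ 2 * sl Q j) z1.
  by apply: nx => i; have := h1 i; rewrite lt_min => /andP[].
have n2 : near_core j (kappa ^+ 2 * sl Q j) z2.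
  by apply: nx => i; have := h2 i; rewrite lt_min => /andP[].
have [_ ->] := jumps_near_core jL n1 (off _ S1); have [_ ->] := jumps_near_core jL n2 (off _ S2).
by rewrite !side// subrr normr0 mul0r.
Qed.

(** The extension of u from the N-th stage to the limit, which keeps the
    Lipschitz constant. *)
Definition jumps p : R := inf [set r | exists z e, [/\ 0 < e, apx p N e z & r = u z + 5 * e]].

Lemma jumps_apx p e z : 0 < e -> apx p N e z -> `|jumps p - u z| <= 5 * e.
Proof.
move=> e0 pz; have low : lbound [set r | exists z e, [/\ 0 < e, apx p N e z & r = u z + 5 * e]] (u z - 5 * e).
  move=> _ [w [e' [e'0 pw ->]]]; have [Sz _] := pz; have [Sw _] := pw.
  have := jumps_lipschitz Sz Sw; have := apx_ge pz pw; rewrite d_xx add0r.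
  by move: (pd Q N z w) => P h1; rewrite ler_norml => /andP[h2 h3]; lra.
have h1 : u z - 5 * e <= jumps p.
  by apply: lb_le_inf => //; exists (u z + 5 * e), z, e.
have h2 : jumps p <= u z + 5 * e.
  by apply: ge_inf; [exists (u z - 5 * e)|exists z, e].
by rewrite ler_norml; apply/andP; split; lra.
Qed.

Lemma jumps_dist p q : `|jumps p - jumps q| <= 5 * d p q.
Proof.
apply/ler_addgt0Pr => e e0; have e1 : 0 < e / 20 by rewrite divr_gt0.
have [z pz] := apx_ex p N e1; have [w qw] := apx_ex q N e1.
have := jumps_apx e1 pz; have := jumps_apx e1 qw; have := apx_ge pz qw.
have [Sz _] := pz; have [Sw _] := qw; have := jumps_lipschitz Sz Sw.
move: (pd Q N z w) (d p q) (u z) (u w) (jumps p) (jumps q) => P D a b a' b'.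
rewrite !ler_norml => /andP[h1 h2] h3 /andP[h4 h5] /andP[h6 h7]; apply/andP; split; lra.
Qed.

Lemma jumps_tau p : `|jumps p - tau p 0 ord0| <= kappa * boxsize Q.
Proof.
apply/ler_addgt0Pr => e e0; have e1 : 0 < e / 6 by rewrite divr_gt0.
have [z pz] := apx_ex p N e1.
have := jumps_apx e1 pz; have := apx_tau pz ord0; have := jumps_close z.
move: (u z) (jumps p) (z 0 ord0) (tau p 0 ord0) (kappa * _) => a b c t D.
rewrite !ler_norml => /andP[h1 h2] /andP[h4 h5] /andP[h6 h7]; apply/andP; split; lra.
Qed.

Lemma jumps_core j p q : j \in L -> (forall i, (core j).1 0 i <= tau p 0 i <= (core j).2 0 i) ->
  d p q < kappa ^+ 2 * sl Q j / 4 -> jumps p = jumps q.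
Proof.
move=> jL pc pq; have /andP[k0 _] := kappa01.
have k1 : 0 < kappa ^+ 2 * sl Q j by rewrite mulr_gt0 ?exprn_gt0// sl_gt0.
apply/eqP; rewrite -subr_eq0 -normr_le0; apply/ler_addgt0Pr => e e0; rewrite add0r.
pose r := Num.min (e / 10) (kappa ^+ 2 * sl Q j / 16).
have r0 : 0 < r by rewrite lt_min !divr_gt0.
have [re rk] : r <= e / 10 /\ r <= kappa ^+ 2 * sl Q j / 16.
  by split; rewrite ge_min lexx ?orbT.
have [z pz] := apx_ex p N r0; have [w qw] := apx_ex q N r0.
have h1 := jumps_apx r0 pz; have h2 := jumps_apx r0 qw; have h3 := apx_ge pz qw.
have [Sz _] := pz; have [Sw _] := qw.
have uzw : u z = u w.
  apply: (@jumps_constant j) => //; last by move: h3; move: (pd Q N z w) => P; lra.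
  move=> i; have := apx_tau pz i; have := pc i; rewrite ler_norml => /andP[h4 h5] /andP[h6 h7].
  apply/andP; split; lra.
move: h1 h2; rewrite uzw; move: (jumps p) (jumps q) (u w) => a b c.
by rewrite !ler_norml => /andP[h4 h5] /andP[h6 h7]; apply/andP; split; lra.
Qed.

End Jumps.

(** Away from a set of small volume one can change the first coordinate by
    little into a Lipschitz function that is locally constant. *)
Lemma jump_function (eps : R) : porous_slits Q -> 0 < eps -> exists U : X -> R, exists L : seq (V * V),
  [/\ pairwise (@bsep R m.+2) L, forall B, B \in L -> inbox (low Q) (high Q) B
    & vol (low Q, high Q) - eps <= \sum_(B <- L) vol B] /\
  [/\ forall p q, `|U p - U q| <= 5 * d p q, forall p, `|U p - tau p 0 ord0| <= eps
    & exists2 r, 0 < r & forall B p q, B \in L -> (forall i, B.1 0 i <= tau p 0 i <= B.2 0 i) ->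
        d p q < r -> U p = U q].
Proof.
move=> por eps0; have bx : inbox (low Q) (high Q) (low Q, high Q).
  by move=> i; rewrite !lexx; split=> //; exact/ltW/low_lt_high.
have v0 := vol_box_ge0 bx; set W := vol _ in v0 *.
pose D := (4 * m.+2%:R + 1) * (W + 1) + boxsize Q + 8.
have b0 := boxsize_gt0 Q; have n0 : 0 <= m.+2%:R :> R by [].
have nW : 0 <= m.+2%:R * W by rewrite mulr_ge0.
have D0 : 0 < D by rewrite /D; lra.
pose kappa := Num.min eps 1 / D.
have s0 : 0 < Num.min eps 1 by rewrite lt_min eps0 ltr01.
have k0 : 0 < kappa by rewrite divr_gt0.
have kD : kappa * D = Num.min eps 1 by rewrite /kappa divfK ?gt_eqF.
have [m1 m2] : Num.min eps 1 <= eps /\ Num.min eps 1 <= 1 by split; rewrite ge_min lexx ?orbT.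
have kW : 0 <= kappa * (m.+2%:R * W) by rewrite mulr_ge0// ltW.
have kn : 0 <= kappa * m.+2%:R by rewrite mulr_ge0// ltW.
have kb : 0 < kappa * boxsize Q by rewrite mulr_gt0.
have kv : 0 <= kappa * W by rewrite mulr_ge0// ltW.
have kE : kappa * D = 4 * (kappa * (m.+2%:R * W)) + 4 * (kappa * m.+2%:R) + kappa * W + kappa +
    kappa * boxsize Q + kappa * 8 by rewrite /D; ring.
have kappa01 : 0 < kappa <= 8^-1 by rewrite k0 /=; lra.
have [L [sepL inL vL]] := fill_box por kappa01 k0 bx.
pose N := (\max_(j <- L) j).+1.
have ltN j : j \in L -> (j < N)%N by move=> jL; rewrite ltnS; exact: leq_bigmax_seq.
exists (jumps kappa L N), (map (core Q kappa) L); split; split.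
- elim: L sepL {inL vL N ltN} => //= j L ih /andP[h1 h2]; rewrite ih// andbT.
  apply/allP => B /mapP[k kL ->]; apply: (core_bsep kappa01).
  by move/allP: h1; apply; exact: map_f.
- by move=> B /mapP[j jL ->]; apply: (core_sub kappa01); exact: inL.
- rewrite big_map; apply: le_trans (_ : \sum_(j <- L) (1 - 4 * m.+2%:R * kappa) * vol (thin Q kappa j) <= _); last first.
    by apply: ler_sum => j _; exact: vol_core.
  rewrite -mulr_sumr.
  apply: le_trans (_ : (1 - 4 * m.+2%:R * kappa) * ((1 - kappa) * W) <= _); last first.
    by apply: ler_wpM2l => //; lra.
  have : 0 <= kappa * (kappa * (m.+2%:R * W)) by rewrite mulr_ge0// ltW.
  lra.
- exact: jumps_dist.
- by move=> p; apply: le_trans (jumps_tau _ _ _ p) _ => //; lra.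
have [r r0 rP] : exists2 r, 0 < r & forall j, (j < N)%N -> r <= kappa ^+ 2 * sl Q j / 4.
  apply: finite_radius => [j e e' le h|j _]; first exact: le_trans le h.
  exists (kappa ^+ 2 * sl Q j / 4) => //; apply: divr_gt0 => //.
  by apply: mulr_gt0; [exact: exprn_gt0|exact: sl_gt0].
exists r => // B p q /mapP[j jL ->] pB pq.
by apply: (jumps_core kappa01 sepL ltN jL) => //; exact: lt_le_trans pq (rP j (ltN j jL)).
Qed.

End JumpFunction.

(** * The double of a metric space *)
Section DoubleMetric.
Variables (R : realType) (X : choiceType) (d : X -> X -> R) (A : set X).
Local Notation DX := (@Defs.double X A).
Implicit Types (p q r z : X) (b c : bool) (e : R) (x y w : DX).

Hypothesis d_ge0 : forall p q, 0 <= d p q.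
Hypothesis d_xx : forall p, d p p = 0.
Hypothesis d_sym : forall p q, d p q = d q p.
Hypothesis d_triangle : forall q p r, d p r <= d p q + d q r.
Hypothesis d_eq0 : forall p q, d p q = 0 -> p = q.
Hypothesis A_nonempty : A !=set0.
Hypothesis A_closed : forall p, (forall e, 0 < e -> exists2 z, A z & d p z < e) -> A p.

Local Notation D := (@double_dist R X d A).

Definition copy b p : DX := (\pi_{eq_quot (double_equiv A)} (p, b))%qT.

Definition fold x : X := (repr x).1.

Definition sheet x : bool := (repr x).2.

Lemma copyK x : copy (sheet x) (fold x) = x.
Proof. by rewrite /copy /sheet /fold -surjective_pairing reprK. Qed.

Lemma copy_eq b c p q : copy b p = copy c q <-> p = q /\ (b = c \/ A p).
Proof.
split=> [/eqmodP|[-> h]]; last apply/eqmodP.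
  by move=> /andP[/eqP /= -> /orP[/eqP /= ->|/set_mem]]; split=> //; [left|right].
by apply/andP; split=> //=; case: h => [->|/mem_set ->]; rewrite ?eqxx ?orbT.
Qed.

Lemma fold_copy b p : fold (copy b p) = p.
Proof. by have /copy_eq[] := copyK (copy b p). Qed.

Lemma sheet_copy b p : sheet (copy b p) = b \/ A p.
Proof. by have /copy_eq[] := copyK (copy b p); rewrite fold_copy. Qed.

Let through p q : has_inf [set d p z + d z q | z in A].
Proof.
split; first by have [z Az] := A_nonempty; exists (d p z + d z q), z.
by exists 0 => _ [z Az <-]; rewrite addr_ge0.
Qed.

Lemma dist_fold x y : d (fold x) (fold y) <= D x y.
Proof.
rewrite /double_dist /fold; case: eqP => _ //; apply: lb_le_inf; first by have [] := through (repr x).1 (repr y).1.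
by move=> _ [z Az <-]; exact: d_triangle.
Qed.

Lemma dist_same b p q : D (copy b p) (copy b q) = d p q.
Proof.
apply/eqP; rewrite eq_le.
have := dist_fold (copy b p) (copy b q); rewrite !fold_copy => ->; rewrite andbT.
have := fold_copy b p; have := fold_copy b q; rewrite /double_dist /fold => -> ->.
case: eqP => // ne; apply: (@le_trans _ _ (d p q)) => //.
have [] := sheet_copy b p; last first.
  by move=> Ap; apply: ge_inf; [case: (through p q)|exists p; rewrite ?d_xx ?add0r].
move=> sp; have [sq|Aq] := sheet_copy b q; first by case: ne; rewrite -/(sheet _) sp -/(sheet _) sq.
by apply: ge_inf; [case: (through p q)|exists q; rewrite ?d_xx ?addr0].
Qed.

Lemma dist_through b c p q z : A z -> D (copy b p) (copy c q) <= d p z + d z q.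
Proof.
move=> Az; have := fold_copy b p; have := fold_copy c q; rewrite /double_dist /fold => -> ->.
case: eqP => _; first exact: d_triangle.
by apply: ge_inf; [case: (through p q)|exists z].
Qed.

(** Points of different copies are joined through A; this also holds when one of
    them lies in A and is represented in the copy of the other one. *)
Lemma dist_other b c p q e : b <> c -> 0 < e ->
  exists2 z, A z & d p z + d z q < D (copy b p) (copy c q) + e.
Proof.
move=> bc e0; have := fold_copy b p; have := fold_copy c q; rewrite /double_dist /fold => -> ->.
have [Ap|nAp] := pselect (A p).
  exists p => //; rewrite d_xx add0r; case: eqP => _; first by rewrite ltrDl.
  rewrite -ltrBlDr; apply: lt_le_trans (_ : d p q <= _); first by rewrite gtrBl.
  by apply: lb_le_inf; [case: (through p q)|move=> _ [z Az <-]; exact: d_triangle].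
have [Aq|nAq] := pselect (A q).
  exists q => //; rewrite d_xx addr0; case: eqP => _; first by rewrite ltrDl.
  rewrite -ltrBlDr; apply: lt_le_trans (_ : d p q <= _); first by rewrite gtrBl.
  by apply: lb_le_inf; [case: (through p q)|move=> _ [z Az <-]; exact: d_triangle].
have -> : ((repr (copy b p)).2 == (repr (copy c q)).2) = false.
  have [sp|//] := sheet_copy b p; have [sq|//] := sheet_copy c q.
  by move: sp sq; rewrite /sheet => -> ->; apply/eqP.
have [_ [z Az <-] h] := inf_adherent e0 (through p q).
by exists z.
Qed.

Lemma copy_ind (P : DX -> Prop) : (forall b p, P (copy b p)) -> forall x, P x.
Proof. by move=> h x; rewrite -(copyK x). Qed.

Lemma dist_ge0 x y : 0 <= D x y.
Proof. exact: le_trans (dist_fold x y). Qed.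

Lemma dist_xx x : D x x = 0.
Proof. by elim/copy_ind: x => b p; rewrite dist_same d_xx. Qed.

Lemma dist_sym x y : D x y = D y x.
Proof.
suff le x' y' : D x' y' <= D y' x' by apply/eqP; rewrite eq_le !le.
elim/copy_ind: x' => b p; elim/copy_ind: y' => c q.
have [->|/eqP bc] := eqVneq b c; first by rewrite !dist_same d_sym.
apply/ler_addgt0Pr => e e0; have [z Az /ltW] := dist_other q p (nesym bc) e0.
apply: le_trans; apply: le_trans (dist_through _ _ _ _ Az) _.
by rewrite addrC (d_sym z p) (d_sym z q).
Qed.

Lemma dist_triangle y x w : D x w <= D x y + D y w.
Proof.
elim/copy_ind: x => b p; elim/copy_ind: w => b' r; elim/copy_ind: y => c q.
have [<-|/eqP bb'] := eqVneq b b'.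
  rewrite dist_same; apply: le_trans (d_triangle q _ _) _.
  by apply: lerD; [have := dist_fold (copy b p) (copy c q)|
    have := dist_fold (copy c q) (copy b r)]; rewrite !fold_copy.
apply/ler_addgt0Pr => e e0; have [cb|/eqP cb] := eqVneq c b.
  have cb' : c <> b' by rewrite cb.
  have [z Az h] := dist_other q r cb' e0; apply: le_trans (dist_through _ _ _ _ Az) _.
  rewrite cb in h *; rewrite dist_same; have := d_triangle q p z; lra.
have [z Az h] := dist_other p q (nesym cb) e0; apply: le_trans (dist_through _ _ _ _ Az) _.
have <- : c = b' by move: bb' cb; case: (b); case: (b'); case: (c).
rewrite dist_same; have := d_triangle q z r; lra.
Qed.

Lemma dist_eq0 x y : D x y = 0 -> x = y.
Proof.
elim/copy_ind: x => b p; elim/copy_ind: y => c q D0.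
have pq : p = q.
  apply: d_eq0; apply/eqP; rewrite eq_le d_ge0 andbT -D0.
  by have := dist_fold (copy b p) (copy c q); rewrite !fold_copy.
apply/copy_eq; split=> //; have [->|/eqP bc] := eqVneq b c; [by left|right].
apply: A_closed => e e0; have [z Az h] := dist_other p q bc e0; exists z => //.
by move: h; rewrite D0 add0r; apply: le_lt_trans; rewrite lerDl.
Qed.

Hypothesis d_compact : forall P : nat -> X,
  exists p, forall e (K : nat), 0 < e -> exists2 k, (K <= k)%N & d (P k) p < e.

Lemma dist_compact (P : nat -> DX) :
  exists x, forall e (K : nat), 0 < e -> exists2 k, (K <= k)%N & D (P k) x < e.
Proof.
have [g gP] : exists g : nat -> nat, forall K, (K <= g K)%N /\
    exists b, forall K', sheet (P (g K')) = b.
  have [[K0 all0]|often] := pselect (exists K0, forall k, (K0 <= k)%N -> sheet (P k) = false).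
    exists (fun K => K + K0)%N => K; split; first exact: leq_addr.
    by exists false => K'; apply: all0; exact: leq_addl.
  have {}often K : exists k, (K <= k)%N /\ sheet (P k) = true.
    apply: contrapT => none; apply: often; exists K => k Kk; apply/negbTE/negP => h.
    by apply: none; exists k.
  have [g gP] := choice often; exists g => K; split; first by case: (gP K).
  by exists true => K'; case: (gP K').
have [_ [b bP]] := gP 0%N.
have [p pP] := d_compact (fun k => fold (P (g k))).
exists (copy b p) => e K e0; have [k Kk kp] := pP e K e0.
exists (g k); first by apply: leq_trans Kk _; case: (gP k).
by rewrite -(copyK (P (g k))) bP dist_same.
Qed.

End DoubleMetric.

(** * Quasisymmetric embeddings of a compact metric space *)
Section Embedding.
Variables (R : realType) (X : Type) (d : X -> X -> R) (f : X -> X).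
Implicit Types (x y z : X) (e : R).

Hypothesis d_ge0 : forall x y, 0 <= d x y.
Hypothesis d_xx : forall x, d x x = 0.
Hypothesis d_sym : forall x y, d x y = d y x.
Hypothesis d_triangle : forall y x z, d x z <= d x y + d y z.
Hypothesis d_eq0 : forall x y, d x y = 0 -> x = y.
Hypothesis fqs : qs_embedding d d f.

Lemma qs_injective : injective f.
Proof.
have [[_ [g [fg _ _]]] _] := fqs => x y fxy.
by rewrite -(fg x) -(fg y); congr g; exact: eq_exist.
Qed.

Lemma qs_continuous x e : 0 < e ->
  exists2 r, 0 < r & forall y, d x y < r -> d (f x) (f y) < e.
Proof. by have [[fc _] _] := fqs; exact: fc. Qed.

Lemma qs_inverse_continuous x e : 0 < e ->
  exists2 r, 0 < r & forall y, d (f x) (f y) < r -> d x y < e.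
Proof.
move=> e0; have [[_ [g [fg _ gc]]] _] := fqs.
have [r r0 h] := gc (to_image f x) e e0; exists r => // y xy.
by have := h (to_image f y) xy; rewrite !fg.
Qed.

Lemma dist_gt0 x y : x <> y -> 0 < d x y.
Proof. by move=> xy; rewrite lt_neqAle d_ge0 andbT; apply/eqP => /esym/d_eq0. Qed.

(** The comparison of distances at equal scale, from eta at 1; points with z = x
    account for the lower bound of the constant. *)
Lemma qs_weak : exists2 H, 1 <= H &
  forall x y z, d x y <= d y z -> d (f x) (f y) <= H * d (f y) (f z).
Proof.
have [_ [eta [_ mono h]]] := fqs.
exists (Num.max 1 (eta 1)) => [|x y z le]; first by rewrite le_max lexx.
have H0 : 0 <= Num.max 1 (eta 1) by rewrite le_max ler01.
have [->|xy] := pselect (x = y); first by rewrite d_xx mulr_ge0.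
have [yz|yz] := pselect (y = z); first by case: xy; apply: d_eq0; apply/eqP; rewrite eq_le d_ge0 andbT -(d_xx y) {3}yz.
have fyz : 0 < d (f y) (f z) by apply: dist_gt0 => /qs_injective.
have [->|xz] := pselect (x = z).
  by rewrite (d_sym (f z)) ler_peMl// ?le_max ?lexx// ltW.
have := h x y z xy yz xz; rewrite /image_dist /= ler_pdivrMr// => /le_trans; apply.
apply: ler_wpM2r; first exact: ltW.
have yz0 := dist_gt0 yz; rewrite le_max; apply/orP; right.
have : d x y / d y z <= 1 by rewrite ler_pdivrMr// mul1r.
rewrite le_eqVlt => /orP[/eqP -> //|lt1]; apply/ltW/mono => //.
by rewrite divr_ge0.
Qed.

Hypothesis d_compact : forall P : nat -> X,
  exists p, forall e (K : nat), 0 < e -> exists2 k, (K <= k)%N & d (P k) p < e.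

Lemma qs_uniform e : 0 < e ->
  exists2 r, 0 < r & forall x y, d x y < r -> d (f x) (f y) < e.
Proof.
move=> e0; apply: contrapT => none; have [iv iv0 small] := vanishing_seq R.
have /choice[P hP] : forall k, exists P : X * X, d P.1 P.2 < iv k /\ e <= d (f P.1) (f P.2).
  move=> k.
  apply: contrapT => nk; apply: none; exists (iv k) => // x y xy; rewrite ltNge; apply/negP => h.
  by apply: nk; exists (x, y).
have [p hp] := d_compact (fun k => (P k).1).
have e2 : 0 < e / 2 by rewrite divr_gt0.
have [r r0 h] := qs_continuous p e2.
have r2 : 0 < r / 2 by rewrite divr_gt0.
have [K hK] := small _ r2; have [k Kk pk] := hp _ K r2.
have [P1 P2] := hP k; have := hK k Kk => ivk.
have h1 := h (P k).1; have h2 := h (P k).2; have t1 := d_triangle (P k).1 p (P k).2.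
have t2 := d_triangle (f p) (f (P k).1) (f (P k).2).
rewrite (d_sym p) in h1 t1; rewrite (d_sym _ (f p)) in t2.
have : d (f p) (f (P k).1) < e / 2 by apply: h1; lra.
have : d (f p) (f (P k).2) < e / 2 by apply: h2; lra.
lra.
Qed.

Lemma qs_range_closed y : (forall e, 0 < e -> exists x, d (f x) y < e) -> exists x, f x = y.
Proof.
move=> h; have [iv iv0 small] := vanishing_seq R.
have [P hP] := choice (fun k => h _ (iv0 k)).
have [p hp] := d_compact P; exists p; apply: d_eq0; apply/eqP; rewrite eq_le d_ge0 andbT.
apply/ler_addgt0Pr => e e0; rewrite add0r.
have e2 : 0 < e / 2 by rewrite divr_gt0.
have [r r0 fr] := qs_continuous p e2.
have [K hK] := small _ e2; have [k Kk pk] := hp _ K r0.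
have := hK k Kk; have := hP k; have := fr (P k); rewrite d_sym => /(_ pk).
have := d_triangle (f (P k)) (f p) y; lra.
Qed.

End Embedding.

Section OuterBoundary.
Variables (R : realType) (m : nat) (Q : slits R m).
Local Notation V := 'rV[R]_m.+2.
Local Notation I := (open_box (low Q) (high Q)).
Local Notation X := (slit_space I (sset Q)).
Local Notation tau := (@tau R m Q).
Local Notation d := (@d R m Q).
Implicit Types (x y z w : V) (j : nat) (e r : R) (p q : X).

Local Notation A := (@outer_boundary R m.+2 I (sset Q)).

Lemma outerP p : A p <-> ~ I (tau p).
Proof.
rewrite /outer_boundary /= -tau_def; split=> [[_ nI] Ip|nI].
  have [e e0 h] := box_open Ip; apply: nI; apply/nbhs_ballP; exists e => //= w [_ zw].
  by apply: h => i; have := zw 0 i; rewrite /ball /= distrC.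
by apply: box_boundary => //; exact: tau_cbox.
Qed.

Lemma outer_nonempty : A !=set0.
Proof.
have tb : low Q 0 ord0 <= low Q 0 ord0 <= high Q 0 ord0 by rewrite lexx ltW// low_lt_high.
have [p pz] := point_over (edge_cbox tb) (@edge_off R m Q _); exists p.
by apply/outerP; rewrite pz => /(_ (i1 m)); rewrite updE /= ltxx.
Qed.

Lemma outer_closed p : (forall e, 0 < e -> exists2 z, A z & d p z < e) -> A p.
Proof.
move=> h; apply/outerP => Ip.
have [e e0 he] := box_open Ip; have [q /outerP Aq pq] := h e e0; apply: Aq; apply: he => i.
by rewrite distrC; apply: le_lt_trans pq; exact: tau_lipschitz.
Qed.

End OuterBoundary.

Section SlitDouble.
Variables (R : realType) (m : nat) (Q : slits R m).
Local Notation V := 'rV[R]_m.+2.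
Local Notation I := (open_box (low Q) (high Q)).
Local Notation X := (slit_space I (sset Q)).
Local Notation tau := (@tau R m Q).
Local Notation d := (@d R m Q).
Local Notation A := (@outer_boundary R m.+2 I (sset Q)).
Local Notation DX := (@Defs.double X A).
Local Notation copy := (copy A).
Implicit Types (x y w : DX) (b c : bool) (e r : R) (p q z : X).

Fact dd_seal : {g | g = @double_dist R X d A}.
Proof. by exists (@double_dist R X d A). Qed.

Definition dd x y : R := sval dd_seal x y.

Lemma dd_def x y : dd x y = double_dist d x y.
Proof. by rewrite /dd (svalP dd_seal). Qed.

Lemma dd_ge0 x y : 0 <= dd x y.
Proof. rewrite dd_def; apply: dist_ge0; [exact: d_ge0|exact: d_triangle|exact: outer_nonempty]. Qed.

Lemma dd_xx x : dd x x = 0.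
Proof.
rewrite dd_def; apply: dist_xx; [exact: d_ge0|exact: d_xx|exact: d_triangle|exact: outer_nonempty].
Qed.

Lemma dd_sym x y : dd x y = dd y x.
Proof.
rewrite !dd_def; apply: dist_sym;
  [exact: d_ge0|exact: d_xx|exact: d_sym|exact: d_triangle|exact: outer_nonempty].
Qed.

Lemma dd_triangle y x w : dd x w <= dd x y + dd y w.
Proof.
rewrite !dd_def; apply: dist_triangle; [exact: d_ge0|exact: d_xx|exact: d_triangle|exact: outer_nonempty].
Qed.

Lemma dd_eq0 x y : dd x y = 0 -> x = y.
Proof.
rewrite !dd_def; apply: dist_eq0;
  [exact: d_ge0|exact: d_xx|exact: d_triangle|exact: d_eq0|exact: outer_nonempty|exact: outer_closed].
Qed.

Lemma dd_fold x y : d (fold x) (fold y) <= dd x y.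
Proof. rewrite dd_def; apply: dist_fold; [exact: d_ge0|exact: d_triangle|exact: outer_nonempty]. Qed.

Lemma dd_same b p q : dd (copy b p) (copy b q) = d p q.
Proof.
rewrite dd_def; apply: dist_same; [exact: d_ge0|exact: d_xx|exact: d_triangle|exact: outer_nonempty].
Qed.

Lemma dd_through b c p q z : A z -> dd (copy b p) (copy c q) <= d p z + d z q.
Proof.
rewrite dd_def; apply: dist_through; [exact: d_ge0|exact: d_triangle|exact: outer_nonempty].
Qed.

Lemma dd_other b c p q e : b <> c -> 0 < e ->
  exists2 z, A z & d p z + d z q < dd (copy b p) (copy c q) + e.
Proof.
rewrite dd_def; apply: dist_other; [exact: d_ge0|exact: d_xx|exact: d_triangle|exact: outer_nonempty].
Qed.

Lemma dd_compact (por : porous_slits Q) (P : nat -> DX) :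
  exists x, forall e (K : nat), 0 < e -> exists2 k, (K <= k)%N & dd (P k) x < e.
Proof.
have [||||x xP] := @dist_compact R X d A _ _ _ _ (d_compact por) P;
  [exact: d_ge0|exact: d_xx|exact: d_triangle|exact: outer_nonempty|].
by exists x => e K /(xP _ K)[k Kk h]; exists k => //; rewrite dd_def.
Qed.

Lemma tau_dd x y i : `|tau (fold x) 0 i - tau (fold y) 0 i| <= dd x y.
Proof. exact: le_trans (tau_lipschitz _ _ _) (dd_fold x y). Qed.

End SlitDouble.

(** * A grid of vertical lines *)
Section Grid.
Variables (R : realType) (m : nat) (Q : slits R m).
Local Notation V := 'rV[R]_m.+2.
Local Notation I := (open_box (low Q) (high Q)).
Local Notation X := (slit_space I (sset Q)).
Local Notation tau := (@tau R m Q).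
Local Notation d := (@d R m Q).
Implicit Types (p q : X).

(** The lines are parallel to the i-th axis. Their distance is that of neighbours
    on a line, up to a factor 2 that leaves room to choose generic first
    coordinates; so neighbours on a line are at the least distance. The number q
    depends on the width of the tube alone, while a refines the grid: there are a
    to the power m.+1 lines with a * q steps each. *)
Lemma grid (i : 'I_m.+2) (z : V) (v r : R) : i != ord0 -> cbox Q z -> z 0 i < v <= high Q 0 i ->
  0 < r -> exists2 q : nat, (0 < q)%N & forall a : nat, (0 < a)%N ->
  let h := (v - z 0 i) / (a * q)%:R in
  exists P : {ffun 'I_m.+1 -> 'I_a} -> nat -> X,
  [/\ forall phi k, (k <= a * q)%N -> [/\ forall l, l != i -> `|tau (P phi k) 0 l - z 0 l| < r,
        generic Q (tau (P phi k) 0 ord0) & tau (P phi k) 0 i = z 0 i + k%:R * h],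
      forall phi k, (k < a * q)%N -> d (P phi k) (P phi k.+1) <= h &
      forall phi k phi' k', (k <= a * q)%N -> (k' <= a * q)%N ->
        (phi, k) <> (phi', k') -> h <= d (P phi k) (P phi' k')].
Proof.
move=> i0 zb /andP[zv vh] r0; have H0 : 0 < v - z 0 i by rewrite subr_gt0.
have [s s0 hs] : exists2 s, 0 < s & forall k, (k < m.+2)%N ->
    forall l : 'I_m.+2, l = k :> nat -> 2 * s <= high Q 0 l - low Q 0 l.
  apply: finite_radius => [k e e' le h l lk|k km]; first by have := h l lk; lra.
  exists ((high Q 0 (Ordinal km) - low Q 0 (Ordinal km)) / 2) => [|l lk].
    by rewrite divr_gt0// subr_gt0 low_lt_high.
  by have -> : l = Ordinal km by [exact/val_inj]; lra.
pose s' := Num.min s (r / 2); have s'0 : 0 < s' by rewrite lt_min s0 divr_gt0.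
have [s's s'r] : s' <= s /\ s' <= r / 2 by split; rewrite ge_min lexx ?orbT.
pose q := (Num.truncn (2 * (v - z 0 i) / s')).+1.
have q0 : 0 < q%:R :> R by rewrite ltr0n.
pose w := 2 * (v - z 0 i) / q%:R.
have w0 : 0 < w by rewrite divr_gt0// mulr_gt0.
have ws : w <= s'.
  by rewrite ler_pdivrMr// [s' * _]mulrC -ler_pdivrMr//; apply/ltW/truncnS_gt.
exists q => // a a_gt0 h; have a0 : 0 < a%:R :> R by rewrite ltr0n.
have h0 : 0 < h by rewrite divr_gt0// natrM mulr_gt0.
have ah : 2 * a%:R * h = w by rewrite /h /w natrM; field; rewrite !gt_eqF.
pose al l : R := if 2 * z 0 l <= low Q 0 l + high Q 0 l then z 0 l else z 0 l - w.
have alP l : [/\ low Q 0 l <= al l, al l + w <= high Q 0 l, z 0 l - w <= al l & al l <= z 0 l].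
  have := hs l (ltn_ord l) l erefl; have := zb l; rewrite /al; case: ifP => [h1|/negbT].
    by move=> /andP[h2 h3] h4; split; lra.
  by rewrite -ltNge => h1 /andP[h2 h3] h4; split; lra.
have cell (c : 'I_a) : 0 <= c%:R * h /\ 2 * (c%:R * h) + 2 * h <= w.
  split; first by rewrite mulr_ge0// ltW.
  rewrite -ah -mulrA -mulrDr; apply: ler_wpM2l => //.
  by rewrite -[X in _ + X]mul1r -mulrDl; apply: ler_wpM2r; [exact: ltW|rewrite natr1 ler_nat].
have /choice[t tP] : forall c : 'I_a, exists t : R,
    al ord0 + 2 * (c%:R * h) < t < al ord0 + 2 * (c%:R * h) + h /\ generic Q t.
  move=> c; have [|t t1 t2] := @interval_avoid R (sx Q) (al ord0 + 2 * (c%:R * h)) (al ord0 + 2 * (c%:R * h) + h).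
    by rewrite ltrDl.
  by exists t.
pose cross l c := if l == ord0 then t c else al l + 2 * (c%:R * h).
have crossP l c : al l <= cross l c <= al l + w.
  have [h1 h2] := cell c; rewrite /cross; case: eqP => [->|_].
    have [/andP[h3 h4] _] := tP c; apply/andP; split; lra.
  by apply/andP; split; lra.
have cross_gap l c c' : c != c' -> h <= `|cross l c - cross l c'|.
  wlog cc : c c' / (c < c')%N.
    move=> wl; rewrite neq_ltn => /orP[cc|cc]; first by apply: wl; rewrite // neq_ltn cc.
    by rewrite distrC; apply: wl; rewrite // neq_ltn cc.
  move=> _; have h1 : c%:R * h + h <= c'%:R * h.
    by rewrite -[X in _ + X]mul1r -mulrDl; apply: ler_wpM2r; [exact: ltW|rewrite natr1 ler_nat].
  suff : h <= cross l c' - cross l c by rewrite distrC => /le_trans; apply; exact: ler_norm.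
  rewrite /cross; case: eqP => _; last by lra.
  by have [/andP[h3 h4] _] := tP c; have [/andP[h5 h6] _] := tP c'; lra.
pose Z (phi : {ffun 'I_m.+1 -> 'I_a}) (k : nat) : V :=
  \row_l if unlift i l is Some l' then cross l (phi l') else z 0 i + k%:R * h.
have Zi phi k : Z phi k 0 i = z 0 i + k%:R * h by rewrite mxE unlift_none.
have Zl phi k l : Z phi k 0 (lift i l) = cross (lift i l) (phi l) by rewrite mxE liftK.
have Zcross phi k l : l != i -> al l <= Z phi k 0 l <= al l + w.
  by rewrite eq_sym => /unlift_some[l' -> _]; rewrite Zl.
have Zgen phi k : generic Q (Z phi k 0 ord0).
  have /unlift_some[l ll _] : i != ord0 by [].
  by rewrite ll Zl /cross -ll eqxx; case: (tP (phi l)).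
have Zb phi k : (k <= a * q)%N -> cbox Q (Z phi k).
  move=> kM l; have [->|li] := eqVneq l i.
    rewrite Zi; have h1 : k%:R * h <= (a * q)%:R * h by rewrite ler_wpM2r ?ler_nat// ltW.
    have h2 : 0 <= k%:R * h by rewrite mulr_ge0// ltW.
    have h3 : (a * q)%:R * h = v - z 0 i by rewrite /h mulrC divfK// gt_eqF// natrM mulr_gt0.
    have /andP[h4 h5] := zb i; apply/andP; split; lra.
  by have /andP[h1 h2] := Zcross phi k l li; have [h3 h4 _ _] := alP l; apply/andP; split; lra.
have /choice[P0 P0P] : forall u : {ffun 'I_m.+1 -> 'I_a} * nat, exists p : X,
    (u.2 <= a * q)%N -> tau p = Z u.1 u.2.
  move=> u; have [le|lt] := leqP u.2 (a * q).
    have [p pE] := point_over (Zb u.1 _ le) (generic_off (Zgen u.1 u.2)); by exists p.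
  by have [p _] := outer_nonempty Q; exists p.
have PE phi k : (k <= a * q)%N -> tau (P0 (phi, k)) = Z phi k by exact: (P0P (phi, k)).
exists (fun phi k => P0 (phi, k)); split.
- move=> phi k kM; rewrite PE//; split=> // l li.
  have [h1 h2 h3 h4] := alP l; have /andP[h5 h6] := Zcross phi k l li.
  by rewrite ltr_norml; apply/andP; split; lra.
- move=> phi k kM.
  have ZS : Z phi k.+1 = upd (Z phi k) i (Z phi k.+1 0 i).
    apply/rowP => l; rewrite updE; have [->//|li] := eqVneq l i.
    by have := li; rewrite eq_sym => /unlift_some[l' -> _]; rewrite !Zl.
  have tk := PE phi k (ltnW kM); have tS := PE phi k.+1 kM.
  have : d (P0 (phi, k)) (P0 (phi, k.+1)) <= euclid_dist (tau (P0 (phi, k))) (tau (P0 (phi, k.+1))).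
    apply: vertical_slide; rewrite tk ?tS//.
    by rewrite ZS updE eq_sym (negbTE i0).
  move=> /le_trans; apply; rewrite tk tS ZS ed_upd !Zi -natr1 mulrDl mul1r.
  by rewrite addrA opprD addrA subrr sub0r normrN gtr0_norm.
move=> phi k phi' k' kM k'M ne.
suff [l hl] : exists l, h <= `|Z phi k 0 l - Z phi' k' 0 l|.
  by apply: le_trans hl _; rewrite -(PE _ _ kM) -(PE _ _ k'M); exact: tau_lipschitz.
have [e|/eqP/ffunP] := eqVneq phi phi'; last first.
  move/existsNP => [l /eqP ll]; exists (lift i l); rewrite !Zl; exact: cross_gap.
have kk : k != k' by apply/eqP => kk; apply: ne; rewrite e kk.
exists i; rewrite !Zi opprD addrACA subrr add0r -mulrBl normrM (gtr0_norm h0) ler_peMl//.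
  exact: ltW.
wlog lt : k k' kk {kM k'M ne} / (k < k')%N.
  move=> wl; move: (kk); rewrite neq_ltn => /orP[lt|lt]; first exact: wl.
  by rewrite distrC; apply: wl; rewrite // eq_sym.
by rewrite distrC -natrB 1?ltnW// normr_nat ler1n subn_gt0.
Qed.

End Grid.

(** * Short image curves avoiding a large set *)

Lemma le_add_power (R : realType) (s a : R) n : 0 <= s -> 0 < a -> s <= a + s ^+ n.+1 * a^-1 ^+ n.
Proof.
move=> s0 a0; have [sa|as_] := leP s a.
  by apply: le_trans sa _; rewrite lerDl mulr_ge0// exprn_ge0// invr_ge0 ltW.
rewrite exprS -mulrA -exprMn; apply: le_trans (_ : s * 1 <= _); first by rewrite mulr1.
apply: le_trans (_ : s * (s / a) ^+ n <= _); last by rewrite lerDr ltW.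
by apply: ler_wpM2l => //; apply: exprn_ege1; rewrite ler_pdivlMr// mul1r ltW.
Qed.

(** If the total energy is small, a line has a small sum, by Hölder's inequality
    and averaging. *)
Lemma short_line (R : realType) (F : finType) M n (s : F -> 'I_M -> R) (delta S : R) :
  0 < delta -> (0 < M)%N -> (forall phi k, 0 <= s phi k) ->
  \sum_phi \sum_k s phi k ^+ n.+1 <= S ->
  S * (2 * M%:R / delta) ^+ n < #|F|%:R * (delta / 2) ->
  exists phi, \sum_k s phi k < delta.
Proof.
move=> d0 M0 s0 sS small; apply: contrapT => none.
have long phi : delta <= \sum_k s phi k.
  by rewrite leNgt; apply/negP => h; apply: none; exists phi.
have M0' : 0 < M%:R :> R by rewrite ltr0n.
pose a := delta / (2 * M%:R); have a0 : 0 < a by rewrite divr_gt0// mulr_gt0.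
have aV : a^-1 = 2 * M%:R / delta by rewrite /a invf_div.
have : #|F|%:R * delta <= \sum_(phi : F) \sum_k s phi k.
  by rewrite mulr_natl -sumr_const; apply: ler_sum.
have : \sum_(phi : F) \sum_k s phi k <=
    \sum_(phi : F) \sum_(k < M) (a + s phi k ^+ n.+1 * a^-1 ^+ n).
  by apply: ler_sum => phi _; apply: ler_sum => k _; exact: le_add_power.
have -> : \sum_(phi : F) \sum_(k < M) (a + s phi k ^+ n.+1 * a^-1 ^+ n) =
    #|F|%:R * (delta / 2) + (\sum_phi \sum_k s phi k ^+ n.+1) * a^-1 ^+ n.
  under eq_bigr do rewrite big_split /= sumr_const card_ord -mulr_suml.
  rewrite big_split /= sumr_const -mulr_suml; congr (_ + _).
  by rewrite -[a *+ M]mulr_natr -[LHS]mulr_natl /a; field; rewrite !gt_eqF.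
have : (\sum_phi \sum_k s phi k ^+ n.+1) * a^-1 ^+ n <= S * (2 * M%:R / delta) ^+ n.
  by rewrite aV; apply: ler_wpM2r => //; rewrite exprn_ge0// divr_ge0 ?mulr_ge0 ?ltW.
move=> h1 h2 h3; have := le_trans h3 h2.
have -> : #|F|%:R * delta = #|F|%:R * (delta / 2) + #|F|%:R * (delta / 2) by field.
by rewrite lerD2l leNgt (le_lt_trans h1 small).
Qed.

Section Modulus.
Variables (R : realType) (m : nat) (Q : slits R m).
Local Notation V := 'rV[R]_m.+2.
Local Notation I := (open_box (low Q) (high Q)).
Local Notation X := (slit_space I (sset Q)).
Local Notation tau := (@tau R m Q).
Local Notation d := (@d R m Q).
Local Notation A := (@outer_boundary R m.+2 I (sset Q)).
Local Notation DX := (@Defs.double X A).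
Local Notation copy := (copy A).
Local Notation dd := (@dd R m Q).
Local Notation bx := (low Q, high Q).
Implicit Types (p q : X).

(** The boxes inside the balls, of volume comparable to a power of the radii, are
    disjoint from each other and from the boxes of L, which leave volume W. *)
Lemma packed_balls (T : finType) (P : pred T) (y : T -> X) (rad : T -> R) (B : T -> V * V)
    (c W : R) (L : seq (V * V)) : 0 < c ->
  (forall n, P n -> 0 < rad n /\ reg_box c (rad n) (y n) (B n)) ->
  (forall n n', P n -> P n' -> n != n' -> rad n + rad n' <= d (y n) (y n')) ->
  pairwise (@bsep R m.+2) L -> (forall D, D \in L -> inbox (low Q) (high Q) D) ->
  vol bx - W <= \sum_(D <- L) vol D ->
  (forall n D q, P n -> D \in L -> (forall i, D.1 0 i < D.2 0 i) ->
     (forall i, D.1 0 i <= tau q 0 i <= D.2 0 i) ->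
     rad n <= d (y n) q) ->
  \sum_(n | P n) (c * rad n) ^+ m.+2 <= W.
Proof.
move=> c0 reg sepd sepL inL volL avoid.
pose thick (D : V * V) := [forall i, D.1 0 i < D.2 0 i].
pose L' := [seq D <- L | thick D]; pose nodes := [seq n <- enum T | P n].
have volL' : \sum_(D <- L') vol D = \sum_(D <- L) vol D.
  rewrite big_filter [RHS](bigID thick) /= [X in _ + X]big1_seq ?addr0// => D /andP[+ DL].
  move=> /forallPn[i]; rewrite -leNgt => h; rewrite /vol (bigD1 i)//=.
  by have [_ h' _] := inL D DL i; rewrite (_ : D.2 0 i - D.1 0 i = 0) ?mul0r//; lra.
have := @packing R m.+2 (L' ++ map B nodes) (low Q) (high Q).
rewrite big_cat /= volL' big_map big_filter big_enum_cond /= => pack.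
have {pack} : \sum_(D <- L) vol D + \sum_(n | P n) vol (B n) <= vol bx.
  apply: pack.
  - by move=> i; exact/ltW/low_lt_high.
  - rewrite pairwise_cat; apply/and3P; split.
    + apply/allrelP => D _ /[!mem_filter] /andP[/forallP thickD DL] /mapP[n + ->].
      rewrite mem_filter => /andP[Pn _]; have [rad0 regn] := reg n Pn.
      apply: contraT => /(bsepPn thickD (reg_box_lt c0 rad0 regn))[lo [hi [lh lD hB]]].
      have [q [q1 _ q3]] := reg_box_point regn lh hB.
      suff : rad n <= d (y n) q by rewrite leNgt q3.
      apply: (avoid n D) => // i; have := q1 i; have [] := lD i.
      by move=> h1 h2 /andP[h3 h4]; apply/andP; split; lra.
    + by apply: subseq_pairwise sepL; exact: filter_subseq.
    + rewrite pairwise_map; have := enum_uniq T; rewrite /nodes; elim: (enum T) => //= n s ih.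
      move=> /andP[ns /ih{}ih]; case: ifP => // Pn /=; rewrite ih andbT.
      apply/allP => n'; rewrite mem_filter => /andP[Pn' n's] /=.
      have [rad0 regn] := reg n Pn; have [rad0' regn'] := reg n' Pn'.
      apply: (reg_box_sep c0 rad0 rad0' regn regn'); apply: sepd => //.
      by apply: contraNneq ns => ->.
  - move=> D; rewrite mem_cat mem_filter => /orP[/andP[_ /inL//]|/mapP[n + ->]].
    by rewrite mem_filter => /andP[/reg[_ [_ ? _]] _].
suff : \sum_(n | P n) (c * rad n) ^+ m.+2 <= \sum_(n | P n) vol (B n) by lra.
by apply: ler_sum => n /reg[rad0 regn]; exact: vol_reg_box regn.
Qed.

End Modulus.

Lemma telescope_le (R : realType) (u : nat -> R) M :
  `|u 0%N - u M| <= \sum_(k < M) `|u k - u k.+1|.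
Proof.
elim: M => [|M ih]; first by rewrite big_ord0 subrr normr0.
rewrite big_ord_recr /=; apply: le_trans (_ : `|u 0%N - u M| + `|u M - u M.+1| <= _).
  by rewrite (_ : u 0%N - u M.+1 = (u 0%N - u M) + (u M - u M.+1)) ?ler_normD//; ring.
exact: lerD.
Qed.

Section ShortCurves.
Variables (R : realType) (m : nat) (Q : slits R m).
Local Notation V := 'rV[R]_m.+2.
Local Notation I := (open_box (low Q) (high Q)).
Local Notation X := (slit_space I (sset Q)).
Local Notation tau := (@tau R m Q).
Local Notation d := (@d R m Q).
Local Notation A := (@outer_boundary R m.+2 I (sset Q)).
Local Notation DX := (@Defs.double X A).
Local Notation copy := (copy A).
Local Notation dd := (@dd R m Q).
Local Notation bx := (low Q, high Q).
Implicit Types (p q : X).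

Hypothesis por : porous_slits Q.
Variables (f : DX -> DX) (H : R).
Hypothesis H1 : 1 <= H.
Hypothesis weak : forall x y z, dd x y <= dd y z -> dd (f x) (f y) <= H * dd (f y) (f z).
Hypothesis finj : injective f.
Hypothesis funif : forall e : R, 0 < e ->
  exists2 r, 0 < r & forall x y, dd x y < r -> dd (f x) (f y) < e.

Variables (i : 'I_m.+2) (z : V) (v r : R) (b : bool).
Hypothesis i0 : i != ord0.
Hypothesis zb : cbox Q z.
Hypothesis vb : z 0 i < v <= high Q 0 i.
Hypothesis r0 : 0 < r.

Definition tube p := (forall l, l != i -> `|tau p 0 l - z 0 l| < r) /\ generic Q (tau p 0 ord0).

(** The function g is 1-Lipschitz on the image of the tube and does not change over
    a small step near a point of a box of L. *)
Definition frozen (g : DX -> R) (L : seq (V * V)) (e : R) := forall p q, tube p -> tube q ->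
  `|g (f (copy b p)) - g (f (copy b q))| <= dd (f (copy b p)) (f (copy b q)) /\
  (dd (f (copy b p)) (f (copy b q)) < e -> forall D c, D \in L ->
     (forall k, D.1 0 k < D.2 0 k) -> (forall k, D.1 0 k <= tau c 0 k <= D.2 0 k) ->
     d (fold (f (copy b p))) c < dd (f (copy b p)) (f (copy b q)) ->
     g (f (copy b p)) = g (f (copy b q))).

(** The balls around the images of the points of a fine grid, with radii
    comparable to the steps along the lines, are separated because f is
    quasisymmetric. Those that miss the boxes of L have small total volume, so
    on some line the steps that miss L are short altogether. *)
Lemma short_chain (delta : R) : 0 < delta -> exists2 W, 0 < W &
  forall (L : seq (V * V)) (e : R) (g : DX -> R), 0 < e ->
  pairwise (@bsep R m.+2) L -> (forall D, D \in L -> inbox (low Q) (high Q) D) ->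
  vol bx - W <= \sum_(D <- L) vol D -> frozen g L e ->
  exists p q, [/\ tube p, tube q, tau p 0 i = z 0 i, tau q 0 i = v &
    `|g (f (copy b p)) - g (f (copy b q))| < delta].
Proof.
move=> delta0; have H0 : 0 < H by exact: lt_le_trans H1.
have H2 : 1 <= 2 * H by rewrite mulr_natl mulr2n; apply: le_trans H1 _; rewrite lerDl ltW.
have [c c0 [r1 r10 boxes]] := reg_boxes por.
have [q q0 grid] := grid i0 zb vb r0.
have v0 : 0 < v - z 0 i by case/andP: vb; rewrite subr_gt0.
have q0' : 0 < q%:R :> R by rewrite ltr0n.
pose K := (2 * H / c) ^+ m.+2.
have K0 : 0 < K by rewrite exprn_gt0// divr_gt0// mulr_gt0.
pose K2 := (2 * q%:R / delta) ^+ m.+1.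
have K20 : 0 < K2 by rewrite exprn_gt0// divr_gt0// mulr_gt0.
pose W := delta / 4 / (2 * K * K2).
have W0 : 0 < W by apply: divr_gt0; [exact: divr_gt0|apply: mulr_gt0 => //; exact: mulr_gt0].
exists W => // L e g e0 sepL inL volL fr.
have e1 : 0 < Num.min e r1 by rewrite lt_min e0.
have [s s0 fs] := funif e1.
pose a := (Num.truncn ((v - z 0 i) / s)).+1.
have a0 : 0 < a%:R :> R by rewrite ltr0n.
have /= := grid a isT; set h := _ / _ => -[P [P1 P2 P3]].
pose M := (a * q)%N; have M0 : (0 < M)%N by rewrite muln_gt0.
have h0 : 0 < h by rewrite divr_gt0// ltr0n.
have hs : h < s.
  rewrite /h natrM ltr_pdivrMr ?mulr_gt0// mulrA; apply: lt_le_trans (_ : s * a%:R <= _).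
    by rewrite mulrC -ltr_pdivrMr// truncnS_gt.
  by rewrite ler_peMr ?ler1n//; apply/ltW/mulr_gt0.
pose x phi k : DX := f (copy b (P phi k)).
pose st phi k := dd (x phi k) (x phi k.+1).
have tb phi k : (k <= M)%N -> tube (P phi k) by move=> kM; have [t1 t2 _] := P1 phi k kM.
have st_small phi k : (k < M)%N -> st phi k < Num.min e r1.
  by move=> kM; apply: fs; rewrite dd_same; apply: le_lt_trans hs; exact: P2.
have neq phi k phi' k' : (k <= M)%N -> (k' <= M)%N -> (phi, k) <> (phi', k') ->
    x phi k <> x phi' k'.
  move=> kM k'M ne /finj/copy_eq[e' _]; have := P3 _ _ _ _ kM k'M ne.
  by rewrite e' d_xx leNgt h0.
have st_gt0 phi k : (k < M)%N -> 0 < st phi k.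
  move=> kM; rewrite lt_neqAle dd_ge0 andbT eq_sym; apply/eqP => /dd_eq0.
  by apply: neq => //; [exact: ltnW|case=> /n_Sn].
have st_sep phi k phi' k' : (k < M)%N -> (k' < M)%N -> (phi, k) <> (phi', k') ->
    st phi k <= H * dd (x phi k) (x phi' k').
  move=> kM k'M ne; rewrite /st dd_sym; apply: weak; rewrite !dd_same d_sym.
  by apply: le_trans (P2 _ _ kM) (P3 _ _ _ _ _ _ ne); exact: ltnW.
pose bad phi k := g (x phi k) != g (x phi k.+1).
pose sb phi (k : 'I_M) := if bad phi k then st phi k else 0.
pose T := ({ffun 'I_m.+1 -> 'I_a} * 'I_M)%type.
have sheet_bound (c' : bool) : \sum_(n : T | bad n.1 n.2 && (sheet (x n.1 n.2) == c'))
    (c * (st n.1 n.2 / (2 * H))) ^+ m.+2 <= W.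
  have rad0 (n : T) : 0 < st n.1 n.2 / (2 * H) by rewrite divr_gt0 ?mulr_gt0// st_gt0.
  have /choice[B hB] : forall n : T, exists B, reg_box c (st n.1 n.2 / (2 * H)) (fold (x n.1 n.2)) B.
    move=> n; apply: boxes; rewrite rad0 /=; have := st_small n.1 n.2 (ltn_ord _).
    rewrite lt_min => /andP[_]; apply: le_lt_trans; rewrite ler_pdivrMr ?mulr_gt0//.
    by rewrite ler_peMr ?dd_ge0.
  apply: (@packed_balls _ _ Q T _ (fun n => fold (x n.1 n.2)) _ B _ _ L) => //.
  - move=> n n' /andP[_ /eqP sn] /andP[_ /eqP sn'] nn'.
    have ne : (n.1, n.2 : nat) <> (n'.1, n'.2 : nat).
      case=> n1 n2; move/eqP: nn'; apply; rewrite [n]surjective_pairing [n']surjective_pairing n1.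
      by congr pair; exact: val_inj.
    have h1 := st_sep _ _ _ _ (ltn_ord n.2) (ltn_ord n'.2) ne.
    have h2 := st_sep _ _ _ _ (ltn_ord n'.2) (ltn_ord n.2) (nesym ne).
    have <- : dd (x n.1 n.2) (x n'.1 n'.2) = d (fold (x n.1 n.2)) (fold (x n'.1 n'.2)).
      by rewrite -(copyK (x n.1 n.2)) -(copyK (x n'.1 n'.2)) sn sn' dd_same !fold_copy.
    rewrite dd_sym in h2.
    rewrite -mulrDl ler_pdivrMr ?mulr_gt0//; move: h1 h2; move: (dd _ _) (st _ _) (st _ _) => *; lra.
  - move=> n D c1 /andP[badn _] DL thickD cD; rewrite leNgt; apply/negP => near.
    move/eqP: badn; apply; have nM := ltn_ord n.2.
    have [_ fr2] := fr _ _ (tb n.1 _ (ltnW nM)) (tb n.1 _ nM).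
    have := st_small n.1 n.2 nM; rewrite lt_min => /andP[se _].
    apply: (fr2 se D c1) => //; apply: lt_le_trans near _.
    by rewrite ler_pdivrMr ?mulr_gt0// ler_peMr ?dd_ge0.
have [phi hphi] : exists phi, \sum_k sb phi k < delta.
  apply: (@short_line R _ M m.+1 sb delta (2 * K * W)) => //.
  - by move=> phi k; rewrite /sb; case: ifP => // _; exact: dd_ge0.
  - rewrite pair_bigA /=.
    have -> : \sum_(n : T) sb n.1 n.2 ^+ m.+2 = K * (\sum_(c' : bool)
        \sum_(n : T | bad n.1 n.2 && (sheet (x n.1 n.2) == c')) (c * (st n.1 n.2 / (2 * H))) ^+ m.+2).
      rewrite -(partition_big (fun n : T => sheet (x n.1 n.2)) xpredT)//=.
      rewrite mulr_sumr [RHS]big_mkcond; apply: eq_bigr => n _; rewrite /sb; case: ifP => _.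
        rewrite -exprMn; congr (_ ^+ _); field; rewrite !gt_eqF//.
      by rewrite expr0n.
    rewrite big_bool /=; have := sheet_bound true; have := sheet_bound false.
    move: (\sum_(n : T | _ ) _) (\sum_(n : T | _) _) => u w h1 h2.
    rewrite (_ : 2 * K * W = K * (2 * W)); last by ring.
    by apply: ler_wpM2l; [exact: ltW|lra].
  rewrite card_ffun !card_ord natrX /M natrM.
  have -> : 2 * (a%:R * q%:R) / delta = a%:R * (2 * q%:R / delta) :> R by ring.
  rewrite exprMn -/K2 (_ : 2 * K * W * (a%:R ^+ m.+1 * K2) = a%:R ^+ m.+1 * (delta / 4)); last first.
    by rewrite /W; field; rewrite !gt_eqF.
  rewrite ltr_pM2l ?exprn_gt0//; lra.
have M1 := leqnn M; have [_ _ e2] := P1 phi 0%N (leq0n _); have [_ _ e3] := P1 phi M M1.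
exists (P phi 0%N), (P phi M); split; [exact: tb|exact: tb|by rewrite e2 mul0r addr0| |].
  by rewrite e3 /h mulrC divfK ?gt_eqF ?ltr0n//; ring.
apply: le_lt_trans hphi; apply: le_trans (telescope_le (fun k => g (x phi k)) M) _.
apply: ler_sum => k _; rewrite /sb /bad; case: eqP => /= [->|_]; first by rewrite subrr normr0.
by have [h1 _] := fr _ _ (tb phi _ (ltnW (ltn_ord k))) (tb phi _ (ltn_ord k)).
Qed.

End ShortCurves.

(** * Embeddings preserve the slices orthogonal to the first axis *)
Section Slices.
Variables (R : realType) (m : nat) (Q : slits R m).
Local Notation V := 'rV[R]_m.+2.
Local Notation I := (open_box (low Q) (high Q)).
Local Notation X := (slit_space I (sset Q)).
Local Notation tau := (@tau R m Q).
Local Notation d := (@d R m Q).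
Local Notation A := (@outer_boundary R m.+2 I (sset Q)).
Local Notation DX := (@Defs.double X A).
Local Notation copy := (copy A).
Local Notation dd := (@dd R m Q).
Local Notation bx := (low Q, high Q).
Local Notation i1 := (i1 m).
Implicit Types (p q : X) (b c : bool) (x y : DX) (z : V).

Hypothesis por : porous_slits Q.
Variables (f : DX -> DX) (H : R).
Hypothesis H1 : 1 <= H.
Hypothesis weak : forall x y (z : DX), dd x y <= dd y z -> dd (f x) (f y) <= H * dd (f y) (f z).
Hypothesis finj : injective f.
Hypothesis funif : forall e : R, 0 < e ->
  exists2 r, 0 < r & forall x y, dd x y < r -> dd (f x) (f y) < e.

Definition hor x : R := tau (fold x) 0 ord0.

Lemma hor_copy b p : hor (copy b p) = tau p 0 ord0.
Proof. by rewrite /hor fold_copy. Qed.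

Lemma hor_dd x y : `|hor x - hor y| <= dd x y.
Proof. exact: tau_dd. Qed.

Lemma near_point (p : X) b (e : R) : offslits Q (tau p) -> 0 < e -> exists2 r, 0 < r &
  forall p', (forall i, `|tau p' 0 i - tau p 0 i| < r) -> dd (f (copy b p')) (f (copy b p)) < e.
Proof.
move=> off e0; have [s s0 fs] := funif e0; have [r r0 h] := tau_inv_cont por off s0.
by exists r => // p' pp'; apply: fs; rewrite dd_same; exact: h.
Qed.

Lemma tube_near i z (v r : R) p p' : tube i z r p' -> 0 < r -> tau p 0 i = v -> tau p' 0 i = v ->
  (forall l, l != i -> tau p 0 l = z 0 l) -> forall l, `|tau p' 0 l - tau p 0 l| < r.
Proof.
move=> [tb _] r0 pv p'v pz l; have [->|li] := eqVneq l i; first by rewrite pv p'v subrr normr0.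
by rewrite pz// tb.
Qed.

(** The first coordinate of the image is changed by little into a function that is
    constant near boxes filling nearly everything; along the images of some lines
    next to the segment from p to q it hardly changes at all. *)
Lemma slice_move i z v b p q : i != ord0 -> generic Q (z 0 ord0) -> z 0 i < v <= high Q 0 i ->
  tau p = z -> tau q = upd z i v -> hor (f (copy b p)) = hor (f (copy b q)).
Proof.
move=> i0 gz vb pz qz; apply/eqP; rewrite -subr_eq0 -normr_le0.
apply/ler_addgt0Pr => e e0; rewrite add0r.
have zb : cbox Q z by rewrite -pz; exact: tau_cbox.
have offp : offslits Q (tau p) by rewrite pz; exact: generic_off.
have offq : offslits Q (tau q) by apply: generic_off; rewrite qz updE eq_sym (negbTE i0).
have e8 : 0 < e / 8 by rewrite divr_gt0.
have [r1 r10 np] := near_point b offp e8; have [r2 r20 nq] := near_point b offq e8.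
have r0 : 0 < Num.min r1 r2 by rewrite lt_min r10.
have e40 : 0 < e / 40 by rewrite divr_gt0.
have [W W0 short] := short_chain por H1 weak finj funif b i0 zb vb r0 e40.
have W1 : 0 < Num.min W (e / 8) by rewrite lt_min W0.
have [U [L [[L1 L2 L3] [U1 U2 [r r'0 U3]]]]] := jump_function por W1.
have r2' : 0 < r / 2 by rewrite divr_gt0.
have [||p' [q' [tp tq pi qi close]]] := short L (r / 2) (fun x => U (fold x) / 5) r2' L1 L2.
- by apply: le_trans L3; rewrite lerD2l lerN2 ge_min lexx.
- move=> u w _ _; set x := f _; set y := f _; have h1 := U1 (fold x) (fold y).
  have h2 := dd_fold x y; split.
    rewrite -mulrBl normrM [X in _ * X]ger0_norm// ler_pdivrMr//.
    by apply: le_trans h1 _; rewrite mulrC ler_pM2r.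
  move=> xyr D c DL _ cD xc; congr (_ / _); rewrite -(U3 D c (fold x))//.
    by apply: (U3 D) => //; have := d_triangle (fold x) c (fold y); rewrite (d_sym c (fold x)); lra.
  by rewrite d_sym; lra.
have p'p : dd (f (copy b p')) (f (copy b p)) < e / 8.
  apply: np => l; apply: lt_le_trans (tube_near tp r0 _ pi _ l) _; rewrite ?pz//.
  by rewrite ge_min lexx.
have q'q : dd (f (copy b q')) (f (copy b q)) < e / 8.
  apply: nq => l; apply: lt_le_trans (tube_near tq r0 _ qi _ l) _.
  - by rewrite qz updE eqxx.
  - by move=> k ki; rewrite qz updE (negbTE ki).
  - by rewrite ge_min lexx orbT.
have := hor_dd (f (copy b p')) (f (copy b p)); have := hor_dd (f (copy b q')) (f (copy b q)).
have := U2 (fold (f (copy b p'))); have := U2 (fold (f (copy b q'))).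
have e8' : Num.min W (e / 8) <= e / 8 by rewrite ge_min lexx orbT.
move: close p'p q'q e8'; rewrite /hor -mulrBl normrM [X in _ * X < _]ger0_norm//.
rewrite ltr_pdivrMr//; move: (Num.min W _) (U _) (U _) (dd _ _) (dd _ _).
move: (tau _ _ _) (tau _ _ _) (tau _ _ _) (tau _ _ _) => t1 t2 t3 t4 w u1 u2 d1 d2.
rewrite ltr_norml !ler_norml => /andP[? ?] ? ? ? /andP[? ?] /andP[? ?] /andP[? ?] /andP[? ?].
by apply/andP; split; lra.
Qed.

Lemma slice_half b p q : tau p 0 ord0 = tau q 0 ord0 -> generic Q (tau p 0 ord0) ->
  hor (f (copy b p)) = hor (f (copy b q)).
Proof.
suff sub (r : seq 'I_m.+2) : forall p, tau p 0 ord0 = tau q 0 ord0 -> generic Q (tau p 0 ord0) ->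
    (forall l, l \notin r -> tau p 0 l = tau q 0 l) -> hor (f (copy b p)) = hor (f (copy b q)).
  by move=> pq gp; apply: (sub (enum 'I_m.+2)) => // l; rewrite mem_enum.
elim: r => [|i r ih] {}p pq gp same.
  have e : tau p = tau q by apply/rowP => l; exact: same.
  by rewrite (fiber_unique e (generic_off gp)).
have [i0|i0] := eqVneq i ord0.
  apply: ih => // l lr; have [->//|li] := eqVneq l i; first by rewrite i0.
  by apply: same; rewrite inE negb_or li.
pose z := upd (tau p) i (tau q 0 i).
have zb : cbox Q z.
  by move=> l; rewrite updE; case: eqP => [->|_]; exact: tau_cbox.
have z0 : z 0 ord0 = tau p 0 ord0 by rewrite updE eq_sym (negbTE i0).
have gz : generic Q (z 0 ord0) by rewrite z0.
have [p' p'z] := point_over zb (generic_off gz).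
transitivity (hor (f (copy b p'))); last first.
  apply: ih => [||l lr]; rewrite p'z ?z0// updE; case: eqP => [->//|/eqP li].
  by apply: same; rewrite inE negb_or li.
case: (ltrgtP (tau p 0 i) (tau q 0 i)) => h.
- by apply: (@slice_move i (tau p) (tau q 0 i)) => //; rewrite h; case/andP: (tau_cbox q i).
- apply/esym; apply: (@slice_move i z (tau p 0 i)) => //.
    by rewrite updE eqxx h; case/andP: (tau_cbox p i).
  by apply/rowP => l; rewrite !updE; case: eqP => [->|].
have e : tau p' = tau p by rewrite p'z; apply/rowP => l; rewrite updE; case: eqP => [->|].
by rewrite (fiber_unique e)//; rewrite e; exact: generic_off.
Qed.

Lemma edge_point t : low Q 0 ord0 <= t <= high Q 0 ord0 -> exists p, tau p = edge Q t.
Proof. by move=> tb; apply: (point_over (edge_cbox tb)); exact: edge_off. Qed.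

Lemma edge_outer p t : tau p = edge Q t -> A p.
Proof. by move=> pt; apply/outerP; rewrite pt => /(_ i1); rewrite updE /= ltxx. Qed.

Lemma slice x y : hor x = hor y -> generic Q (hor x) -> hor (f x) = hor (f y).
Proof.
have [p [pt Ap]] : exists p, tau p 0 ord0 = hor x /\ A p.
  have [p pe] := edge_point (tau_cbox (fold x) ord0).
  by exists p; split; [rewrite pe updE|exact: edge_outer pe].
rewrite -(copyK x) -(copyK y); move: (sheet x) (sheet y) => b c.
rewrite /hor !fold_copy => xy gx; transitivity (hor (f (copy b p))).
  by apply: slice_half; rewrite ?pt /hor.
have -> : copy b p = copy c p by apply/copy_eq; split=> //; right.
by apply: slice_half; rewrite pt /hor.
Qed.

(** Otherwise all the slices in a slab are mapped into one slice. Up to a thin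
    slab, its complement consists of two boxes. The images of lines stay away from
    them, so some are short, although they join the images of different points. *)
Lemma slab_not_flat (t1 t2 t' : R) : low Q 0 ord0 <= t1 -> t1 < t2 -> t2 <= high Q 0 ord0 ->
  exists x, [/\ t1 <= hor x <= t2, generic Q (hor x) & hor (f x) <> t'].
Proof.
move=> lt1 t12 t2h; apply: contrapT => none.
have flat x : t1 <= hor x <= t2 -> generic Q (hor x) -> hor (f x) = t'.
  by move=> xt gx; apply: contrapT => h; apply: none; exists x.
have [t /andP[t1t tt2] gt] := interval_avoid (sx Q) t12.
pose z := upd (mid Q) ord0 t.
have gz : generic Q (z 0 ord0) by rewrite updE.
have zb : cbox Q z.
  move=> l; rewrite updE; case: eqP => [->|_]; first by apply/andP; split; lra.
  by have := low_lt_high Q l; rewrite !mxE => h; apply/andP; split; lra.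
have i10 : i1 != ord0 by [].
have vb : z 0 i1 < high Q 0 i1 <= high Q 0 i1.
  by rewrite lexx andbT updE (negbTE i10) mxE; have := low_lt_high Q i1; lra.
have wb : cbox Q (upd z i1 (high Q 0 i1)).
  by move=> l; rewrite updE; case: eqP => [->|_]; [rewrite lexx andbT ltW// low_lt_high|exact: zb].
have gw : generic Q (upd z i1 (high Q 0 i1) 0 ord0) by rewrite !updE.
have [p pz] := point_over zb (generic_off gz); have [q qz] := point_over wb (generic_off gw).
have offp : offslits Q (tau p) by rewrite pz; exact: generic_off.
have offq : offslits Q (tau q) by rewrite qz; exact: generic_off.
have pq : copy true p <> copy true q.
  move/copy_eq => [e _]; have := congr1 (fun p : X => tau p 0 i1) e.
  rewrite /= pz qz [RHS]updE eqxx => e'; by move: vb; rewrite e' ltxx.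
have t'b : low Q 0 ord0 <= t' <= high Q 0 ord0.
  rewrite -(flat (copy true p)); first exact: tau_cbox.
    by rewrite /hor fold_copy pz updE eqxx; apply/andP; split; exact: ltW.
  by rewrite /hor fold_copy pz.
apply: pq; apply: finj; apply: dd_eq0; apply/eqP; rewrite eq_le dd_ge0 andbT.
apply/ler_addgt0Pr => e e0; rewrite add0r.
have e4 : 0 < e / 4 by rewrite divr_gt0.
have [r1 r10 np] := near_point true offp e4; have [r2 r20 nq] := near_point true offq e4.
pose r := Num.min (Num.min r1 r2) (Num.min (t - t1) (t2 - t)).
have r0 : 0 < r by rewrite !lt_min r10 r20 !subr_gt0 t1t.
have [ra rb rc rd] : [/\ r <= r1, r <= r2, r <= t - t1 & r <= t2 - t].
  by split; rewrite !ge_min lexx ?orbT.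
have [W W0 short] := short_chain por H1 weak finj funif true i10 zb vb r0 e4.
pose face := \prod_(i < m.+1) (high Q 0 (lift ord0 i) - low Q 0 (lift ord0 i)).
have face0 : 0 < face by apply: prodr_gt0 => i _; rewrite subr_gt0 low_lt_high.
pose k := W / (2 * face); have k0 : 0 < k by rewrite divr_gt0// mulr_gt0.
pose v1 := Num.max (low Q 0 ord0) (t' - k); pose v2 := Num.min (high Q 0 ord0) (t' + k).
have [l0 l1] := andP t'b.
have [a1 a2 a3 a4] : [/\ low Q 0 ord0 <= v1, v1 <= t', t' - k <= v1 & low Q 0 ord0 < v1 -> v1 = t' - k].
  rewrite /v1; case: (lerP (low Q 0 ord0) (t' - k)) => h; split=> //; by [lra|move=> ?; lra].
have [b1 b2 b3 b4] : [/\ v2 <= high Q 0 ord0, t' <= v2, v2 <= t' + k & v2 < high Q 0 ord0 -> v2 = t' + k].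
  rewrite /v2; case: (lerP (high Q 0 ord0) (t' + k)) => h; split=> //; by [lra|move=> ?; lra].
pose D1 : V * V := (low Q, upd (high Q) ord0 v1).
pose D2 : V * V := (upd (low Q) ord0 v2, high Q).
have vol1 (lo hi : V) : (forall i, lo 0 (lift ord0 i) = low Q 0 (lift ord0 i)) ->
    (forall i, hi 0 (lift ord0 i) = high Q 0 (lift ord0 i)) ->
    vol (lo, hi) = (hi 0 ord0 - lo 0 ord0) * face.
  move=> hlo hhi; rewrite /vol big_ord_recl /=; congr (_ * _).
  by apply: eq_bigr => i _; rewrite hlo hhi.
have tubeflat u : tube i1 z r u -> hor (f (copy true u)) = t'.
  move=> [tu gu]; apply: flat; last by rewrite /hor fold_copy.
  have := tu ord0 isT.
  by rewrite /hor fold_copy [z 0 ord0]updE eqxx ltr_norml => /andP[h1 h2]; apply/andP; split; lra.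
have [||||p' [q' [tp tq pi qi close]]] :=
  short [:: D1; D2] k (fun x => dd (f (copy true p)) x) k0.
- by rewrite /= !andbT; apply/existsP; exists ord0; rewrite !updE !eqxx (le_trans a2 b2).
- move=> D; rewrite !inE => /orP[] /eqP -> l; have := low_lt_high Q l => h.
    change [/\ low Q 0 l <= low Q 0 l, low Q 0 l <= upd (high Q) ord0 v1 0 l &
      upd (high Q) ord0 v1 0 l <= high Q 0 l].
    by rewrite updE; case: eqP => [->|_]; split=> //; lra.
  change [/\ low Q 0 l <= upd (low Q) ord0 v2 0 l, upd (low Q) ord0 v2 0 l <= high Q 0 l &
      high Q 0 l <= high Q 0 l].
  by rewrite updE; case: eqP => [->|_]; split=> //; lra.
- rewrite !big_cons big_nil addr0 (vol1 (low Q) (high Q))// !vol1//; try by move=> i; rewrite updE.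
  rewrite !updE eqxx; have : (v2 - v1) * face <= 2 * k * face by apply: ler_wpM2r; [exact: ltW|lra].
  by rewrite (_ : 2 * k * face = W); [lra|rewrite /k; field; rewrite gt_eqF].
- move=> u w tu tw; set x := f (copy true u); set y := f (copy true w); split.
    have h1 := dd_triangle x (f (copy true p)) y; have h2 := dd_triangle y (f (copy true p)) x.
    by rewrite ler_norml; rewrite (dd_sym y x) in h2; apply/andP; split; lra.
  move=> xyk D c DL thick cD xc.
  have : `|tau (fold x) 0 ord0 - tau c 0 ord0| < k.
    by apply: le_lt_trans (tau_lipschitz _ _ _) _; exact: lt_trans xyk.
  have -> : tau (fold x) 0 ord0 = t' by exact: tubeflat.
  rewrite ltr_norml => /andP[h1 h2]; exfalso.
  move: DL thick cD; rewrite !inE => /orP[] /eqP -> /(_ ord0) + /(_ ord0); rewrite updE eqxx /=.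
    by move=> /a4 e1 /andP[_]; lra.
  by move=> /b4 e1 /andP[+ _]; lra.
have p'p : dd (f (copy true p')) (f (copy true p)) < e / 4.
  apply: np => l; apply: lt_le_trans (tube_near tp r0 _ pi _ l) ra; first by rewrite pz.
  by move=> i _; rewrite pz.
have q'q : dd (f (copy true q')) (f (copy true q)) < e / 4.
  apply: nq => l; apply: lt_le_trans (tube_near tq r0 _ qi _ l) rb.
  - by rewrite qz updE eqxx.
  - by move=> i ii; rewrite qz updE (negbTE ii).
have := dd_triangle (f (copy true q')) (f (copy true p)) (f (copy true q)).
rewrite dd_sym in p'p; move: close; rewrite ltr_norml => /andP[h1 h2].
move: p'p q'q h1 h2; move: (dd _ _) (dd _ _) (dd _ _) (dd _ _) => *; lra.
Qed.

End Slices.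

(** * The gauge of a cube at an interior point *)
Section Gauge.
Variables (R : realType) (n : nat) (c : 'rV[R]_n).
Hypothesis c_inside : forall l, -1 < c 0 l < 1.
Implicit Types (y : 'rV[R]_n).

(** The least factor by which the cube, dilated from c, contains y. *)
Definition gauge y : R := \big[Num.max/0]_l
  Num.max ((y 0 l - c 0 l) / (1 - c 0 l)) ((c 0 l - y 0 l) / (1 + c 0 l)).

Let sides l : 0 < 1 - c 0 l /\ 0 < 1 + c 0 l.
Proof. by have /andP[h1 h2] := c_inside l; split; lra. Qed.

Lemma gauge_ge0 y : 0 <= gauge y.
Proof. exact: bigmax_ge_id. Qed.

Lemma gauge_ge y l : y 0 l - c 0 l <= gauge y * (1 - c 0 l) /\ c 0 l - y 0 l <= gauge y * (1 + c 0 l).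
Proof.
have [s1 s2] := sides l; have : Num.max ((y 0 l - c 0 l) / (1 - c 0 l)) ((c 0 l - y 0 l) / (1 + c 0 l)) <= gauge y.
  exact: le_bigmax.
by rewrite ge_max !ler_pdivrMr// => /andP[].
Qed.

Lemma gauge_le y (v : R) : 0 <= v ->
  (forall l, y 0 l - c 0 l <= v * (1 - c 0 l) /\ c 0 l - y 0 l <= v * (1 + c 0 l)) -> gauge y <= v.
Proof.
move=> v0 h; apply: bigmax_le => // l _; have [s1 s2] := sides l; have [h1 h2] := h l.
by rewrite ge_max !ler_pdivrMr// h1.
Qed.

Lemma gauge_le1 y : cube y -> gauge y <= 1.
Proof.
move=> yc; apply: gauge_le => // l; have := yc l; rewrite ler_norml => /andP[h1 h2].
by split; lra.
Qed.

Lemma gauge_boundary y l : `|y 0 l| = 1 -> 1 <= gauge y.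
Proof.
have [s1 s2] := sides l; have [h1 h2] := gauge_ge y l.
have [y0|y0] := leP 0 (y 0 l); [rewrite ger0_norm//|rewrite ltr0_norm//] => y1.
  by rewrite -(ler_pM2r s1) mul1r; lra.
by rewrite -(ler_pM2r s2) mul1r; lra.
Qed.

Lemma gauge_inside y : (forall l, `|y 0 l| < 1) -> gauge y < 1.
Proof.
move=> h; apply: bigmax_lt => // l _; have [s1 s2] := sides l.
have := h l; rewrite ltr_norml => /andP[h1 h2].
by rewrite gt_max !ltr_pdivrMr//; apply/andP; split; lra.
Qed.

Lemma gauge_coord y l : `|y 0 l - c 0 l| <= 2 * gauge y.
Proof.
have [h1 h2] := gauge_ge y l; have g0 := gauge_ge0 y; have /andP[h3 h4] := c_inside l.
have h5 : 0 <= gauge y * (1 + c 0 l) by apply: mulr_ge0; lra.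
have h6 : 0 <= gauge y * (1 - c 0 l) by apply: mulr_ge0; lra.
by rewrite mulrDr mulr1 in h2 h5; rewrite mulrBr mulr1 in h1 h6; rewrite ler_norml; apply/andP; split; lra.
Qed.

Lemma gauge_lipschitz : exists2 K, 0 < K & forall y y' (e : R),
  0 <= e -> (forall l, `|y 0 l - y' 0 l| <= e) -> `|gauge y - gauge y'| <= K * e.
Proof.
have [s s0 hs] : exists2 s, 0 < s & forall k, (k < n)%N -> forall l : 'I_n, l = k :> nat ->
    s <= 1 - c 0 l /\ s <= 1 + c 0 l.
  apply: finite_radius => [k e e' le h l lk|k kn]; first by have [h1 h2] := h l lk; split; lra.
  have [s1 s2] := sides (Ordinal kn).
  exists (Num.min (1 - c 0 (Ordinal kn)) (1 + c 0 (Ordinal kn))); first by rewrite lt_min s1.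
  move=> l lk; have -> : l = Ordinal kn by exact: val_inj.
  by rewrite !ge_min !lexx orbT.
exists s^-1 => [|y y' e e0 yy']; first by rewrite invr_gt0.
suff le (u w : 'rV[R]_n) : (forall l, `|u 0 l - w 0 l| <= e) -> gauge u - gauge w <= s^-1 * e.
  have h1 := le y y' yy'; have h2 : gauge y' - gauge y <= s^-1 * e.
    by apply: le => l; rewrite distrC.
  by rewrite ler_norml; apply/andP; split; lra.
have se0 : 0 <= s^-1 * e by rewrite mulr_ge0// invr_ge0 ltW.
move=> uw; rewrite lerBlDr; apply: gauge_le => [|l]; first by rewrite addr_ge0 ?gauge_ge0.
have [h1 h2] := gauge_ge w l; have [g1 g2] := hs l (ltn_ord l) l erefl.
have := uw l; rewrite ler_norml => /andP[h3 h4].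
have se : s^-1 * e * s = e by rewrite mulrC mulrA divff ?mul1r// gt_eqF.
have h5 : s^-1 * e * s <= s^-1 * e * (1 - c 0 l) by exact: ler_wpM2l.
have h6 : s^-1 * e * s <= s^-1 * e * (1 + c 0 l) by exact: ler_wpM2l.
by split; rewrite mulrDl; lra.
Qed.

Lemma gauge_scale y y' (a a' : R) : 0 <= a -> 0 <= a' ->
  (forall l, (y 0 l - c 0 l) * a = (y' 0 l - c 0 l) * a') -> gauge y * a = gauge y' * a'.
Proof.
move=> a0 a'0 h; suff le (u w : 'rV[R]_n) (s t : R) : 0 <= s -> 0 <= t ->
    (forall l, (u 0 l - c 0 l) * s = (w 0 l - c 0 l) * t) -> gauge u * s <= gauge w * t.
  by apply/eqP; rewrite eq_le !le// => l; rewrite h.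
move=> + t0 uw; rewrite le_eqVlt => /orP[/eqP <-|s0]; first by rewrite mulr0 mulr_ge0 ?gauge_ge0.
rewrite -ler_pdivlMr//; apply: gauge_le => [|l].
  by apply: divr_ge0; [apply: mulr_ge0; rewrite ?gauge_ge0|exact: ltW].
have [h1 h2] := gauge_ge w l; rewrite -!mulrA ![_^-1 * _]mulrC !mulrA.
split; rewrite ler_pdivlMr//.
  by rewrite uw mulrAC; apply: ler_wpM2r.
by rewrite -opprB mulNr uw -mulNr opprB mulrAC; apply: ler_wpM2r.
Qed.

End Gauge.

(** * Slices as spheres *)
Section SliceSphere.
Variables (R : realType) (m : nat) (Q : slits R m).
Local Notation V := 'rV[R]_m.+2.
Local Notation W := 'rV[R]_m.+1.
Local Notation I := (open_box (low Q) (high Q)).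
Local Notation X := (slit_space I (sset Q)).
Local Notation tau := (@tau R m Q).
Local Notation d := (@d R m Q).
Local Notation A := (@outer_boundary R m.+2 I (sset Q)).
Local Notation DX := (@Defs.double X A).
Local Notation copy := (copy A).
Local Notation dd := (@dd R m Q).
Local Notation hor := (@hor R m Q).
Implicit Types (p q : X) (b : bool) (x : DX) (y : W) (t e : R).

Local Notation half l := ((high Q 0 (lift ord0 l) - low Q 0 (lift ord0 l)) / 2).

Lemma half_gt0 (l : 'I_m.+1) : 0 < half l.
Proof. by rewrite divr_gt0// subr_gt0 low_lt_high. Qed.

(** The last coordinates, normalized to run through [-1, 1]. *)
Definition vert p : W := \row_l ((tau p 0 (lift ord0 l) - mid Q 0 (lift ord0 l)) / half l).

Definition vpoint t y : V :=
  \row_i if unlift ord0 i is Some l then mid Q 0 i + half l * y 0 l else t.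

Lemma vpoint0 t y : vpoint t y 0 ord0 = t.
Proof. by rewrite mxE unlift_none. Qed.

Lemma vpoint_lift t y l : vpoint t y 0 (lift ord0 l) = mid Q 0 (lift ord0 l) + half l * y 0 l.
Proof. by rewrite mxE liftK. Qed.

Lemma vert_vpoint p t y : tau p = vpoint t y -> vert p = y.
Proof.
move=> e; apply/rowP => l; rewrite mxE e vpoint_lift addrAC subrr add0r.
by rewrite mulrC mulrA mulVf ?mul1r// gt_eqF// half_gt0.
Qed.

Lemma tau_vert p l : tau p 0 (lift ord0 l) = mid Q 0 (lift ord0 l) + half l * vert p 0 l.
Proof. by rewrite [vert p 0 l]mxE [half l * _]mulrC divfK ?gt_eqF ?half_gt0//; ring. Qed.

Lemma vert_inj p q : tau p 0 ord0 = tau q 0 ord0 -> vert p = vert q -> tau p = tau q.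
Proof.
move=> h v; apply/rowP => i; case: (unliftP ord0 i) => [l|] -> //.
by rewrite !tau_vert v.
Qed.

Lemma vert_cube p : cube (vert p).
Proof.
move=> l; have := tau_cbox p (lift ord0 l); rewrite tau_vert [mid _ _ _]mxE => h.
have h0 := half_gt0 l; rewrite ler_norml -(ler_pM2l h0) -[X in _ && X](ler_pM2l h0).
by rewrite mulrN1 mulr1; move: (half l * _) h => s /andP[h1 h2]; apply/andP; split; lra.
Qed.

Lemma vert_lipschitz : exists2 C, 0 < C & forall p q l, `|vert p 0 l - vert q 0 l| <= C * d p q.
Proof.
have [s s0 hs] : exists2 s, 0 < s & forall k, (k < m.+1)%N -> forall l : 'I_m.+1, l = k :> nat ->
    s <= half l.
  apply: finite_radius => [k e e' le h l lk|k km]; first by apply: le_trans le _; exact: h.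
  exists (half (Ordinal km)) => [|l lk]; first exact: half_gt0.
  by have -> : l = Ordinal km by exact: val_inj.
exists s^-1 => [|p q l]; first by rewrite invr_gt0.
rewrite !mxE -mulrBl opprB addrA subrK normrM normfV (gtr0_norm (half_gt0 l)) mulrC.
apply: ler_pM => //; first by rewrite invr_ge0 ltW// half_gt0.
  by rewrite lef_pV2 ?posrE ?half_gt0//; exact: hs (ltn_ord l) l erefl.
exact: tau_lipschitz.
Qed.

Lemma outer_vert p : low Q 0 ord0 < tau p 0 ord0 < high Q 0 ord0 ->
  A p <-> exists l, `|vert p 0 l| = 1.
Proof.
move=> p0; rewrite outerP; split=> [nI|[l hl] Ip].
  apply: contrapT => none; apply: nI => i; case: (unliftP ord0 i) => [l|] -> //.
  have lt1 : `|vert p 0 l| < 1.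
    by rewrite lt_neqAle vert_cube andbT; apply/eqP => h; apply: none; exists l.
  rewrite tau_vert [mid _ _ _]mxE; have h0 := half_gt0 l.
  move: lt1; rewrite ltr_norml -(ltr_pM2l h0) -[X in _ && X](ltr_pM2l h0).
  by rewrite mulrN1 mulr1; move: (half l * _) => s /andP[h1 h2]; apply/andP; split; lra.
have := Ip (lift ord0 l); rewrite tau_vert [mid _ _ _]mxE; have h0 := half_gt0 l.
have [v0|v0] := leP 0 (vert p 0 l); move: hl; [rewrite ger0_norm//|rewrite ltr0_norm//] => hl.
  by rewrite hl => /andP[_]; lra.
by rewrite (_ : vert p 0 l = -1); [move=> /andP[+ _]; lra|lra].
Qed.

Lemma slice_points t : low Q 0 ord0 <= t <= high Q 0 ord0 -> generic Q t ->
  exists P : W -> X, [/\ forall y, cube y -> tau (P y) = vpoint t y &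
    forall e, 0 < e -> exists2 r, 0 < r & forall y y', cube y -> cube y' ->
      (forall l, `|y 0 l - y' 0 l| < r) -> d (P y) (P y') < e].
Proof.
move=> tb gt; have vb y : cube y -> cbox Q (vpoint t y).
  move=> yc i; case: (unliftP ord0 i) => [l|] ->; last by rewrite vpoint0.
  rewrite vpoint_lift [mid _ _ _]mxE; have h0 := half_gt0 l.
  have := yc l; rewrite ler_norml -(ler_pM2l h0) -[X in _ && X](ler_pM2l h0).
  by rewrite mulrN1 mulr1; move: (half l * _) => s /andP[h1 h2]; apply/andP; split; lra.
have gen y : generic Q (vpoint t y 0 ord0) by rewrite vpoint0.
have /choice[P PE] : forall y, exists p, cube y -> tau p = vpoint t y.
  move=> y; have [yc|nc] := pselect (cube y).
    by have [p pE] := point_over (vb y yc) (generic_off (gen y)); exists p.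
  by have [p _] := outer_nonempty Q; exists p.
exists P; split=> // e e0; have B0 := boxsize_gt0 Q.
exists (e / m.+2%:R / boxsize Q) => [|y y' yc y'c yy']; first by rewrite !divr_gt0.
have := PE y yc; have := PE y' y'c => ey' ey.
apply: le_lt_trans (vertical_slide _ _) _; rewrite ?ey ?ey' ?vpoint0//.
apply: ed_small => i; case: (unliftP ord0 i) => [l|] ->; last by rewrite !vpoint0 subrr normr0 divr_gt0.
rewrite !vpoint_lift opprD addrACA subrr add0r -mulrBr normrM (gtr0_norm (half_gt0 l)).
apply: le_lt_trans (_ : boxsize Q * `|y 0 l - y' 0 l| < _); last by rewrite mulrC -ltr_pdivlMr.
apply: ler_wpM2r => //; have := side_le_boxsize Q (lift ord0 l); have := half_gt0 l; lra.
Qed.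

(** A generic slice is the double of a cube, that is, a sphere. *)
Lemma slice_copy t (P : W -> X) x : generic Q t -> (forall y, cube y -> tau (P y) = vpoint t y) ->
  hor x = t -> x = copy (sheet x) (P (vert (fold x))).
Proof.
move=> gt PE xt; rewrite -[LHS]copyK; congr copy; apply: fiber_unique.
  have e := PE _ (vert_cube (fold x)); apply: vert_inj; last by rewrite (vert_vpoint e).
  by rewrite e vpoint0.
by apply: generic_off; rewrite -/(hor x) xt.
Qed.

End SliceSphere.

Lemma quotient_bound (R : realType) (k k' v v' N N' E : R) : 0 < N -> N / 2 <= N' -> N <= 1 -> N' <= 1 ->
  `|k| <= 1 -> `|v'| <= 2 -> `|k - k'| <= E -> `|v - v'| <= E -> `|N - N'| <= E ->
  `|k * v / N - k' * v' / N'| <= 10 * E / N ^+ 2.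
Proof.
move=> N0 NN' N1 N'1 k1 v2 kk' vv' nn'; have N'0 : 0 < N' by lra.
have E0 : 0 <= E by apply: le_trans kk'.
have -> : k * v / N - k' * v' / N' =
    ((k - k') * v' * N + k * ((v - v') * N' + v' * (N' - N))) / (N * N').
  by field; rewrite !gt_eqF.
rewrite normrM normfV (gtr0_norm (mulr_gt0 N0 N'0)) ler_pdivrMr ?mulr_gt0//.
have -> : 10 * E / N ^+ 2 * (N * N') = 10 * E * (N' / N) by field; rewrite gt_eqF.
apply: le_trans (_ : 10 * E * 2^-1 <= _); last first.
  by apply: ler_wpM2l; [rewrite mulr_ge0|rewrite ler_pdivlMr//; lra].
have h1 : `|(k - k') * v' * N| <= E * 2 * 1.
  rewrite !normrM (gtr0_norm N0); by apply: ler_pM => //; [exact: ltW|exact: ler_pM].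
have h2 : `|(v - v') * N' + v' * (N' - N)| <= E * 1 + 2 * E.
  apply: le_trans (ler_normD _ _) _; apply: lerD.
    by rewrite normrM (gtr0_norm N'0); apply: ler_pM => //; exact: ltW.
  by rewrite normrM [`|N' - N|]distrC; apply: ler_pM.
have h3 : `|k * ((v - v') * N' + v' * (N' - N))| <= 1 * (E * 1 + 2 * E).
  by rewrite normrM; apply: ler_pM.
apply: le_trans (ler_normD _ _) _; lra.
Qed.

Section Stereographic.
Variables (R : realType) (m : nat) (Q : slits R m).
Local Notation V := 'rV[R]_m.+2.
Local Notation W := 'rV[R]_m.+1.
Local Notation I := (open_box (low Q) (high Q)).
Local Notation X := (slit_space I (sset Q)).
Local Notation tau := (@tau R m Q).
Local Notation d := (@d R m Q).
Local Notation A := (@outer_boundary R m.+2 I (sset Q)).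
Local Notation DX := (@Defs.double X A).
Local Notation copy := (copy A).
Local Notation dd := (@dd R m Q).
Local Notation hor := (@hor R m Q).
Implicit Types (p q : X) (b : bool) (x : DX) (y : W) (e : R).

Variables (t : R) (c : W) (b0 : bool).
Hypothesis tb : low Q 0 ord0 < t < high Q 0 ord0.
Hypothesis gt : generic Q t.
Hypothesis c_inside : forall l, -1 < c 0 l < 1.

Let N x := gauge c (vert (fold x)).

Let height x := if sheet x == b0 then 1 - N x else 0.

(** An embedding of a slice without the point over c in the sheet b0 in Euclidean
    space: a translation on the other sheet, a reflection through the boundary
    along the rays from c on this one. *)
Definition stereo x : W :=
  \row_l ((vert (fold x) 0 l - c 0 l) * (1 + 2 * (height x / N x))).

Lemma height_bounds x : 0 <= height x <= 1.
Proof.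
rewrite /height; have h1 := gauge_ge0 c (vert (fold x)); have h2 := gauge_le1 c_inside (vert_cube (fold x)).
by case: ifP => _; rewrite /N; apply/andP; split; lra.
Qed.

(** The height vanishes on the outer boundary, through which the distances between
    the two sheets are measured. *)
Lemma stereo_lipschitz : exists2 K, 0 < K & exists2 r, 0 < r &
  forall x x', hor x = t -> hor x' = t -> dd x x' < r ->
  [/\ forall l, `|vert (fold x) 0 l - vert (fold x') 0 l| <= K * dd x x',
      `|N x - N x'| <= K * dd x x' & `|height x - height x'| <= K * dd x x'].
Proof.
have [C C0 hC] := vert_lipschitz Q; have [K K0 hK] := gauge_lipschitz c_inside.
have gl p q e : d p q <= e -> `|gauge c (vert p) - gauge c (vert q)| <= K * (C * e).
  move=> pq; have e0 : 0 <= e := le_trans (d_ge0 p q) pq.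
  apply: hK => [|l]; first by rewrite mulr_ge0// ltW.
  by apply: le_trans (hC p q l) _; rewrite ler_pM2l.
have [r r0 [r1 r2]] : exists2 r, 0 < r & r <= t - low Q 0 ord0 /\ r <= high Q 0 ord0 - t.
  have /andP[h1 h2] := tb; exists (Num.min (t - low Q 0 ord0) (high Q 0 ord0 - t)).
    by rewrite lt_min !subr_gt0 h1.
  by rewrite !ge_min !lexx orbT.
exists (C + K * C); first by rewrite addr_gt0// mulr_gt0.
exists r => // x x' xt x't xx'; have D0 := dd_ge0 x x'.
have Nl : `|N x - N x'| <= K * (C * dd x x') by apply: gl; exact: dd_fold.
have KC0 : 0 <= K * (C * dd x x') by rewrite !mulr_ge0// ltW.
have C1 : 0 <= C * dd x x' by rewrite !mulr_ge0// ltW.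
rewrite mulrDl -mulrA; split.
- by move=> l; apply: le_trans (hC _ _ l) _; apply: le_trans (_ : C * dd x x' <= _); [rewrite ler_pM2l// dd_fold|rewrite lerDl].
- by apply: le_trans Nl _; rewrite lerDr.
apply: le_trans (_ : K * (C * dd x x') <= _); last by rewrite lerDr.
suff other u u' : hor u = t -> hor u' = t -> dd u u' < r -> sheet u <> sheet u' ->
    1 - N u <= K * (C * dd u u').
  have [same|/eqP diff] := eqVneq (sheet x) (sheet x').
    rewrite /height same; case: ifP => _; last by rewrite subrr normr0.
    by rewrite opprB addrC addrA subrK distrC.
  have hx := other _ _ xt x't xx' diff; have hx' := other _ _ x't xt; rewrite dd_sym in hx'.
  have {}hx' := hx' xx' (nesym diff).
  have := height_bounds x; have := height_bounds x'; rewrite /height.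
  have h0 := le_trans (normr_ge0 _) Nl.
  case: ifP => /eqP sx'; case: ifP => /eqP sx; first by case: diff; rewrite sx sx'.
  - by move=> /andP[h1 h2] _; rewrite sub0r normrN ger0_norm.
  - by move=> _ /andP[h1 h2]; rewrite subr0 ger0_norm.
  - by rewrite subrr normr0.
move=> ut u't uu' diff; apply/ler_addgt0Pr => e e0.
pose e1 := Num.min (r - dd u u') (e / (K * C)).
have KC : 0 < K * C by rewrite mulr_gt0.
have e10 : 0 < e1 by rewrite lt_min subr_gt0 uu' divr_gt0.
have [z Az] := dd_other (fold u) (fold u') diff e10; rewrite !copyK => hz.
have uz : d (fold u) z <= dd u u' + e1 by apply: ltW; apply: le_lt_trans hz; rewrite lerDl d_ge0.
have ur : d (fold u) z < r.
  apply: le_lt_trans (_ : d (fold u) z + d z (fold u') < _); first by rewrite lerDl d_ge0.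
  by apply: lt_le_trans hz _; rewrite -lerBrDl ge_min lexx.
have zt : low Q 0 ord0 < tau z 0 ord0 < high Q 0 ord0.
  have := le_lt_trans (tau_lipschitz (fold u) z ord0) ur; rewrite -/(hor u) ut ltr_norml.
  by move=> /andP[h1 h2]; apply/andP; split; lra.
have /(outer_vert zt)[l /(gauge_boundary c_inside) Nz] := Az.
have := gl _ _ _ uz; rewrite ler_norml => /andP[h1 _].
apply: le_trans (_ : K * (C * (dd u u' + e1)) <= _); first by move: h1; rewrite -/(N u); lra.
rewrite !mulrDr; rewrite lerD2l mulrA mulrC -ler_pdivlMr//; by rewrite ge_min lexx orbT.
Qed.

Lemma stereo_continuous x e : hor x = t -> x <> copy b0 (fold x) \/ vert (fold x) <> c -> 0 < e ->
  exists2 r, 0 < r & forall x', hor x' = t -> dd x x' < r ->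
    forall l, `|stereo x 0 l - stereo x' 0 l| < e.
Proof.
move=> xt xc e0; have [K K0 [r r0 lip]] := stereo_lipschitz.
have N1 u : N u <= 1 by exact: gauge_le1 (vert_cube _).
have [x0|N0] := eqVneq (N x) 0; last first.
  have {}N0 : 0 < N x by rewrite lt_neqAle eq_sym N0 gauge_ge0.
  pose s := Num.min (N x / 2) (e / (2 + 20 / N x ^+ 2)).
  have den : 0 < 2 + 20 / N x ^+ 2 by rewrite addr_gt0// divr_gt0// exprn_gt0.
  have s0 : 0 < s by rewrite lt_min !divr_gt0.
  exists (Num.min r (s / K)) => [|x' x't]; first by rewrite lt_min r0 divr_gt0.
  rewrite lt_min => /andP[xr]; rewrite ltr_pdivlMr// mulrC => xs l.
  have [h1 h2 h3] := lip _ _ xt x't xr; have {}h1 := h1 l.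
  move: xs h1 h2 h3; rewrite lt_min; move: (K * _) => E /andP[E1 E2] h1 h2 h3.
  rewrite [stereo x 0 l]mxE [stereo x' 0 l]mxE; set v := vert (fold x) 0 l - c 0 l; set v' := vert (fold x') 0 l - c 0 l.
  have vv' : `|v - v'| <= E by rewrite /v /v' opprB addrA subrK.
  have k1 : `|height x| <= 1 by have /andP[? ?] := height_bounds x; rewrite ger0_norm.
  have v2 : `|v'| <= 2.
    apply: le_trans (gauge_coord c_inside (vert (fold x')) l) _.
    by have := N1 x'; rewrite /N; lra.
  have NN : N x / 2 <= N x' by move: h2; rewrite ler_norml => /andP[? ?]; lra.
  have := quotient_bound N0 NN (N1 x) (N1 x') k1 v2 h3 vv' h2.
  have -> : v * (1 + 2 * (height x / N x)) - v' * (1 + 2 * (height x' / N x')) =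
    (v - v') + 2 * (height x * v / N x - height x' * v' / N x') by ring.
  move=> qb; apply: le_lt_trans (ler_normD _ _) _; rewrite normrM ger0_norm//.
  have : E * (2 + 20 / N x ^+ 2) < e by rewrite -ltr_pdivlMr.
  have E0 := le_trans (normr_ge0 _) h2.
  rewrite mulrDr; move: qb vv' E0; rewrite (_ : 10 * E / N x ^+ 2 = E * (20 / N x ^+ 2) / 2); last first.
    by field; rewrite gt_eqF.
  move: (E * (20 / _)) (`|v - v'|) (`|height x * _ / _ - _|) => *; lra.
have xv l : vert (fold x) 0 l = c 0 l.
  have := gauge_coord c_inside (vert (fold x)) l; rewrite -/(N x) x0 mulr0 normr_le0 subr_eq0.
  by move/eqP.
have hx : height x = 0.
  rewrite /height; case: eqP => // sx; case: xc => [[]|[]]; first by rewrite -sx copyK.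
  by apply/rowP.
exists (Num.min r (e / (5 * K))) => [|x' x't]; first by rewrite lt_min r0 divr_gt0// mulr_gt0.
rewrite lt_min => /andP[xr]; rewrite ltr_pdivlMr ?mulr_gt0// => xs l.
have [h1 h2 h3] := lip _ _ xt x't xr; have {}h1 := h1 l.
rewrite [stereo x 0 l]mxE [stereo x' 0 l]mxE xv subrr mul0r sub0r normrN; rewrite xv distrC in h1; rewrite hx sub0r normrN in h3.
have := gauge_coord c_inside (vert (fold x')) l; rewrite -/(N x') => g.
have [hb1 hb2] := andP (height_bounds x'); have n0 : 0 <= N x' := gauge_ge0 c _.
apply: le_lt_trans xs; rewrite (_ : dd x x' * (5 * K) = 5 * (K * dd x x')); last by ring.
move: (K * dd x x') h1 h3 => E h1 h3; rewrite mulrDr mulr1.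
apply: le_trans (ler_normD _ _) _.
have : `|(vert (fold x') 0 l - c 0 l) * (2 * (height x' / N x'))| <= 4 * height x'.
  have [z|nz] := eqVneq (N x') 0; first by rewrite z invr0 !mulr0 normr0 mulr_ge0.
  have {}n0 : 0 < N x' by rewrite lt_neqAle eq_sym nz.
  have q0 : 0 <= 2 * (height x' / N x') by apply: mulr_ge0 => //; apply: divr_ge0 => //; exact: ltW.
  rewrite normrM [`|2 * _|]ger0_norm//.
  apply: le_trans (_ : 2 * N x' * (2 * (height x' / N x')) <= _).
    exact: ler_wpM2r.
  by rewrite le_eqVlt; apply/orP; left; apply/eqP; field; rewrite gt_eqF.
have h4 : height x' <= E by rewrite -(ger0_norm hb1).
by move=> h5; apply: le_trans (lerD h1 h5) _; lra.
Qed.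

(** The gauge of the image is the sum of the gauge and twice the height: at most 1
    on one sheet and at least 1 on the other. It determines the gauge and the
    sheet, hence the factor by which the map moves the point along its ray. *)
Lemma stereo_inj x x' : hor x = t -> hor x' = t ->
  (x <> copy b0 (fold x) \/ vert (fold x) <> c) -> (x' <> copy b0 (fold x') \/ vert (fold x') <> c) ->
  stereo x = stereo x' -> x = x'.
Proof.
have at0 u : (u <> copy b0 (fold u) \/ vert (fold u) <> c) -> N u = 0 -> height u = 0 /\ vert (fold u) = c.
  move=> uc u0; have uv : vert (fold u) = c.
    apply/rowP => l; have := gauge_coord c_inside (vert (fold u)) l.
    by rewrite -/(N u) u0 mulr0 normr_le0 subr_eq0 => /eqP.
  split=> //; rewrite /height; case: eqP => // su; case: uc => // -[]; by rewrite -su copyK.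
have N0 u : 0 <= N u := gauge_ge0 c _.
have fac u : 0 <= 1 + 2 * (height u / N u).
  by rewrite addr_ge0// mulr_ge0// divr_ge0//; case/andP: (height_bounds u).
move=> xt x't xc x'c e.
have coord l : (vert (fold x) 0 l - c 0 l) * (1 + 2 * (height x / N x)) =
    (vert (fold x') 0 l - c 0 l) * (1 + 2 * (height x' / N x')).
  by have /rowP/(_ l) := e; rewrite [stereo x 0 l]mxE [stereo x' 0 l]mxE.
have scaled u : (u <> copy b0 (fold u) \/ vert (fold u) <> c) ->
    N u * (1 + 2 * (height u / N u)) = N u + 2 * height u.
  move=> uc; have [u0|u0] := eqVneq (N u) 0; last by field.
  by have [-> _] := at0 u uc u0; rewrite u0 mul0r mulr0 addr0.
have sum : N x + 2 * height x = N x' + 2 * height x'.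
  by rewrite -scaled// -scaled//; exact: (gauge_scale c_inside).
have [NN hh] : N x = N x' /\ height x = height x'.
  have n1 : N x <= 1 := gauge_le1 c_inside (vert_cube _).
  have n2 : N x' <= 1 := gauge_le1 c_inside (vert_cube _).
  by move: sum; rewrite /height; case: ifP => _; case: ifP => _ sum; split; lra.
have vv : vert (fold x) = vert (fold x').
  have [x0|x0] := eqVneq (N x) 0.
    by have [_ ->] := at0 x xc x0; have [_ ->] := at0 x' x'c (esym (etrans (esym x0) NN)).
  apply/rowP => l; have := coord l; rewrite -NN -hh => /mulIf h; apply: (addIr (- c 0 l)).
  apply: h; rewrite gt_eqF// ltr_wpDr// mulr_ge0// divr_ge0//; by case/andP: (height_bounds x).
have ff : fold x = fold x'.
  by apply: fiber_unique; [apply: vert_inj; rewrite // -/(hor x) xt|apply: generic_off; rewrite -/(hor x) xt].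
have [ss|/eqP ss] := eqVneq (sheet x) (sheet x'); first by rewrite -(copyK x) ss ff copyK.
rewrite -(copyK x) -(copyK x') ff; apply/copy_eq; split=> //; right.
apply/outer_vert; first by rewrite -/(hor x') x't.
apply: contrapT => none; have : N x' < 1.
  apply: gauge_inside => // l; rewrite lt_neqAle vert_cube andbT; apply/eqP => h.
  by apply: none; exists l.
have : height x != height x' \/ N x' = 1.
  move: hh; rewrite /height NN; case: ifP => /eqP s1; case: ifP => /eqP s2 h; try by right; lra.
    by case: ss; rewrite s1 s2.
  by case: ss; move: s1 s2; case: (sheet x); case: (sheet x'); case: (b0).
by case=> [/eqP//|->]; rewrite ltxx.
Qed.

End Stereographic.

(** * Maps between slices *)
Section SliceMaps.
Variables (R : realType) (m : nat) (Q : slits R m).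
Local Notation V := 'rV[R]_m.+2.
Local Notation W := 'rV[R]_m.+1.
Local Notation I := (open_box (low Q) (high Q)).
Local Notation X := (slit_space I (sset Q)).
Local Notation tau := (@tau R m Q).
Local Notation d := (@d R m Q).
Local Notation A := (@outer_boundary R m.+2 I (sset Q)).
Local Notation DX := (@Defs.double X A).
Local Notation copy := (copy A).
Local Notation dd := (@dd R m Q).
Local Notation hor := (@hor R m Q).
Implicit Types (p : X) (b : bool) (q x u : DX) (y : W) (e : R).

Hypothesis por : porous_slits Q.
Variable f : DX -> DX.
Hypothesis finj : injective f.
Hypothesis funif : forall e : R, 0 < e ->
  exists2 r, 0 < r & forall x (y : DX), dd x y < r -> dd (f x) (f y) < e.

Variables t t' : R.
Hypothesis tb : low Q 0 ord0 < t < high Q 0 ord0.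
Hypothesis t'b : low Q 0 ord0 < t' < high Q 0 ord0.
Hypothesis gt : generic Q t.
Hypothesis gt' : generic Q t'.

Let wide (s : R) : low Q 0 ord0 < s < high Q 0 ord0 -> low Q 0 ord0 <= s <= high Q 0 ord0.
Proof. by case/andP => h1 h2; rewrite !ltW. Qed.

Let cube_opp y : cube y -> cube (- y).
Proof. by move=> yc l; rewrite mxE normrN. Qed.

Lemma slice_image_closed q : (forall x, hor x = t -> f x <> q) ->
  exists2 e, 0 < e & forall x, hor x = t -> e <= dd (f x) q.
Proof.
move=> miss; apply: contrapT => none; have [iv iv0 small] := vanishing_seq R.
have /choice[P hP] : forall k, exists x, hor x = t /\ dd (f x) q < iv k.
  move=> k; apply: contrapT => nk; apply: none; exists (iv k) => // x xt.
  by rewrite leNgt; apply/negP => h; apply: nk; exists x.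
have [x hx] := dd_compact por P; apply: (miss x).
  apply/eqP; rewrite -subr_eq0 -normr_le0; apply/ler_addgt0Pr => e e0; rewrite add0r.
  have [k _ kx] := hx e 0%N e0; have [kt _] := hP k.
  by apply: ltW; apply: le_lt_trans kx; rewrite -kt distrC; exact: hor_dd.
apply: dd_eq0; apply/eqP; rewrite eq_le dd_ge0 andbT; apply/ler_addgt0Pr => e e0; rewrite add0r.
have e2 : 0 < e / 2 by rewrite divr_gt0.
have [r r0 fr] := funif e2; have [K hK] := small _ e2.
have [k Kk kx] := hx r K r0; have [_ hk] := hP k; have := hK k Kk.
have := fr _ _ kx; have := dd_triangle (f (P k)) (f x) q; rewrite (dd_sym (f x) (f (P k))).
move: hk; move: (dd _ _) (dd _ _) (dd _ _) (iv k) => *; lra.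
Qed.

(** If the image missed a point, it would miss one off the outer boundary, and f
    would embed a sphere in a Euclidean space of the same dimension; but a
    continuous map to this space identifies two antipodal points. *)
Lemma slice_onto q : (forall x, hor x = t -> hor (f x) = t') -> hor q = t' ->
  exists2 x, hor x = t & f x = q.
Proof.
move=> ft qt'; apply: contrapT => none.
have miss x : hor x = t -> f x <> q by move=> xt xq; apply: none; exists x.
have [e e0 far] := slice_image_closed miss.
have [P [PE Pc]] := slice_points (wide tb) gt.
have [P' [PE' Pc']] := slice_points (wide t'b) gt'.
have qE := slice_copy gt' PE' qt'; set b0 := sheet q in qE; set y0 := vert (fold q) in qE.
have y0c : cube y0 := vert_cube _.
have [r r0 hr] := Pc' e e0.
pose s := Num.min 2^-1 (r / 2); have s0 : 0 < s by rewrite lt_min invr_gt0 ltr0n divr_gt0.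
have [s1 s2] : s <= 2^-1 /\ s <= r / 2 by split; rewrite ge_min lexx ?orbT.
pose y1 : W := (1 - s) *: y0.
have y1E l : y1 0 l = (1 - s) * y0 0 l by rewrite mxE.
have sy l : `|s * y0 0 l| <= s.
  by rewrite normrM gtr0_norm// -[leRHS]mulr1 ler_pM2l.
have y1in l : `|y1 0 l| <= 1 - s.
  rewrite y1E normrM ger0_norm; last by lra.
  by rewrite -[leRHS]mulr1; apply: ler_wpM2l => //; lra.
have y1c : cube y1 by move=> l; apply: le_trans (y1in l) _; lra.
have inside l : -1 < y1 0 l < 1 by have := y1in l; rewrite ler_norml => /andP[h1 h2]; apply/andP; split; lra.
have q1q : dd (copy b0 (P' y1)) q < e.
  rewrite qE dd_same; apply: hr => // l; rewrite y1E.
  rewrite (_ : _ - _ = - (s * y0 0 l)); last by ring.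
  by rewrite normrN; apply: le_lt_trans (sy l) _; lra.
have avoid x : hor x = t -> f x <> copy b0 (fold (f x)) \/ vert (fold (f x)) <> y1.
  move=> xt; have [xb|] := pselect (f x = copy b0 (fold (f x))); last by left.
  right=> xv; have := far x xt; rewrite leNgt => /negP; apply.
  suff -> : f x = copy b0 (P' y1) by [].
  rewrite xb; congr copy; apply: fiber_unique.
    by apply: vert_inj; rewrite ?xv ?(vert_vpoint (PE' _ y1c))// PE'// vpoint0; exact: ft.
  by apply: generic_off; rewrite -/(hor (f x)) ft.
pose h x := stereo y1 b0 x; pose g b y := f (copy b (P y)).
have gtt b y : cube y -> hor (copy b (P y)) = t.
  by move=> yc; rewrite hor_copy PE// vpoint0.
have gt't b y : cube y -> hor (g b y) = t' by move=> yc; apply: ft; exact: gtt.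
have cont b y (a : R) : cube y -> 0 < a -> exists2 r, 0 < r & forall y', cube y' ->
    (forall l, `|y' 0 l - y 0 l| < r) -> forall l, `|h (g b y) 0 l - h (g b y') 0 l| < a.
  move=> yc a0; have [r2 r20 hc] := stereo_continuous t'b inside (gt't b y yc) (avoid _ (gtt b y yc)) a0.
  have [r3 r30 fc] := funif r20; have [r4 r40 pc] := Pc _ r30.
  exists r4 => // y' y'c yy'; apply: hc; first exact: gt't.
  by apply: fc; rewrite dd_same; apply: pc => // l; rewrite distrC.
have [||y yc] := @borsuk_ulam R m (fun y => h (g true y) - h (g false (- y))).
- move=> y yc a a0; have a2 : 0 < a / 2 by rewrite divr_gt0.
  have [r1 r10 c1] := cont true y _ yc a2; have [r2 r20 c2] := cont false (- y) _ (cube_opp yc) a2.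
  exists (Num.min r1 r2) => [|y' y'c yy' l]; first by rewrite lt_min r10.
  have h1 : `|h (g true y) 0 l - h (g true y') 0 l| < a / 2.
    by apply: c1 => // k; apply: lt_le_trans (yy' k) _; rewrite ge_min lexx.
  have h2 : `|h (g false (- y)) 0 l - h (g false (- y')) 0 l| < a / 2.
    apply: c2 => [|k]; first exact: cube_opp.
    rewrite !mxE -opprD normrN; apply: lt_le_trans (yy' k) _; by rewrite ge_min lexx orbT.
  have E (z z' : W) : (z - z') 0 l = z 0 l - z' 0 l by rewrite !mxE.
  rewrite !E; move: (h _ 0 l) (h _ 0 l) (h _ 0 l) (h _ 0 l) h1 h2 => v1 v2 v3 v4.
  by rewrite !ltr_norml => /andP[? ?] /andP[? ?]; apply/andP; split; lra.
- move=> y yc [l yl]; rewrite opprK opprB.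
  have glue (z : W) : cube z -> `|z 0 l| = 1 -> g true z = g false z.
    move=> zc zl; congr f; apply/copy_eq; split=> //; right; apply/outer_vert.
      by rewrite PE// vpoint0.
    by exists l; rewrite (vert_vpoint (PE _ zc)).
  by rewrite glue ?mxE ?normrN//; [rewrite -(glue y)|exact: cube_opp].
move/subr0_eq => e1; have ync := cube_opp yc.
have := stereo_inj t'b gt' inside (gt't true y yc) (gt't false _ ync)
  (avoid _ (gtt true y yc)) (avoid _ (gtt false _ ync)) e1.
move=> /finj/copy_eq[pp [//|Ap]].
have yy : y = - y.
  by rewrite -{1}(vert_vpoint (PE _ yc)) pp (vert_vpoint (PE _ ync)).
have [|l] := (outer_vert _).1 Ap; first by rewrite PE// vpoint0.
rewrite (vert_vpoint (PE _ yc)) (_ : y 0 l = 0) ?normr0; first by move/eqP; rewrite eq_sym oner_eq0.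
by have := congr1 (fun z : W => z 0 l) yy; rewrite /= mxE; lra.
Qed.

Hypothesis finv : forall x e, 0 < e ->
  exists2 r, 0 < r & forall y : DX, dd (f x) (f y) < r -> dd x y < e.

(** If the image of one slice is another one, there are twins, the two points
    over one point of the box, with distant images: the inverse map composed
    with the projection to the box identifies antipodal points. *)
Lemma distant_twins (rho : R) : (forall q, hor q = t' -> exists2 x, hor x = t & f x = q) ->
  rho <= t' - low Q 0 ord0 -> rho <= high Q 0 ord0 - t' ->
  (forall l : 'I_m.+1, 2 * rho <= high Q 0 (lift ord0 l) - low Q 0 (lift ord0 l)) ->
  exists u u', [/\ hor u = t, fold u = fold u' & rho <= dd (f u) (f u')].
Proof.
move=> onto r1 r2 r3.
have [P' [PE' Pc']] := slice_points (wide t'b) gt'.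
have ht b y : cube y -> hor (copy b (P' y)) = t'.
  by move=> yc; rewrite hor_copy PE'// vpoint0.
have /choice[g gP] : forall q, exists x, hor q = t' -> hor x = t /\ f x = q.
  move=> q; have [qt|nq] := pselect (hor q = t').
    by have [x x1 x2] := onto q qt; exists x.
  by exists q.
pose k b y := g (copy b (P' y)).
have kt b y : cube y -> hor (k b y) = t by move=> yc; have [] := gP _ (ht b y yc).
have fk b y : cube y -> f (k b y) = copy b (P' y) by move=> yc; have [] := gP _ (ht b y yc).
have [C C0 hC] := vert_lipschitz Q.
have cont b y (a : R) : cube y -> 0 < a -> exists2 r, 0 < r & forall y', cube y' ->
    (forall l, `|y' 0 l - y 0 l| < r) ->
    forall l, `|vert (fold (k b y)) 0 l - vert (fold (k b y')) 0 l| < a.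
  move=> yc a0; have aC : 0 < a / C by rewrite divr_gt0.
  have [r10 r100 fc] := finv (k b y) aC; have [r4 r40 pc] := Pc' _ r100.
  exists r4 => // y' y'c yy' l; apply: le_lt_trans (hC _ _ l) _.
  rewrite mulrC -ltr_pdivlMr//; apply: le_lt_trans (dd_fold _ _) _; apply: fc.
  by rewrite !fk// dd_same; apply: pc => // i; rewrite distrC.
have [||y yc] := @borsuk_ulam R m (fun y => vert (fold (k true y)) - vert (fold (k false (- y)))).
- move=> y yc a a0; have a2 : 0 < a / 2 by rewrite divr_gt0.
  have [s1 s10 c1] := cont true y _ yc a2; have [s2 s20 c2] := cont false (- y) _ (cube_opp yc) a2.
  exists (Num.min s1 s2) => [|y' y'c yy' l]; first by rewrite lt_min s10.
  have h1 : `|vert (fold (k true y)) 0 l - vert (fold (k true y')) 0 l| < a / 2.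
    by apply: c1 => // i; apply: lt_le_trans (yy' i) _; rewrite ge_min lexx.
  have h2 : `|vert (fold (k false (- y))) 0 l - vert (fold (k false (- y'))) 0 l| < a / 2.
    apply: c2 => [|i]; first exact: cube_opp.
    rewrite !mxE -opprD normrN; apply: lt_le_trans (yy' i) _; by rewrite ge_min lexx orbT.
  have E (z z' : W) : (z - z') 0 l = z 0 l - z' 0 l by rewrite !mxE.
  rewrite !E; move: (vert _ 0 l) (vert _ 0 l) (vert _ 0 l) (vert _ 0 l) h1 h2 => v1 v2 v3 v4.
  by rewrite !ltr_norml => /andP[? ?] /andP[? ?]; apply/andP; split; lra.
- move=> y yc [l yl]; rewrite opprK opprB.
  have glue (z : W) : cube z -> `|z 0 l| = 1 -> k true z = k false z.
    move=> zc zl; congr g; apply/copy_eq; split=> //; right; apply/outer_vert.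
      by rewrite PE'// vpoint0.
    by exists l; rewrite (vert_vpoint (PE' _ zc)).
  by rewrite glue ?mxE ?normrN//; [rewrite -(glue y)|exact: cube_opp].
move/subr0_eq => e1; have ync := cube_opp yc.
exists (k true y), (k false (- y)).
have far : rho <= dd (f (k true y)) (f (k false (- y))).
  rewrite leNgt; apply/negP => near; rewrite !fk// in near.
  have s1 : 0 < rho - dd (copy true (P' y)) (copy false (P' (- y))) by rewrite subr_gt0.
  have [//|z Az] := @dd_other _ _ Q true false (P' y) (P' (- y)) _ _ s1.
  rewrite [X in _ < X]addrC subrK => hz.
  have z1 := d_ge0 (P' y) z; have z2 := d_ge0 z (P' (- y)).
  have zt : low Q 0 ord0 < tau z 0 ord0 < high Q 0 ord0.
    have := tau_lipschitz (P' y) z ord0; rewrite PE'// vpoint0 ler_norml => /andP[? ?].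
    by apply/andP; split; lra.
  have /(outer_vert zt)[l zl] := Az.
  have := tau_lipschitz (P' y) z (lift ord0 l); have := tau_lipschitz z (P' (- y)) (lift ord0 l).
  rewrite !PE'// !vpoint_lift [(- y) 0 l]mxE mulrN (tau_vert z).
  have h0 := half_gt0 Q l; have := r3 l; move: zl hz; move: (vert z 0 l) => v.
  move: (d _ z) (d z _) ((_ / 2) * y 0 l) (mid _ _ _) => d1 d2 hy md zl hz r3l.
  have hv : `|(high Q 0 (lift ord0 l) - low Q 0 (lift ord0 l)) / 2 * v| = (high Q 0 (lift ord0 l) - low Q 0 (lift ord0 l)) / 2.
    by rewrite normrM zl mulr1 gtr0_norm.
  move: hv h0 r3l; move: (_ / 2 * v) => hv'; rewrite !ler_norml.
  move=> e2 h0 r3l /andP[? ?] /andP[? ?].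
  by move: e2; case: (ger0P hv') => ? ?; lra.
have ff : fold (k true y) = fold (k false (- y)).
  apply: fiber_unique; last by apply: generic_off; rewrite -/(hor _) kt.
  by apply: vert_inj => //; rewrite -/(hor _) -/(hor (k false _)) !kt.
by split=> //; exact: kt.
Qed.

End SliceMaps.

(** * Embeddings of the double are onto *)
Section Surjectivity.
Variables (R : realType) (m : nat) (Q : slits R m).
Local Notation V := 'rV[R]_m.+2.
Local Notation W := 'rV[R]_m.+1.
Local Notation I := (open_box (low Q) (high Q)).
Local Notation X := (slit_space I (sset Q)).
Local Notation tau := (@tau R m Q).
Local Notation d := (@d R m Q).
Local Notation A := (@outer_boundary R m.+2 I (sset Q)).
Local Notation DX := (@Defs.double X A).
Local Notation copy := (copy A).
Local Notation dd := (@dd R m Q).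
Local Notation hor := (@hor R m Q).
Local Notation lo := (low Q 0 ord0).
Local Notation hi := (high Q 0 ord0).
Implicit Types (p q : X) (b : bool) (x u : DX) (t e : R).

Hypothesis por : porous_slits Q.

(** By compactness: a limit of points approaching the face lies over it. *)
Lemma near_face (t0 e : R) : t0 = lo \/ t0 = hi -> 0 < e ->
  exists2 r, 0 < r & forall p, `|tau p 0 ord0 - t0| < r -> exists2 z, A z & d p z < e.
Proof.
move=> t0E e0; apply: contrapT => none; have [iv iv0 small] := vanishing_seq R.
have /choice[P hP] : forall k, exists p, `|tau p 0 ord0 - t0| < iv k /\ forall z, A z -> e <= d p z.
  move=> k; apply: contrapT => nk; apply: none; exists (iv k) => // p pt.
  apply: contrapT => far; apply: nk; exists p; split=> // z Az; rewrite leNgt; apply/negP => h.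
  by apply: far; exists z.
have [q hq] := d_compact por P.
have qt : tau q 0 ord0 = t0.
  apply/eqP; rewrite -subr_eq0 -normr_le0; apply/ler_addgt0Pr => s s0; rewrite add0r.
  have s2 : 0 < s / 2 by rewrite divr_gt0.
  have [K hK] := small _ s2; have [k Kk kq] := hq _ K s2.
  have [kt _] := hP k; have := hK k Kk; have := tau_lipschitz (P k) q ord0.
  move: kt kq; rewrite ltr_norml !ler_norml => /andP[? ?] ? /andP[? ?] ?; apply/andP; split; lra.
have Aq : A q.
  by apply/outerP => /(_ ord0); rewrite qt; case: t0E => ->; rewrite ltxx ?andbF.
have [k _ kq] := hq e 0%N e0; have [_ far] := hP k.
by have := far q Aq; rewrite leNgt kq.
Qed.

Variable f : DX -> DX.
Hypothesis fqs : qs_embedding dd dd f.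

Let finj : injective f := qs_injective fqs.

Let funif e : 0 < e -> exists2 r, 0 < r & forall x u, dd x u < r -> dd (f x) (f u) < e.
Proof. exact: (qs_uniform (@dd_sym _ _ Q) (@dd_triangle _ _ Q) fqs (dd_compact por)). Qed.

Let finv x e : 0 < e -> exists2 r, 0 < r & forall u, dd (f x) (f u) < r -> dd x u < e.
Proof. exact: (qs_inverse_continuous fqs). Qed.

Let fslice x u : hor x = hor u -> generic Q (hor x) -> hor (f x) = hor (f u).
Proof.
have [H H1 weak] := qs_weak (@dd_ge0 _ _ Q) (@dd_xx _ _ Q) (@dd_sym _ _ Q) (@dd_eq0 _ _ Q) fqs.
exact: (slice por H1 weak finj funif).
Qed.

Let clip t : R := Num.max lo (Num.min hi t).

Let lohi : lo < hi := low_lt_high Q ord0.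

Let clipP t : lo <= clip t <= hi.
Proof. by rewrite le_max lexx /= ge_max ge_min lexx /= andbT ltW. Qed.

Let clip_id t : lo <= t <= hi -> clip t = t.
Proof. by move=> /andP[h1 h2]; rewrite /clip min_r// max_r. Qed.

Let clip_lipschitz t s : `|clip t - clip s| <= `|t - s|.
Proof.
have h1 (a x y : R) : `|Num.max a x - Num.max a y| <= `|x - y|.
  have := ler_norm (x - y); have := ler_norm (y - x); rewrite distrC ler_norml.
  by case: (lerP a x) => ?; case: (lerP a y) => ?; move: (normr_ge0 (x - y)); move: `|_| => ? ? ? ?; apply/andP; split; lra.
have h2 (a x y : R) : `|Num.min a x - Num.min a y| <= `|x - y|.
  have := ler_norm (x - y); have := ler_norm (y - x); rewrite distrC ler_norml.
  by case: (lerP a x) => ?; case: (lerP a y) => ?; move: (normr_ge0 (x - y)); move: `|_| => ? ? ? ?; apply/andP; split; lra.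
exact: le_trans (h1 _ _ _) (h2 _ _ _).
Qed.

Let edge_ex t : exists p, tau p = edge Q (clip t).
Proof. by apply: edge_point; exact: clipP. Qed.

Let E t : DX := copy true (projT1 (cid (edge_ex t))).

Let horE t : lo <= t <= hi -> hor (E t) = t.
Proof. by move=> tb; rewrite hor_copy; case: cid => p /= ->; rewrite updE clip_id. Qed.

(** The slice at t is mapped into the slice at F t, if t is generic. *)
Let F t : R := hor (f (E t)).

Let F_bounds t : lo <= F t <= hi.
Proof. exact: tau_cbox. Qed.

Let F_slice x : generic Q (hor x) -> hor (f x) = F (hor x).
Proof. by move=> gx; apply: fslice => //; rewrite horE//; exact: tau_cbox. Qed.

Let F_continuous e : 0 < e -> exists2 r, 0 < r & forall t s, `|t - s| < r -> `|F t - F s| < e.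
Proof.
move=> e0; have [r r0 fr] := funif e0; exists r => // t s ts.
apply: le_lt_trans (hor_dd _ _) _; apply: fr; rewrite dd_same.
case: cid => p pt /=; case: cid => q qt /=; apply: le_lt_trans ts.
exact: le_trans (edge_slide pt qt) (clip_lipschitz t s).
Qed.

Let F_cross (a b v : R) : a <= b -> Num.min (F a) (F b) <= v <= Num.max (F a) (F b) ->
  exists2 t, a <= t <= b & F t = v.
Proof.
move=> ab vb; have [|t + <-] := @IVT R F a b v ab _ vb; last by rewrite in_itv /= => tab; exists t.
apply: continuous_subspaceT => t B /nbhs_ballP[e /= e0 eB].
have [r r0 h] := F_continuous e0; apply/nbhs_ballP; exists r => // s ts.
by apply: eB; exact: h.
Qed.

(** Countably many values are not good, so good ones are dense. *)
Definition good t := generic Q t /\ forall s, F s = t -> generic Q s.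

Let good_ex (a b : R) : a < b -> exists2 t, a < t < b & good t.
Proof.
move=> ab; have [t tab ht] := interval_avoid (fun j => if odd j then F (sx Q j./2) else sx Q j./2) ab.
exists t => //; split=> [j jt|s st j js].
  by apply: (ht j.*2); rewrite odd_double doubleK.
by apply: (ht j.*2.+1); rewrite /= odd_double /= uphalf_double js.
Qed.

Let F_onto_slice t t' x : lo < t < hi -> lo < t' < hi -> F t = t' -> good t' -> hor x = t' ->
  exists2 u, hor u = t & f u = x.
Proof.
move=> tb t'b Ft [gt' pre]; have gt := pre t Ft.
by apply: (slice_onto por finj funif tb t'b gt gt') => u ut; rewrite F_slice ut.
Qed.

(** Two slices that are mapped onto the same slice meet. *)
Let F_injective t s t' : lo < t < hi -> lo < s < hi -> lo < t' < hi -> good t' ->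
  F t = t' -> F s = t' -> t = s.
Proof.
move=> tb sb t'b gt' Ft Fs; have t'w : lo <= t' <= hi by case/andP: t'b => ? ?; rewrite !ltW.
have [u ut uE] := F_onto_slice tb t'b Ft gt' (horE t'w).
have [w ws wE] := F_onto_slice sb t'b Fs gt' (horE t'w).
by rewrite -ut -ws; congr hor; apply: finj; rewrite uE wE.
Qed.

Let F_not_constant (a b : R) : lo <= a -> a < b -> b <= hi -> forall v, exists2 t, a <= t <= b & F t <> v.
Proof.
move=> la ab bh v.
have [H H1 weak] := qs_weak (@dd_ge0 _ _ Q) (@dd_xx _ _ Q) (@dd_sym _ _ Q) (@dd_eq0 _ _ Q) fqs.
have [x [xab gx xv]] := slab_not_flat por H1 weak finj funif v la ab bh.
by exists (hor x) => //; rewrite -F_slice.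
Qed.

(** Near the faces orthogonal to the first axis, twins are close. If the image
    of such a face were a slice inside the box, a nearby slice would be mapped
    onto a slice with distant images of twins. *)
Let F_end c : c = lo \/ c = hi -> F c = lo \/ F c = hi.
Proof.
move=> cE; apply: contrapT => /not_orP[nlo nhi].
have cin : lo < F c < hi.
  have /andP[h1 h2] := F_bounds c; rewrite !lt_neqAle h1 h2 !andbT.
  by apply/andP; split; apply/eqP => // /esym.
have [rho rho0 [r1 r2 r3]] : exists2 rho, 0 < rho & [/\ 2 * rho <= F c - lo, 2 * rho <= hi - F c &
    forall l : 'I_m.+1, 2 * rho <= high Q 0 (lift ord0 l) - low Q 0 (lift ord0 l)].
  have [s s0 hs] : exists2 s, 0 < s & forall k, (k < m.+1)%N -> forall l : 'I_m.+1, l = k :> nat ->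
      2 * s <= high Q 0 (lift ord0 l) - low Q 0 (lift ord0 l).
    apply: finite_radius => [k e e' le h l lk|k km]; first by have := h l lk; lra.
    exists ((high Q 0 (lift ord0 (Ordinal km)) - low Q 0 (lift ord0 (Ordinal km))) / 2) => [|l lk].
      by rewrite divr_gt0// subr_gt0 low_lt_high.
    by have -> : l = Ordinal km by [exact: val_inj]; lra.
  pose a := Num.min (F c - lo) (hi - F c).
  have a0 : 0 < a by rewrite lt_min !subr_gt0.
  have [a1 a2] : a <= F c - lo /\ a <= hi - F c by split; rewrite ge_min lexx ?orbT.
  pose rho := Num.min s (a / 2).
  have [b1 b2] : rho <= s /\ rho <= a / 2 by split; rewrite ge_min lexx ?orbT.
  exists rho; first by rewrite lt_min s0 divr_gt0.
  split; [lra|lra|move=> l; have := hs l (ltn_ord l) l erefl; lra].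
have [e e0 fe] := funif rho0; have e2 : 0 < e / 2 by rewrite divr_gt0.
have [s s0 hs] := near_face cE e2; have [s' s'0 hs'] := F_continuous rho0.
pose w := Num.min (Num.min s s') (hi - lo).
have w0 : 0 < w by rewrite !lt_min s0 s'0 subr_gt0.
have [w1 w2 w3] : [/\ w <= s, w <= s' & w <= hi - lo] by split; rewrite !ge_min lexx ?orbT.
have [a [b [ab la bh near]]] : exists a b : R, [/\ a < b, lo < a, b < hi &
    forall t, a <= t <= b -> `|t - c| < w].
  case: cE => ->; [exists (lo + w / 3), (lo + w / 2)|exists (hi - w / 2), (hi - w / 3)];
    split; try lra; by move=> t /andP[h1 h2]; rewrite ltr_norml; apply/andP; split; lra.
have [s1 s1ab Fs1] := F_not_constant (ltW la) ab (ltW bh) (F a).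
have [t' t'b good_t'] : exists2 t', Num.min (F a) (F s1) < t' < Num.max (F a) (F s1) & good t'.
  by apply: good_ex; case: (ltrgtP (F a) (F s1)) Fs1 => // ->.
have [t tas Ft] : exists2 t, a <= t <= s1 & F t = t'.
  by apply: F_cross; [case/andP: s1ab|case/andP: t'b => ? ?; rewrite !ltW].
have tab : a <= t <= b by case/andP: tas s1ab => ? ? /andP[? ?]; apply/andP; split; lra.
have tc := near t tab.
have tb : lo < t < hi by case/andP: tab => ? ?; apply/andP; split; lra.
have := hs' t c (lt_le_trans tc w2); rewrite Ft ltr_norml => /andP[h1 h2].
have t'b' : lo < t' < hi by apply/andP; split; lra.
have [gt' pre] := good_t'.
have [||||u [u' [ut uu' far]]] := distant_twins t'b' (pre t Ft) gt' finv (rho := rho).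
- by move=> q qt; exact: F_onto_slice Ft good_t' qt.
- lra.
- lra.
- exact: r3.
have [z Az uz] : exists2 z, A z & d (fold u) z < e / 2.
  by apply: hs; rewrite -/(hor u) ut; exact: lt_le_trans tc w1.
suff : dd (f u) (f u') < rho by rewrite ltNge far.
apply: fe; rewrite -(copyK u) -(copyK u') -uu'.
by apply: le_lt_trans (dd_through _ _ _ _ Az) _; rewrite (d_sym z); lra.
Qed.

(** The two ends are mapped to different ends: otherwise a good value would be
    attained on both sides of an extremum. *)
Let F_values t' : lo < t' < hi -> exists2 t, lo <= t <= hi & F t = t'.
Proof.
move=> /andP[t1 t2].
have [Flo Fhi] : (F lo = lo \/ F lo = hi) /\ (F hi = lo \/ F hi = hi).
  by split; apply: F_end; [left|right].
apply: F_cross; first exact: ltW.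
suff ne : F lo <> F hi.
  by case: Flo Fhi ne => -> [] -> // _; rewrite ?(min_l (ltW lohi)) ?(min_r (ltW lohi))
    ?(max_r (ltW lohi)) ?(max_l (ltW lohi)) !ltW.
move=> same; have [s sb Fs] := F_not_constant (lexx lo) lohi (lexx hi) (F lo).
have [v vb gv] : exists2 v, Num.min (F lo) (F s) < v < Num.max (F lo) (F s) & good v.
  by apply: good_ex; case: (ltrgtP (F lo) (F s)) Fs => // ->.
have [vlo vs] : v <> F lo /\ v <> F s.
  move: vb; rewrite gt_min lt_max => /andP[v1 v2].
  by split=> e; move: v1 v2; rewrite e ltxx /= ?orbF => v1 /=; rewrite ltNge (ltW v1).
have vw : Num.min (F lo) (F s) <= v <= Num.max (F lo) (F s) by case/andP: vb => ? ?; rewrite !ltW.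
have [s1 s2] := andP sb.
have [t tls Ft] := F_cross s1 vw.
have [t3 tsh Ft3] : exists2 t, s <= t <= hi & F t = v.
  by apply: F_cross => //; rewrite -same minC maxC.
have tlo : t <> lo by move=> e; apply: vlo; rewrite -Ft e.
have t3hi : t3 <> hi by move=> e; apply: vlo; rewrite -Ft3 e.
have ts : t <> s by move=> e; apply: vs; rewrite -Ft e.
have t3s : t3 <> s by move=> e; apply: vs; rewrite -Ft3 e.
have slt (x y : R) : x <= y -> x <> y -> x < y by rewrite lt_neqAle => -> /eqP ->.
have [q1 q2] := andP tls; have [q3 q4] := andP tsh.
have lt1 := slt _ _ q1 (nesym tlo); have lt2 := slt _ _ q2 ts.
have lt3 := slt _ _ q3 (nesym t3s); have lt4 := slt _ _ q4 t3hi.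
have vin : lo < v < hi.
  have /andP[b1 b2] := F_bounds s; have /andP[b3 b4] := F_bounds lo.
  by move: vb; rewrite gt_min lt_max => /andP[/orP[] ? /orP[] ?]; apply/andP; split; lra.
have : t = t3 by apply: (F_injective _ _ vin gv Ft Ft3); apply/andP; split; lra.
lra.
Qed.

(** The image is closed and contains all slices at good values. *)
Theorem qs_onto : range f = setT.
Proof.
rewrite -subTset => y _; suff [x xy] : exists x, f x = y by exists x.
apply: (qs_range_closed (@dd_ge0 _ _ Q) (@dd_sym _ _ Q) (@dd_triangle _ _ Q) (@dd_eq0 _ _ Q) fqs (dd_compact por)).
move=> e e0; have [c c0 [r0 r00 boxes]] := reg_boxes por.
pose r := Num.min (r0 / 2) e.
have [r1 r2] : r <= r0 / 2 /\ r <= e by split; rewrite ge_min lexx ?orbT.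
have rpos : 0 < r by rewrite lt_min divr_gt0.
have [|B regB] := boxes (fold y) r; first by rewrite rpos /=; lra.
have Blt := reg_box_lt c0 rpos regB; have [_ inB near] := regB.
have [t' t'b gt'] := good_ex (Blt ord0).
have [bl _ bh] := inB ord0; rewrite /= in bl bh.
have t'in : lo < t' < hi by case/andP: t'b => ? ?; apply/andP; split; lra.
pose z : V := upd (\row_i ((B.1 0 i + B.2 0 i) / 2)) ord0 t'.
have zB i : B.1 0 i < z 0 i < B.2 0 i.
  rewrite updE; case: eqP => [->//|_]; rewrite mxE; have := Blt i.
  by move=> h; apply/andP; split; lra.
have zb : cbox Q z by move=> i; have /andP[? ?] := zB i; have [? ? ?] := inB i; apply/andP; split; lra.
have gz : generic Q (z 0 ord0) by rewrite updE; case: gt'.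
have [q qz] := point_over zb (generic_off gz).
have dq : d (fold y) q < r by apply: near; rewrite qz.
have [t tb Ft] := F_values t'in.
have tin : lo < t < hi.
  case/andP: tb => b1 b2; rewrite !lt_neqAle b1 b2 !andbT.
  have ends c' : c' = lo \/ c' = hi -> t <> c'.
    by move=> c'E e'; have := F_end c'E; rewrite -e' Ft; case/andP: t'in => ? ? []; lra.
  by apply/andP; split; apply/eqP; [move/esym|]; apply: ends; [left|right].
have [|u _ uE] := F_onto_slice (x := copy (sheet y) q) tin t'in Ft gt'.
  by rewrite hor_copy qz updE.
by exists u; rewrite uE -[X in dd _ X](copyK y) dd_same d_sym; exact: lt_le_trans dq r2.
Qed.

End Surjectivity.

(** * The parameters of a sequence of slits *)
Section SlitData.
Variables (R : realType) (m : nat) (a b : 'rV[R]_m.+2) (s : nat -> set 'rV[R]_m.+2).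
Local Notation V := 'rV[R]_m.+2.
Local Notation ed := (@euclid_dist R m.+2).
Hypothesis ab : forall i, a 0 i < b 0 i.
Hypothesis sin : forall i, s i `<=` open_box a b.

Definition slit_of (x l : R) (c : V) : set V := [set y : V | forall i : 'I_m.+2,
  if i == ord0 then y 0 i = x else c 0 i <= y 0 i <= c 0 i + l].

Lemma is_slitP E : is_slit E -> exists P : R * R * V, 0 < P.1.2 /\ E = slit_of P.1.1 P.1.2 P.2.
Proof.
move=> [x [l [c [d [l0 cd ->]]]]]; exists (x, l, c); split=> //.
apply/seteqP; split=> y h i; have := h i; rewrite -(inj_eq val_inj) /=; case: eqP => // /eqP i0.
  by rewrite -(cd i i0) addrC subrK.
by rewrite -(cd i i0) addrC subrK.
Qed.

Lemma diam_slit j (x l : R) (c : V) : 0 < l -> s j = slit_of x l c -> l <= diam ed (s j).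
Proof.
move=> l0 sE; pose z (v : R) : V := \row_i if i == ord0 then x else c 0 i + v * l.
have zin v : 0 <= v <= 1 -> s j (z v).
  move=> /andP[v0 v1]; rewrite sE => i; rewrite mxE; case: eqP => // _.
  by apply/andP; split; [rewrite lerDl mulr_ge0 ?(ltW l0)|rewrite lerD2l ger_pMl].
have [z0 z1] : s j (z 0) /\ s j (z 1) by split; apply: zin; rewrite ?lexx ?ler01.
apply: le_trans (_ : ed (z 0) (z 1) <= _).
  apply: le_trans (coord_le_ed (z 0) (z 1) (i1 m)); rewrite !mxE /= mul0r mul1r addr0.
  by rewrite opprD addrA subrr sub0r normrN gtr0_norm.
apply: ub_le_sup; last by exists (z 0) => //; exists (z 1).
exists (\sum_i (b 0 i - a 0 i)) => _ [y1 y1s [y2 y2s <-]].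
apply: le_trans (ed_le_sum _ _) _; apply: ler_sum => i _.
have /andP[? ?] := sin y1s i; have /andP[? ?] := sin y2s i.
by rewrite ler_norml; apply/andP; split; lra.
Qed.

Lemma rel_sep_dist (sigma : R) j k y z : 0 < sigma ->
  sigma <= rel_dist ed (s j) (s k) -> 0 < diam ed (s j) -> 0 < diam ed (s k) -> s j y -> s k z ->
  sigma * Num.min (diam ed (s j)) (diam ed (s k)) <= ed y z.
Proof.
move=> s0 + dj dk sy sz; rewrite /rel_dist ler_pdivlMr ?lt_min ?dj// => /le_trans; apply.
apply: ge_inf; last by exists y => //; exists z.
by exists 0 => _ [? _ [? _ <-]]; exact: ed_ge0.
Qed.

(** The length of a slit is at most its diameter. *)
Lemma slits_exist : (forall i, is_slit (s i)) -> uniformly_rel_separated (open_box a b) s ->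
  exists Q : slits R m, [/\ low Q = a, high Q = b & sset Q = s].
Proof.
move=> /(fun h i => is_slitP (h i)) /choice[P PE] [sigma s0 [sep _]].
have l0 j : 0 < (P j).1.2 by case: (PE j).
have sE j : s j = slit_of (P j).1.1 (P j).1.2 (P j).2 by case: (PE j).
have dj j := diam_slit (l0 j) (sE j).
unshelve eexists (@Slits R m a b ab s (fun j => (P j).1.1) (fun j => (P j).1.2) (fun j => (P j).2) l0 sE
  sin sigma s0 _) => //.
move=> j k y z jk sy sz; have hj := lt_le_trans (l0 j) (dj j); have hk := lt_le_trans (l0 k) (dj k).
apply: le_trans (rel_sep_dist s0 (sep _ _ jk) hj hk sy sz).
by rewrite ler_pM2l// le_min !ge_min (dj j) (dj k) orbT.
Qed.

End SlitData.

Theorem theorem1p5 (R : realType) (n : nat) (hn : (2 <= n)%N)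
    (a b : 'rV[R]_n) (hab : forall i, a 0 i < b 0 i)
    (s : nat -> set 'rV[R]_n)
    (hs : slits_in (open_box a b) s)
    (hsep : uniformly_rel_separated (open_box a b) s)
    (hdiam : vanishing_diam s)
    (hdense : slits_dense (open_box a b) s)
    (hporous : porous (@slit_dist R n (open_box a b) s)
                 (@peripheral_spheres R n (open_box a b) s)) :
  qs_co_hopfian
    (@double_dist R (slit_space (open_box a b) s)
       (@slit_dist R n (open_box a b) s)
       (@outer_boundary R n (open_box a b) s)).
Proof.
case: n hn a b hab s hs hsep hporous {hdiam hdense} => [//|[//|m]] _ a b hab s [slit sin _] sep por.
have [Q [aE bE sE]] := slits_exist hab sin slit sep.
move: por; rewrite -aE -bE -sE => por f fqs.
have dE : @slit_dist R m.+2 (open_box (low Q) (high Q)) (sset Q) = @d R m Q.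
  by apply/funext => p; apply/funext => q; rewrite d_def.
apply: (qs_onto por); move: fqs; rewrite dE.
suff -> : @double_dist R _ (@d R m Q) (@outer_boundary R m.+2 (open_box (low Q) (high Q)) (sset Q)) =
    @dd R m Q by [].
by apply/funext => x; apply/funext => y; rewrite dd_def.
Qed.
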